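(* Assume that $\mathbf{E}\xi_i(1)=0$ and $\sigma_i^2=\mathbf{E}\xi_i(1)^2<\infty$ for $i=1,2$. Let $x,b\in(0,1)$, $s>0$, $s_i=\sqrt{2s}/\sigma_i$ for $i=1,2$, and $\overline b=1-b$. Consider the oscillating process with switching level $bB$, started from $xB$, and its first exit time $\chi_{xB}(bB)$ from $[0,B]$; $\underline A$ and $\overline A$ denote exit through the lower, respectively upper, boundary. Then as $B\to\infty$: for $x\in(0,b]$, $$\mathbf{E}\left[e^{-s\chi_{xB}(bB)/B^2};\underline A\right]\to\frac{\sigma_1\sinh((b-x)s_1)\cosh(\overline bs_2)+\sigma_2\sinh(\overline bs_2)\cosh((b-x)s_1)}{\sigma_1\sinh(bs_1)\cosh(\overline bs_2)+\sigma_2\sinh(\overline bs_2)\cosh(bs_1)},$$ $$\mathbf{E}\left[e^{-s\chi_{xB}(bB)/B^2};\overline A\right]\to\frac{\sigma_1\sinh(xs_1)}{\sigma_1\sinh(bs_1)\cosh(\overline bs_2)+\sigma_2\sinh(\overline bs_2)\cosh(bs_1)};$$ and for $x\in[b,1)$, $$\mathbf{E}\left[e^{-s\chi_{xB}(bB)/B^2};\overline A\right]\to\frac{\sigma_1\sinh(bs_1)\cosh((x-b)s_2)+\sigma_2\sinh((x-b)s_2)\cosh(bs_1)}{\sigma_1\sinh(bs_1)\cosh(\overline bs_2)+\sigma_2\sinh(\overline bs_2)\cosh(bs_1)},$$ $$\mathbf{E}\left[e^{-s\chi_{xB}(bB)/B^2};\underline A\right]\to\frac{\sigma_2\sinh((1-x)s_2)}{\sigma_1\sinh(bs_1)\cosh(\overline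 bs_2)+\sigma_2\sinh(\overline bs_2)\cosh(bs_1)}.$$
   Context: Underlying processes. For $i=1,2$ let $\xi_i(t)=\sum_{k=0}^{N_i(t)}\xi^i_k-a_it$, $t\ge0$, where $a_i>0$, $\xi^i_0=0$, $(\xi^i_k)_{k\ge1}$ are i.i.d. strictly positive random variables with distribution function $F_i$, and $N_i$ is a Poisson process of rate $\lambda_i$, $N_i(0)=0$, independent of $(\xi^i_k)$. Passage times. $\inf\emptyset=\infty$. $\tau_i^-(x)=\inf\{t:\xi_i(t)\le-x\}$; $\tau_i^+(x)=\inf\{t:\xi_i(t)>x\}$, $T_i^+(x)=\xi_i(\tau_i^+(x))-x$, for $x\ge0$. Oscillating process. For a fixed switching level $b>0$ and $x\in\mathbb{R}$, $\xi(x,t)$, $t\ge0$, $\xi(x,0)=x$, is defined recursively. If $x>b$: $\xi(x,t)=x+\xi_2(t)$ for $0\le t<\tau_2^-(x-b)$ and $\xi(x,t)=\xi(b,t-\tau_2^-(x-b))$ for $t\ge\tau_2^-(x-b)$. If $x\le b$: $\xi(x,t)=x+\xi_1(t)$ for $0\le t<\tau_1^+(b-x)$ and $\xi(x,t)=\xi(b+T_1^+(b-x),t-\tau_1^+(b-x))$ for $t\ge\tau_1^+(b-x)$. At each switching time the process restarts afresh from its current position, independently of the past given that position (strong Markov property), so it moves like $\xi_2$ when above $b$ until it hits $b$, and like $\xi_1$ when at or below $b$ until it jumps above $b$. Exit functionals. For $B>0$ and the process with switching level $b\in[0,B]$ started from $x\in[0,B]$: $\chi_x(b)=\inf\{t:\xi(x,t)\notin[0,B]\}$;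 $\overline A=\{\xi(x,\chi_x(b))>B\}$; $\underline A=\{\xi(x,\chi_x(b))\le0\}$. In the claim this is applied with $x,b$ replaced by $xB,bB$ (the laws of $\xi_1,\xi_2$ do not depend on $B$). *)

(* Defs.v *)
From HB Require Import structures.
From mathcomp Require Import all_boot all_order all_algebra.
From mathcomp Require Import all_classical all_reals all_analysis.

Set Implicit Arguments.
Unset Strict Implicit.
Unset Printing Implicit Defensive.

Import Order.TTheory GRing.Theory Num.Theory.
Import numFieldNormedType.Exports.

Local Open Scope classical_set_scope.
Local Open Scope ring_scope.

Section Hyperbolic.
Context {R : realType}.

Definition sinh (x : R) : R := (expR x - expR (- x)) / 2.
Definition cosh (x : R) : R := (expR x + expR (- x)) / 2.

End Hyperbolic.

Section Independence.
Context {d : measure_display} {Omega : measurableType d} {R : realType}.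

Definition sigma_generated {d' : measure_display} {T : measurableType d'}
    {I : Type} (D : set I) (X : I -> Omega -> T) : set (set Omega) :=
  <<s \bigcup_(i in D) preimage_set_system setT (X i) measurable >>.

Definition independent_family (P : probability Omega R) {I : choiceType}
    (G : I -> set (set Omega)) : Prop :=
  forall (K : seq I) (A : I -> set Omega), uniq K ->
    (forall i, i \in K -> G i (A i)) ->
    P (\big[setI/setT]_(i <- K) A i) = (\prod_(i <- K) P (A i))%E.

Definition independent2 (P : probability Omega R)
    (G H : set (set Omega)) : Prop :=
  forall A B, G A -> H B -> P (A `&` B) = (P A * P B)%E.

End Independence.

Section CompoundPoisson.
Context {d : measure_display} {Omega : measurableType d} {R : realType}.
Variable P : probability Omega R.

Definition time_set : set R := [set t | 0 <= t].

(* Only times t >= 0 matter. The increment over (s, t] is compared through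
   N t = N s + k because subtraction on nat is truncated, and s < t is strict
   because poisson_pmf is not the Dirac mass at 0 when its rate is 0. *)
Definition poisson_process (lambda : R) (N : R -> {RV P >-> nat}) : Prop :=
  [/\ forall w, N 0 w = 0%N,
      forall w (s t : R), 0 <= s -> s <= t -> (N s w <= N t w)%N,
      forall w (t : R), 0 <= t -> \forall u \near t^'+, N u w = N t w,
      forall (s t : R) k, 0 <= s -> s < t ->
        P [set w | N t w = (N s w + k)%N]
          = (poisson_pmf (lambda * (t - s)) k)%:E
    & forall t : nat -> R, 0 <= t 0%N -> {homo t : m n / (m <= n)%N >-> m <= n} ->
        independent_family P (fun m : nat =>
          sigma_generated [set: unit]
            (fun=> fun w => (N (t m.+1) w - N (t m) w)%N))].

(* J k is the (k+1)-st jump. *)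
Definition compound_poisson (lambda : R) (F : R -> R)
    (N : R -> {RV P >-> nat}) (J : nat -> {RV P >-> R}) : Prop :=
  [/\ poisson_process lambda N,
      forall k w, 0 < J k w,
      forall k y, cdf (J k) y = (F y)%:E,
      independent_family P (fun k : nat =>
        sigma_generated [set: unit] (fun=> J k : Omega -> R))
    & independent2 P
        (sigma_generated time_set (fun t => N t : Omega -> nat))
        (sigma_generated setT (fun k => J k : Omega -> R))].

Definition drifted_path (a : R) (N : R -> {RV P >-> nat})
    (J : nat -> {RV P >-> R}) (t : R) (w : Omega) : R :=
  \sum_(k < N t w) J k w - a * t.

(* All the randomness of one copy of the process: its clock and its jumps. *)
Definition copy_sigma (N : R -> {RV P >-> nat}) (J : nat -> {RV P >-> R}) :
    set (set Omega) :=
  <<s sigma_generated time_set (fun t => N t : Omega -> nat)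
      `|` sigma_generated setT (fun k => J k : Omega -> R) >>.

End CompoundPoisson.

Section PassageTimes.
Context {R : realType}.

(* ereal_inf set0 = +oo. *)
Definition tau_minus (f : R -> R) (x : R) : \bar R :=
  ereal_inf [set t%:E | t in [set t | 0 <= t /\ f t <= - x]].

Definition tau_plus (f : R -> R) (x : R) : \bar R :=
  ereal_inf [set t%:E | t in [set t | 0 <= t /\ x < f t]].

(* Meaningful only when tau_plus f x is finite. *)
Definition overshoot (f : R -> R) (x : R) : R := f (fine (tau_plus f x)) - x.

End PassageTimes.

(* The regime of a position y with switching level b is the boolean b < y. *)
Definition below : bool := false.
Definition above : bool := true.

Section Oscillating.
Context {R : realType}.
Variable b : R.

(* Duration of the stage started at y, and position at which the next stage
   starts; f i is the path driving regime i. *)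
Definition stage_step (f : bool -> R -> R) (y : R) : \bar R * R :=
  if b < y then (tau_minus (f above) (y - b), b)
  else (tau_plus (f below) (b - y), b + overshoot (f below) (b - y)).

(* f i n is the path available to regime i during the n-th stage: each switch
   uses new paths, which is the restart from the current position.
   stage f x n is the time at which the n-th stage starts (+oo if it is never
   reached) and its starting position. *)
Fixpoint stage (f : bool -> nat -> R -> R) (x : R) (n : nat) : \bar R * R :=
  if n is m.+1 then
    let: (T, y) := stage f x m in
    let: (D, y') := stage_step (fun i => f i m) y in
    ((T + D)%E, y')
  else (0%E, x).

(* The recursive definition unrolled: at time t the process is in the stage n
   with T_n <= t < T_(n+1). Such an n is unique; it fails to exist only if the
   switching times accumulate before t, an event of probability zero, on which
   the value is irrelevant. *)
Definition oscillating (f : bool -> nat -> R -> R) (x t : R) : R :=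
  let n := get [set n : nat |
    ((stage f x n).1 <= t%:E)%E /\ (t%:E < (stage f x n.+1).1)%E] in
  let: (T, y) := stage f x n in
  y + f (b < y) n (t - fine T).

End Oscillating.

Section Exit.
Context {R : realType}.

Definition exit_time (X : R -> R) (B : R) : \bar R :=
  ereal_inf [set t%:E | t in [set t | 0 <= t /\ ~~ (0 <= X t <= B)]].

Definition exits_below (X : R -> R) (B : R) : Prop :=
  (exit_time X B < +oo)%E /\ X (fine (exit_time X B)) <= 0.

Definition exits_above (X : R -> R) (B : R) : Prop :=
  (exit_time X B < +oo)%E /\ B < X (fine (exit_time X B)).

End Exit.

Section ExitTransform.
Context {d : measure_display} {Omega : measurableType d} {R : realType}.
Variable P : probability Omega R.

(* E[exp(- r chi); A], where chi is the first exit time of X from [0, B] and A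
   is an event on which chi is finite. *)
Definition exit_transform (r : R) (X : Omega -> R -> R) (B : R)
    (A : set Omega) : \bar R :=
  (\int[P]_(w in A) (expR (- (r * fine (exit_time (X w) B))))%:E)%E.

End ExitTransform.

(* Main.v *)
Require Import Defs.
From HB Require Import structures.
From mathcomp Require Import all_boot all_order all_algebra.
From mathcomp Require Import all_classical all_reals all_analysis.
From mathcomp Require Import measurable_realfun.
From mathcomp Require Import ring lra.

(** The limits are the boundary value problem of a diffusion that is seen through
    the generators of the two compound Poisson processes.

    Let [u] be the C^1 function with [u'' = s_1 ^ 2 u] below the switching level
    and [u'' = s_2 ^ 2 u] above it, with prescribed value and slope at that level
    ([osc_sol]). Since the drift of [xi_i] compensates its jumps, the generator of
    [xi_i] applied to [y |-> u (y / B)] is [sigma_i ^ 2 u'' / (2 B ^ 2)] up to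
    [o (B ^ (- 2))], and this is [s u / B ^ 2] on both sides. So the discounted
    process [exp (- s t / B ^ 2) u (xi t / B)] is almost a martingale up to the exit.
    At the exit [u] has nearly one of its two boundary values: the lower end is
    reached exactly, and just above the upper end [u] is continued by a constant
    ([clamp]), which makes the overshoot harmless. The jumps too long for a Taylor
    expansion of [u] are charged to their truncated second moment.
    This gives, in coordinates centred at [b],
    [u (- b) * lower + u (1 - b) * upper --> u (x - b)].
    The two choices of [u] with boundary values (1, 0) and (0, 1) are the four
    formulas of the statement.

    Only supersolutions are needed, because the bound for [- u] is the other half.
    Two difficulties shape the argument.

    - The second derivative of [u] jumps at the switching level, and jumps of the
      process across it are seen from below with the wrong curvature. A small
      concave correction, strongly curved near the level, makes [u] a supersolution
      of the discrete generator ([test_function], [barrier_supersolution]).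

    - The process is given by paths, not by a Markov semigroup. A stage, driven by
      one copy of the paths, is observed on a grid of mesh [h]. From one grid point
      to the next, at most one jump matters ([one_step]), and a supersolution of the
      generator increases by [O (h ^ 2)] only ([step_of_generator]); summing over the
      grid and refining it bounds a whole stage ([stage_supermartingale]). Stages are
      chained by conditioning on the copies used before ([chain_supermartingale]),
      and the chain follows the oscillating process up to its exit
      ([chain_exit_value]), because almost surely infinitely many stages last at
      least one unit of time ([prob_quiet_event]). The resulting inequality is
      [transform_supersolution].

    The scale enters through the moments of the jumps: zero mean and finite variance
    of [xi_i (1)] give [lambda_i E J = a_i] and [sigma_i ^ 2 = lambda_i E J ^ 2]
    ([drift_balance], [drifted_variance]). *)

Set Implicit Arguments.
Unset Strict Implicit.
Unset Printing Implicit Defensive.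

Import Order.TTheory GRing.Theory Num.Theory.
Import numFieldNormedType.Exports.

Local Open Scope classical_set_scope.
Local Open Scope ring_scope.

(** * Sigma-algebras, independence and integration *)

Section PiSystem.
Context {d : measure_display} {Omega : measurableType d} {R : realType}.
Variable P : probability Omega R.
Implicit Types (G : set (set Omega)).

(** Uniqueness of finite measures on a pi-system, for the measure
    [E |-> P (E `&` F)] and a multiple of [P]. With [c] the probability of [F]
    it extends independence from generators to the generated sigma-algebra. *)
Lemma pi_system_proportional G (F : set Omega) (c : {nonneg R}) :
  G `<=` measurable -> setI_closed G -> G setT -> measurable F ->
  (forall E, G E -> P (E `&` F) = (c%:num%:E * P E)%E) ->
  forall E, <<s G >> E -> P (E `&` F) = (c%:num%:E * P E)%E.
Proof.
move=> Gm GI GT mF GE E sE.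
have := @g_sigma_algebra_measure_unique _ _ _ G Gm (fun=> setT) _ _
  (mrestr P mF) (mscale c P) GI _ _ E sE; apply => //.
- by rewrite bigcup_const.
- move=> _; apply: le_lt_trans (ltry 1); rewrite /= /mrestr setTI.
  exact: probability_le1.
Qed.

Lemma sub_gen_measurable G : G `<=` measurable -> <<s G >> `<=` measurable.
Proof. by move=> Gm; apply: smallest_sub => //; exact: sigma_algebra_measurable. Qed.

(** The finite intersections of events taken from the [G i] with [i] in [D] form
    a pi-system that generates the join, and on it independence from [G k] is
    the product rule for finite subfamilies. *)
Lemma independent_prefix (I : choiceType) (G : I -> set (set Omega))
    (D : set I) (k : I) :
  (forall i, sigma_algebra setT (G i)) -> (forall i, G i `<=` measurable) ->
  independent_family P G -> ~ D k ->
  independent2 P <<s \bigcup_(i in D) G i >> (G k).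
Proof.
move=> sG mG indG nDk E F sE GF.
have GT i : G i setT.
  have [G0 GC _] := sG i; by rewrite -(setD0 setT); exact: GC.
have GI i A B : G i A -> G i B -> G i (A `&` B).
  have := sG i; move=> sGi GA GB.
  have := @measurableI _ (g_sigma_algebraType (G i)) A B.
  by rewrite /measurable /= (sigma_algebra_id sGi); apply.
pose Pi : set (set Omega) := [set E | exists K (A : I -> set Omega), [/\ uniq K,
  forall i, i \in K -> D i, forall i, G i (A i)
  & E = \bigcap_(i in [set` K]) A i]].
have PiE H : Pi H -> P (H `&` F) = (P H * P F)%E.
  case=> K [A [uK KD GA ->]].
  have kK : k \notin K by apply/negP => /KD.
  pose A' i := if i == k then F else A i.
  have A'E i : i \in K -> A' i = A i.
    by rewrite /A'; case: eqP => // -> kK'; rewrite kK' in kK.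
  have /= := indG (k :: K) A'; rewrite kK uK => /(_ erefl) indK.
  rewrite setIC; transitivity (P (\big[setI/setT]_(i <- k :: K) A' i)).
    congr (P _); rewrite big_cons -bigcap_seq {1}/A' eqxx; congr (_ `&` _).
    by apply: eq_bigcapr => i /= iK; rewrite A'E.
  rewrite indK; last first.
    move=> i; rewrite inE => /predU1P[->|iK]; first by rewrite /A' eqxx.
    by rewrite A'E.
  rewrite big_cons {1}/A' eqxx muleC; congr (_ * _)%E.
  rewrite bigcap_seq indG//; rewrite [LHS]big_seq_cond [RHS]big_seq_cond.
  by apply: eq_bigr => i /andP[iK _]; rewrite A'E.
have mPi : Pi `<=` measurable.
  move=> _ [K [A [_ _ GA ->]]]; rewrite bigcap_seq.
  by apply: bigsetI_measurable => i _; exact: (mG i).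
have PiI : setI_closed Pi.
  move=> _ _ [K [A [uK KD GA ->]]] [L [B [uL LD GB ->]]].
  pose C i := (if i \in K then A i else setT) `&` (if i \in L then B i else setT).
  exists (undup (K ++ L)), C; split.
  - exact: undup_uniq.
  - by move=> i; rewrite mem_undup mem_cat => /orP[/KD|/LD].
  - by move=> i; apply: GI; case: ifP.
  - apply/seteqP; split => [w [Aw Bw] i /=|w Cw].
      rewrite mem_undup mem_cat => _; split; case: ifPn => // ?;
        by [exact: Aw|exact: Bw].
    split=> i /= iK; (have /Cw : [set` undup (K ++ L)] i
      by rewrite /= mem_undup mem_cat iK ?orbT); rewrite /C iK.
    - by case.
    - by case.
have PF : (fine (P F))%:E = P F by rewrite fineK// fin_num_measure//; exact: mG GF.
have F0 : 0 <= fine (P F) by rewrite fine_ge0.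
rewrite muleC -PF.
apply: (@pi_system_proportional Pi F (NngNum F0)) => //.
- by exists [::], (fun=> setT); split => //; rewrite set_nil bigcap_set0.
- exact: (mG k).
- by move=> H PiH; rewrite PiE//= PF muleC.
- move: E sE; apply: smallest_sub; first exact: smallest_sigma_algebra.
  move=> H [i Di GiH]; apply: sub_sigma_algebra.
  exists [:: i], (fun j => if j == i then H else setT); split => //.
  + by move=> j; rewrite inE => /eqP->.
  + by move=> j; case: eqP => [->|].
  + by rewrite bigcap_seq big_seq1 eqxx.
Qed.

End PiSystem.

Lemma bounded_integrable_fin {R : realType} d (T : measurableType d)
    (Q : {measure set T -> \bar R}) (f : T -> R) (M : R) :
  (Q setT < +oo)%E -> measurable_fun setT f -> (forall w, `|f w| <= M) ->
  Q.-integrable setT (EFin \o f).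
Proof.
move=> Qfin mf fM; apply: measurable_bounded_integrable => //.
exists M; split; first exact: num_real.
by move=> x Mx w _; apply: le_trans (fM w) (ltW Mx).
Qed.

Lemma bounded_integrable {R : realType} d (T : measurableType d)
    (Q : probability T R) (f : T -> R) (M : R) :
  measurable_fun setT f -> (forall w, `|f w| <= M) ->
  Q.-integrable setT (EFin \o f).
Proof.
by apply: bounded_integrable_fin; rewrite -ge0_fin_numE// fin_num_measure.
Qed.

Lemma Rintegral_prob_cst {R : realType} d (T : measurableType d)
    (Q : probability T R) (c : R) : \int[Q]_w c = c.
Proof.
by rewrite Rintegral_cst// (_ : fine _ = 1) ?mulr1//= probability_setT.
Qed.

Lemma Rintegral_bounded {R : realType} d (T : measurableType d)
    (Q : probability T R) (f : T -> R) (M : R) :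
  measurable_fun setT f -> (forall w, `|f w| <= M) ->
  `|\int[Q]_w f w| <= M.
Proof.
move=> mf fM; have intf := bounded_integrable Q mf fM.
apply: le_trans (le_normr_Rintegral measurableT intf) _.
rewrite -[leRHS](Rintegral_prob_cst Q).
apply: le_Rintegral => //; first exact: integrable_norm.
by apply: (@bounded_integrable _ _ _ Q (fun=> M) `|M|).
Qed.

Section SubSigmaAlgebra.
Context {d : measure_display} {Omega : measurableType d} {R : realType}.
Variable P : probability Omega R.
Variable G : set (set Omega).
Hypothesis Gm : G `<=` measurable.

Local Notation OmG := (g_sigma_algebraType G).

Lemma sub_measurable_fun d' (T : measurableType d') (f : Omega -> T) :
  measurable_fun setT (f : OmG -> T) -> measurable_fun setT f.
Proof.
move=> mf _ B mB; have := mf measurableT B mB.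
exact: sub_gen_measurable.
Qed.

Let mid : measurable_fun setT (id : Omega -> OmG).
Proof. by move=> _ B mB; rewrite setTI preimage_id; exact: (sub_gen_measurable Gm mB). Qed.

Context {d' : measure_display} {T : measurableType d'}.
Variable V : Omega -> T.
Hypothesis mV : measurable_fun setT V.
Hypothesis indep : forall E D, <<s G >> E -> measurable D ->
  P (E `&` V @^-1` D) = (P E * P (V @^-1` D))%E.

Let idG : {mfun Omega >-> OmG} :=
  HB.pack (id : Omega -> OmG) (isMeasurableFun.Build _ _ _ _ _ mid).
Let V' : {mfun Omega >-> T} := HB.pack V (isMeasurableFun.Build _ _ _ _ _ mV).

Let mZ : measurable_fun setT ((fun w => (w, V w)) : Omega -> OmG * T).
Proof. exact: measurable_fun_pair. Qed.

Let Z : {mfun Omega >-> (OmG * T)%type} :=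
  HB.pack ((fun w => (w, V w)) : Omega -> OmG * T)
    (isMeasurableFun.Build _ _ _ _ _ mZ).
Let m1 := distribution P idG.
Let m2 := distribution P V'.

Let mZE X : measurable X -> (m1 \x m2)%E X = distribution P Z X.
Proof.
move: X; apply: product_measure_unique => A B mA mB.
by rewrite /m1 /m2 /distribution /pushforward /= -indep.
Qed.

(** The law of [w |-> (w, V w)] is a product when the first coordinate carries
    only the sigma-algebra generated by [G]; integrals therefore split by Tonelli,
    and by Fubini in the bounded case below, for every [phi] that sees its first
    argument through [G]. *)
Lemma ge0_independent_integral (phi : Omega * T -> \bar R) :
  measurable_fun setT (phi : OmG * T -> \bar R) -> (forall z, 0 <= phi z)%E ->
  (\int[P]_w phi (w, V w) = \int[P]_w \int[P]_w' phi (w, V w'))%E.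
Proof.
move=> mphi phi0.
transitivity (\int[distribution P Z]_z phi z)%E.
  by rewrite ge0_integral_distribution.
transitivity (\int[(m1 \x m2)%E]_z phi z)%E.
  by apply: eq_measure_integral => A mA _; exact: esym (mZE mA).
rewrite fubini_tonelli1// ge0_integral_distribution//; last 2 first.
- exact: measurable_fun_fubini_tonelli_F.
- by move=> w; exact: integral_ge0.
apply: eq_integral => w _; rewrite /= /fubini_F ge0_integral_distribution//.
exact: (measurableT_comp mphi (pair1_measurable (w : OmG))).
Qed.

Lemma independent_integral (phi : Omega * T -> R) (M : R) :
  measurable_fun setT (phi : OmG * T -> R) -> (forall z, `|phi z| <= M) ->
  \int[P]_w phi (w, V w) = \int[P]_w \int[P]_w' phi (w, V w').
Proof.
move=> mphi phiM.
have iZ : (distribution P Z).-integrable setT (EFin \o phi).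
  apply: (@bounded_integrable _ _ _ (distribution P Z) phi M) => //.
have iphi : (m1 \x m2)%E.-integrable setT (EFin \o phi).
  apply: (@bounded_integrable_fin _ _ _ (m1 \x m2)%E phi M) => //.
  rewrite [X in (X < _)%E](@mZE setT)//.
  by rewrite -ge0_fin_numE// fin_num_measure.
have mphi2 w : measurable_fun setT (fun v => phi (w, v)).
  exact: (measurableT_comp mphi (pair1_measurable (w : OmG))).
have mphi2' w' : measurable_fun setT (fun w : OmG => phi (w, V w')).
  exact: (measurableT_comp mphi (pair2_measurable (V w'))).
pose g w := \int[P]_w' phi (w, V w').
have gE w : (g w)%:E = (\int[m2]_v (phi (w, v))%:E)%E.
  rewrite integral_distribution//=.
  - rewrite /g /Rintegral fineK//; apply: integrable_fin_num => //.
    apply: (@bounded_integrable _ _ _ P (fun w' => phi (w, V w')) M) => //.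
    exact: (measurableT_comp (mphi2 w) mV).
  - exact/measurable_EFinP.
  - apply: (@bounded_integrable _ _ _ P (fun w' => phi (w, V w')) M) => //.
    exact: (measurableT_comp (mphi2 w) mV).
have mg : measurable_fun setT (g : OmG -> R).
  apply/measurable_EFinP; apply: eq_measurable_fun (measurable_fubini_F iphi).
  by move=> w _; rewrite /= gE.
have gM w : `|g w| <= M.
  apply: Rintegral_bounded (fun w' => phiM _).
  exact: (measurableT_comp (mphi2 w) mV).
have mgO : measurable_fun setT g by exact: sub_measurable_fun.
congr fine.
transitivity (\int[distribution P Z]_z (phi z)%:E)%E.
  rewrite integral_distribution//; first exact/measurable_EFinP.
  apply: (@bounded_integrable _ _ _ P (fun w => phi (w, V w)) M) => //.
  exact: (measurableT_comp mphi mZ).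
transitivity (\int[(m1 \x m2)%E]_z (phi z)%:E)%E.
  by apply: eq_measure_integral => A mA _; exact: esym (mZE mA).
rewrite -integral12_prod_meas1//.
transitivity (\int[m1]_w (g w)%:E)%E.
  by apply: eq_integral => w _; rewrite gE.
rewrite integral_distribution//; last first.
  exact: (@bounded_integrable _ _ _ P g M).
exact/measurable_EFinP.
Qed.

End SubSigmaAlgebra.

Section NatValued.

Lemma measurable_nat_case d d' (T : measurableType d) (T' : measurableType d')
    (f : T -> nat) (g : nat -> T -> T') :
  measurable_fun setT f -> (forall n, measurable_fun setT (g n)) ->
  measurable_fun setT (fun w => g (f w) w).
Proof.
move=> mf mg _ B mB; rewrite setTI.
have -> : (fun w => g (f w) w) @^-1` B
    = \bigcup_n (f @^-1` [set n] `&` (g n) @^-1` B).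
  apply/seteqP; split => [w Bw|w [n _ [/= <- //]]].
  by exists (f w).
apply: bigcup_measurable => n _; apply: measurableI.
  by rewrite -[X in measurable X]setTI; exact: mf.
by rewrite -[X in measurable X]setTI; exact: mg.
Qed.

Lemma probability_nat_split d (T : measurableType d) (R : realType)
    (P : probability T R) (f : T -> nat) (X : set T) :
  measurable_fun setT f -> measurable X ->
  P X = (\sum_(m <oo) P (X `&` f @^-1` [set m]))%E.
Proof.
move=> mf mX.
have mfm m : measurable (f @^-1` [set m]).
  by rewrite -[X in measurable X]setTI; exact: mf.
have XE : X = \bigcup_m (X `&` f @^-1` [set m]).
  by apply/seteqP; split => [w Xw|w [n _ []//]]; exists (f w).
rewrite {1}XE; apply: measure_semi_bigcup.
- by move=> m; exact: measurableI.
- exact: trivIset_preimage1_in.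
- by rewrite -XE.
Qed.

(** The rays [`]-oo, y]] form a pi-system that generates the Borel sets. *)
Lemma eq_probability_cdf (R : realType) (mu nu : {measure set R -> \bar R}) :
  (mu setT < +oo)%E ->
  (forall y, mu `]-oo, y]%classic = nu `]-oo, y]%classic) ->
  forall D, measurable D -> mu D = nu D.
Proof.
move=> muoo munu D mD.
pose G : set (set R) := [set A | exists y, A = `]-oo, y]%classic].
have GE : @measurable _ R = <<s G >>.
  apply: etrans (RGenOInfty.measurableE R) _; apply/seteqP; split.
    apply: smallest_sub; first exact: smallest_sigma_algebra.
    move=> _ [x ->]; rewrite -[X in <<s _ >> X]setCK setCitvr.
    by apply: sigma_algebraC; apply: sub_sigma_algebra; exists x.
  apply: smallest_sub; first exact: smallest_sigma_algebra.
  move=> _ [x ->]; rewrite (_ : `]-oo, x]%classic = ~` `]x, +oo[%classic).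
    by apply: sigma_algebraC; apply: sub_sigma_algebra; exists x.
  by rewrite setCitvr.
apply: (measure_unique G (fun n => `]-oo, n%:R]%classic)) => //.
- move=> _ _ [x ->] [y ->]; exists (Num.min x y).
  by apply/seteqP; split => z /=; rewrite !in_itv/= le_min => /andP.
- by move=> n; exists n%:R.
- rewrite -subTset => x _; exists (Num.bound `|x|) => //=.
  by rewrite in_itv/= (le_trans (ler_norm x))// ltW// archi_boundP.
- by move=> _ [y ->].
- by move=> n; apply: le_lt_trans muoo; apply: le_measure => //; rewrite inE //.
Qed.

End NatValued.

Section Sigma.
Context {d : measure_display} {Omega : measurableType d}.
Implicit Types (G H : set (set Omega)).

Definition measurable_wrt d' (T : measurableType d') G (f : Omega -> T) :=
  measurable_fun setT (f : g_sigma_algebraType G -> T).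

Lemma sigma_mono G H : G `<=` <<s H >> -> <<s G >> `<=` <<s H >>.
Proof. by apply: smallest_sub; exact: smallest_sigma_algebra. Qed.

Lemma measurable_wrt_mono d' (T : measurableType d') G H (f : Omega -> T) :
  G `<=` <<s H >> -> measurable_wrt G f -> measurable_wrt H f.
Proof.
by move=> GH mf _ B mB; apply: (sigma_mono GH); exact: mf.
Qed.

Lemma sigma_preimage d' (T : measurableType d') G (f : Omega -> T) B :
  measurable_wrt G f -> measurable B -> <<s G >> (f @^-1` B).
Proof. by move=> mf mB; have := mf measurableT B mB; rewrite setTI. Qed.

Lemma measurable_wrtP d' (T : measurableType d') G (f : Omega -> T) :
  (forall B, measurable B -> <<s G >> (f @^-1` B)) -> measurable_wrt G f.
Proof. by move=> mf _ B mB; rewrite setTI; exact: mf. Qed.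

Lemma sigmaI G A B : <<s G >> A -> <<s G >> B -> <<s G >> (A `&` B).
Proof. exact: (@measurableI _ (g_sigma_algebraType G)). Qed.

Lemma sigma_generated_sub {d' : measure_display} {T : measurableType d'}
    {I : Type} (D : set I) (X : I -> Omega -> T) G :
  (forall i, D i -> measurable_wrt G (X i)) -> sigma_generated D X `<=` <<s G >>.
Proof.
move=> mX; apply: sigma_mono => _ [i Di [B mB <-]].
by rewrite setTI; exact: sigma_preimage (mX i Di) mB.
Qed.

Lemma sigma_generated_wrt {d' : measure_display} {T : measurableType d'}
    {I : Type} (D : set I) (X : I -> Omega -> T) i G :
  D i -> sigma_generated D X `<=` <<s G >> -> measurable_wrt G (X i).
Proof.
move=> Di XG; apply: measurable_wrtP => B mB; apply: XG.
by apply: sub_sigma_algebra; exists i => //; exists B => //; rewrite setTI.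
Qed.

Lemma measurable_wrt_measurable d' (T : measurableType d') G (f : Omega -> T) :
  G `<=` measurable -> measurable_wrt G f -> measurable_fun setT f.
Proof.
by move=> Gm; exact: sub_measurable_fun.
Qed.

End Sigma.

(** * A compound Poisson process observed on a grid *)

Section CompoundPoissonGrid.
Context {d : measure_display} {Omega : measurableType d} {R : realType}.
Variable P : probability Omega R.
Variables (lam a : R) (F : R -> R).
Variables (N : R -> {RV P >-> nat}) (J : nat -> {RV P >-> R}).
Hypothesis cp : compound_poisson lam F N J.
Variable past : set (set Omega).
Hypothesis past_meas : past `<=` measurable.
Hypothesis past_indep : independent2 P <<s past>> (copy_sigma N J).
Variable h : R.
Hypothesis h_gt0 : 0 < h.

Local Notation t k := (k%:R * h).

Definition increment (k : nat) (w : Omega) : nat := (N (t k.+1) w - N (t k) w)%N.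

Definition next_jump (k : nat) (w : Omega) : R := J (N (t k) w) w.

Let clock_gen := \bigcup_(s in (time_set : set R)) preimage_set_system setT
   (N s : Omega -> nat) measurable.
Let clock := sigma_generated time_set (fun s => N s : Omega -> nat).
Let jumps := sigma_generated setT (fun k => J k : Omega -> R).

Let grid_ge0 k : time_set (t k).
Proof. by rewrite /time_set /= mulr_ge0// ltW. Qed.

Let incr_gen (l : nat) := \bigcup_(i in [set i | (i < l)%N])
  sigma_generated [set: unit] (fun=> increment i).
Let jump_gen (m : nat) := \bigcup_(j in [set j | (j < m)%N])
  sigma_generated [set: unit] (fun=> J j : Omega -> R).

(** A pi-system on which independence from the next increment and from the next
    jump follows from that of the clock, of the jumps and of the past. *)
Let grid_block (l m : nat) : set (set Omega) := [set E | exists A C H,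
  [/\ <<s past>> A, <<s incr_gen l>> C, <<s jump_gen m>> H & E = A `&` C `&` H]].

Let measurable_increment_clock k : measurable_wrt clock_gen (increment k).
Proof.
have mN s : time_set s -> measurable_wrt clock_gen (N s : Omega -> nat).
  move=> ts.
  by apply: (@sigma_generated_wrt _ _ _ _ _ time_set (fun s => N s : Omega -> nat)).
rewrite /measurable_wrt /increment.
apply: (@measurable_nat_case _ _ (g_sigma_algebraType clock_gen) nat
  (N (t k.+1)) (fun m w => (m - N (t k) w)%N)); first exact: mN.
move=> m; apply: (@measurableT_comp _ _ _ _ _ _ (fun n => (m - n)%N)) => //.
exact: mN.
Qed.

Let incr_clock l : <<s incr_gen l>> `<=` clock.
Proof.
apply: sigma_mono => E [i _ iE].
apply: sigma_generated_sub E iE => _ _; exact: measurable_increment_clock.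
Qed.

Let jump_jumps m : <<s jump_gen m>> `<=` jumps.
Proof.
apply: sigma_mono => E [i _ iE].
apply: sigma_generated_sub E iE => _ _.
by apply: (@sigma_generated_wrt _ _ _ _ _ setT (fun k => J k : Omega -> R)).
Qed.

Let clock_meas : clock `<=` measurable.
Proof.
apply: sub_gen_measurable => _ [s _ [B mB <-]].
exact: (measurable_funP (N s)).
Qed.

Let jumps_meas : jumps `<=` measurable.
Proof.
apply: sub_gen_measurable => _ [s _ [B mB <-]].
exact: (measurable_funP (J s)).
Qed.

Let clock_copy : clock `<=` copy_sigma N J.
Proof. by move=> E cE; apply: sub_sigma_algebra; left. Qed.

Let jumps_copy : jumps `<=` copy_sigma N J.
Proof. by move=> E cE; apply: sub_sigma_algebra; right. Qed.

Let block_indep A C H : <<s past>> A -> clock C -> jumps H ->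
  P (A `&` C `&` H) = (P A * P C * P H)%E.
Proof.
move=> pA cC jH; have [_ _ _ _ NJ] := cp.
rewrite -setIA past_indep//; last first.
  by apply: sigmaI; [exact: clock_copy|exact: jumps_copy].
by rewrite NJ// muleA.
Qed.

Let incr_prefix l C D : <<s incr_gen l>> C ->
  P (C `&` increment l @^-1` D) = (P C * P (increment l @^-1` D))%E.
Proof.
move=> iC; have [[_ _ _ _ pp] _ _ _ _] := cp.
have := @independent_prefix _ _ _ P nat (fun m => sigma_generated [set: unit]
   (fun=> increment m)) [set i | (i < l)%N] l.
apply => //.
- by move=> i; exact: smallest_sigma_algebra.
- move=> i E iE; apply: clock_meas; apply: sigma_generated_sub E iE => _ _.
  exact: measurable_increment_clock.
- apply: (pp (fun k => t k)) => [|m n mn]; first by rewrite mul0r.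
  by rewrite ler_wpM2r ?ler_nat// ltW.
- by rewrite /= ltnn.
- by apply: sub_sigma_algebra; exists tt => //; exists D => //; rewrite setTI.
Qed.

Let jump_prefix m H D : <<s jump_gen m>> H -> measurable D ->
  P (H `&` J m @^-1` D) = (P H * P (J m @^-1` D))%E.
Proof.
move=> iH mD; have [_ _ _ pp _] := cp.
have := @independent_prefix _ _ _ P nat (fun m => sigma_generated [set: unit]
   (fun=> J m : Omega -> R)) [set i | (i < m)%N] m.
apply => //.
- by move=> i; exact: smallest_sigma_algebra.
- move=> i E iE; apply: jumps_meas; apply: sigma_generated_sub E iE => _ _.
  by apply: (@sigma_generated_wrt _ _ _ _ _ setT (fun k => J k : Omega -> R)).
- by rewrite /= ltnn.
- by apply: sub_sigma_algebra; exists tt => //; exists D => //; rewrite setTI.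
Qed.

Let grid_block_meas l m : grid_block l m `<=` measurable.
Proof.
move=> _ [A [C [H [pA iC jH ->]]]].
apply: measurableI; last by apply: jumps_meas; exact: jump_jumps jH.
apply: measurableI; first exact: sub_gen_measurable pA.
by apply: clock_meas; exact: incr_clock iC.
Qed.

Let grid_blockI l m : setI_closed (grid_block l m).
Proof.
move=> _ _ [A [C [H [pA iC jH ->]]]] [A' [C' [H' [pA' iC' jH' ->]]]].
exists (A `&` A'), (C `&` C'), (H `&` H'); split; [exact: sigmaI..|].
by rewrite -!setIA (setICA _ A') (setICA _ C') (setICA _ A').
Qed.

Let sigmaT (G : set (set Omega)) : <<s G>> setT.
Proof. exact: (@measurableT _ (g_sigma_algebraType G)). Qed.

Let grid_blockT l m : grid_block l m setT.
Proof.
by exists setT, setT, setT; split; rewrite ?setIT//; exact: sigmaT.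
Qed.

Let cE (E : set Omega) : measurable E -> {c : {nonneg R} | P E = c%:num%:E}.
Proof.
move=> mE; have F0 : 0 <= fine (P E) by rewrite fine_ge0.
by exists (NngNum F0); rewrite /= fineK// fin_num_measure.
Qed.

Let measurable_increment k : measurable_fun setT (increment k).
Proof.
apply: measurable_wrt_measurable (measurable_increment_clock k).
move=> _ [s _ [B mB <-]]; exact: (measurable_funP (N s)).
Qed.

Let block_increment l m E D : <<s grid_block l m>> E ->
  P (E `&` increment l @^-1` D) = (P E * P (increment l @^-1` D))%E.
Proof.
have mD : measurable (increment l @^-1` D).
  by rewrite -[X in measurable X]setTI; exact: measurable_increment.
have [c cD] := cE mD; rewrite cD muleC; move: E.
apply: pi_system_proportional => //.
move=> _ [A [C [H [pA iC jH ->]]]]; rewrite -cD.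
rewrite setIAC -(setIA A) block_indep//; last exact: jump_jumps jH.
  rewrite incr_prefix// block_indep//; [|exact: incr_clock iC|exact: jump_jumps jH].
 by rewrite [RHS]muleC muleA -[LHS]muleA -[RHS]muleA (muleC (P H)).
apply: sigmaI; first exact: incr_clock iC.
exact: (sigma_preimage (measurable_increment_clock l)).
Qed.

Let block_jump l m E D : measurable D -> <<s grid_block l m>> E ->
  P (E `&` J m @^-1` D) = (P E * P (J m @^-1` D))%E.
Proof.
move=> mD'; have mD : measurable (J m @^-1` D).
  by rewrite -[X in measurable X]setTI; exact: (measurable_funP (J m)).
have [c cD] := cE mD; rewrite cD muleC; move: E.
apply: pi_system_proportional => //.
move=> _ [A [C [H [pA iC jH ->]]]]; rewrite -cD.
rewrite -setIA block_indep//; first last.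
- apply: sigmaI; first exact: jump_jumps jH.
  apply: sigma_preimage mD'.
  by apply: (@sigma_generated_wrt _ _ _ _ _ setT (fun k => J k : Omega -> R)).
- exact: incr_clock iC.
rewrite jump_prefix// block_indep//; [|exact: incr_clock iC|exact: jump_jumps jH].
by rewrite muleA muleC.
Qed.

(** What is known from the past, from the first [l] increments of the clock and
    from the jumps that have occurred by the [k]-th grid time. The number of those
    jumps is random, so that events are described on each level of the clock at
    that time. The two indices differ when the next increment is already known
    but the jump it announces is not. *)
Definition filtration (k l : nat) : set (set Omega) :=
  [set E | forall m, <<s grid_block l m>> (E `&` N (t k) @^-1` [set m])].

Let past_block l m : past `<=` <<s grid_block l m>>.
Proof.
move=> A pA; apply: sub_sigma_algebra; exists A, setT, setT.
by split; rewrite ?setIT//; [exact: sub_sigma_algebra|exact: sigmaT..].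
Qed.

Let incr_block l m : <<s incr_gen l>> `<=` <<s grid_block l m>>.
Proof.
move=> A pA; apply: sub_sigma_algebra; exists setT, A, setT.
by split; rewrite ?setTI ?setIT//; exact: sigmaT.
Qed.

Let jump_block l m : <<s jump_gen m>> `<=` <<s grid_block l m>>.
Proof.
move=> A pA; apply: sub_sigma_algebra; exists setT, setT, A.
by split; rewrite ?setTI//; exact: sigmaT.
Qed.

Let clock_block j l m : (j <= l)%N ->
  measurable_wrt (grid_block l m) (N (t j) : Omega -> nat).
Proof.
have [[N0 Nmono _ _ _] _ _ _ _] := cp.
elim: j => [_|j IH jl].
  apply: measurable_wrtP => B mB; rewrite mul0r.
  have -> : N 0 @^-1` B = [set w | B 0%N].
    by apply/seteqP; split => w /=; rewrite N0.
  have [B0|nB0] := pselect (B 0%N).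
    by rewrite (_ : [set _ | _] = setT) ?predeqE//; exact: sigmaT.
  by rewrite (_ : [set _ | _] = set0) ?predeqE//; exact: (@measurable0 _ (g_sigma_algebraType _)).
have NE w : N (t j.+1) w = (N (t j) w + increment j w)%N.
  by rewrite subnKC// Nmono//; [exact: grid_ge0|rewrite ler_wpM2r ?ler_nat// ltW].
rewrite /measurable_wrt (_ : (N _ : Omega -> nat) = fun w => (N (t j) w + increment j w)%N);
  last exact/funext.
apply: (@measurable_nat_case _ _ (g_sigma_algebraType _) nat
  (N (t j)) (fun m w => (m + increment j w)%N)); first exact: (IH (ltnW jl)).
move=> n; apply: (@measurableT_comp _ _ _ _ _ _ (addn n)) => //.
apply: measurable_wrtP => B mB; apply: incr_block; apply: sub_sigma_algebra.
exists j => //=; apply: sub_sigma_algebra.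
by exists tt => //; exists B => //; rewrite setTI.
Qed.

Let jump_wrt_block j l m : (j < m)%N ->
  measurable_wrt (grid_block l m) (J j : Omega -> R).
Proof.
move=> jm; apply: measurable_wrtP => B mB; apply: jump_block.
apply: sub_sigma_algebra; exists j => //=; apply: sub_sigma_algebra.
by exists tt => //; exists B => //; rewrite setTI.
Qed.

Lemma filtration_mono k l l' : (l <= l')%N -> filtration k l `<=` filtration k l'.
Proof.
move=> ll E fE m; apply: sigma_mono (fE m) => _ [A [C [H [pA iC jH ->]]]].
apply: sub_sigma_algebra; exists A, C, H; split => //.
apply: sigma_mono iC => C' [i il iC']; apply: sub_sigma_algebra.
by exists i => //=; exact: leq_trans il ll.
Qed.

Lemma filtration_sigma k l : (k <= l)%N -> sigma_algebra setT (filtration k l).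
Proof.
move=> kl; split.
- move=> m; rewrite set0I; exact: (@measurable0 _ (g_sigma_algebraType _)).
- move=> A fA m; rewrite setTD.
  have -> : ~` A `&` N (t k) @^-1` [set m] =
      N (t k) @^-1` [set m] `\` (A `&` N (t k) @^-1` [set m]).
    by rewrite setDIr setDv setU0 setDE setIC.
  apply: (@measurableD _ (g_sigma_algebraType _)); last exact: fA.
  exact: (sigma_preimage (clock_block kl)).
- move=> A fA m; rewrite setI_bigcupl.
  by apply: (@bigcup_measurable _ (g_sigma_algebraType _)) => i _; exact: fA.
Qed.

Lemma filtrationE k l : (k <= l)%N -> <<s filtration k l>> = filtration k l.
Proof. by move=> kl; apply: sigma_algebra_id; exact: filtration_sigma. Qed.

Lemma filtration_meas k l : filtration k l `<=` measurable.
Proof.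
move=> E fE; rewrite (_ : E = \bigcup_m (E `&` N (t k) @^-1` [set m])).
  apply: bigcup_measurable => m _; apply: sub_gen_measurable (fE m).
  exact: grid_block_meas.
by apply/seteqP; split => [w Ew|w [m _ []//]]; exists (N (t k) w).
Qed.

(** On each level of the clock, a path up to the [k]-th grid time is a function
    of a fixed number of jumps; this reduces adaptedness to that case. *)
Lemma measurable_filtration d' (T : measurableType d') (f : Omega -> T) k l :
  (k <= l)%N ->
  (forall m, exists2 g : Omega -> T, measurable_wrt (grid_block l m) g &
     forall w, N (t k) w = m -> f w = g w) ->
  measurable_wrt (filtration k l) f.
Proof.
move=> kl fg; apply: measurable_wrtP => B mB; rewrite filtrationE// => m.
have [g mg fgE] := fg m.
have -> : f @^-1` B `&` N (t k) @^-1` [set m]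
    = g @^-1` B `&` N (t k) @^-1` [set m].
  by apply/seteqP; split => w /= [Bw Nm]; split => //; move: Bw; rewrite fgE.
apply: sigmaI; first exact: sigma_preimage mg mB.
exact: (sigma_preimage (clock_block kl)).
Qed.

Lemma measurable_past_filtration d' (T : measurableType d') (f : Omega -> T) k l :
  (k <= l)%N -> measurable_wrt past f -> measurable_wrt (filtration k l) f.
Proof.
move=> kl mf; apply: measurable_filtration => // m; exists f => //.
by apply: measurable_wrt_mono mf; exact: past_block.
Qed.

Lemma measurable_increment_filtration k :
  measurable_wrt (filtration k k.+1) (increment k).
Proof.
apply: measurable_filtration => // m; exists (increment k) => //.
apply: measurable_wrtP => B mB; apply: incr_block; apply: sub_sigma_algebra.
exists k => //=; apply: sub_sigma_algebra.
by exists tt => //; exists B => //; rewrite setTI.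
Qed.

Lemma measurable_path_filtration j k l : (j <= k)%N -> (k <= l)%N ->
  measurable_wrt (filtration k l) (drifted_path a N J (t j)).
Proof.
move=> jk kl; apply: measurable_filtration => // m.
have [[N0 Nmono _ _ _] _ _ _ _] := cp.
exists (fun w => \sum_(i < m) (if (i < N (t j) w)%N then J i w else 0) - a * t j).
  apply: measurable_funB; last exact: measurable_cst.
  apply: measurable_sum => i; apply: measurable_fun_if => //.
  - apply: (@measurableT_comp _ _ _ _ _ _ (fun n => (i < n)%N)) => //.
    exact: (clock_block (leq_trans jk kl)).
  - apply: measurable_funTS; exact: jump_wrt_block.
move=> w Nm; rewrite /drifted_path; congr (_ - _).
rewrite -big_mkcond/=; have Njm : (N (t j) w <= m)%N.
  rewrite -Nm Nmono//; first exact: grid_ge0.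
  by rewrite ler_wpM2r ?ler_nat// ltW.
by rewrite (big_ord_widen _ (fun i => J i w) Njm).
Qed.

(** Each piece of [E] on a level [m] of the clock belongs to the sigma-algebra
    of the block with [m] jumps, from which the increment is independent. *)
Lemma increment_indep k E D : <<s filtration k k>> E ->
  P (E `&` increment k @^-1` D) = (P E * P (increment k @^-1` D))%E.
Proof.
move=> fE; have mE := sub_gen_measurable (@filtration_meas k k) fE.
have mD : measurable (increment k @^-1` D).
  by rewrite -[X in measurable X]setTI; exact: measurable_increment.
rewrite filtrationE// in fE.
rewrite (probability_nat_split P (measurable_funP (N (t k))) (measurableI _ _ mE mD)).
rewrite [X in (X * _)%E](probability_nat_split P (measurable_funP (N (t k))) mE).
have [c cD] := cE mD; rewrite cD [RHS]muleC -nneseriesZl//.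
apply: eq_eseriesr => m _.
by rewrite setIAC (block_increment (m := m))// cD muleC.
Qed.

Hypothesis same_law : forall k D, measurable D -> P (J k @^-1` D) = P (J 0%N @^-1` D).

Lemma measurable_next_jump k : measurable_fun setT (next_jump k).
Proof.
by apply: (@measurable_nat_case _ _ _ _ (N (t k)) (fun m w => J m w)).
Qed.

(** On the level [m] of the clock the next jump is [J m], which is independent
    of the block that contains the [m] jumps before it and has the law of [J 0]
    for every [m]. *)
Let next_jump_indep0 k l E D : (k <= l)%N -> <<s filtration k l>> E -> measurable D ->
  P (E `&` next_jump k @^-1` D) = (P E * P (J 0%N @^-1` D))%E.
Proof.
move=> kl fE mD'; have mE := sub_gen_measurable (@filtration_meas k l) fE.
have mD : measurable (next_jump k @^-1` D).
  by rewrite -[X in measurable X]setTI; exact: measurable_next_jump.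
have mD0 : measurable (J 0%N @^-1` D).
  by rewrite -[X in measurable X]setTI; exact: (measurable_funP (J 0%N)).
rewrite filtrationE// in fE.
rewrite (probability_nat_split P (measurable_funP (N (t k))) (measurableI _ _ mE mD)).
rewrite [X in (X * _)%E](probability_nat_split P (measurable_funP (N (t k))) mE).
have [c cD] := cE mD0; rewrite cD [RHS]muleC -nneseriesZl//.
apply: eq_eseriesr => m _; rewrite -cD muleC -(same_law m)// -(block_jump mD' (fE m)).
rewrite -!setIA; congr (P (_ `&` _)).
apply/seteqP; split => w /=; rewrite /next_jump.
  by move=> [+ Nm]; rewrite Nm.
by move=> [Nm Jm]; rewrite Nm.
Qed.

Lemma next_jump_law k D : measurable D ->
  P (next_jump k @^-1` D) = P (J 0%N @^-1` D).
Proof.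
move=> mD; have := @next_jump_indep0 k k setT D (leqnn k) (@sigmaT (filtration k k)) mD.
by rewrite setTI => ->; rewrite probability_setT mul1e.
Qed.

Lemma next_jump_indep k l E D : (k <= l)%N -> <<s filtration k l>> E -> measurable D ->
  P (E `&` next_jump k @^-1` D) = (P E * P (next_jump k @^-1` D))%E.
Proof. by move=> kl fE mD; rewrite next_jump_law// (next_jump_indep0 kl). Qed.

Lemma increment_law k n : P (increment k @^-1` [set n]) = (poisson_pmf (lam * h) n)%:E.
Proof.
have [[_ Nmono _ pp _] _ _ _ _] := cp.
have tS : t k < t k.+1 by rewrite ltr_pM2r// ltr_nat.
have := pp (t k) (t k.+1) n (grid_ge0 k) tS.
rewrite -mulrBl -natrB// subSnn mul1r => <-; congr (P _).
apply/seteqP; split => w /=; rewrite /increment.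
  by move=> <-; rewrite subnKC// Nmono//; [exact: grid_ge0|exact: ltW].
by move=> ->; rewrite addKn.
Qed.

End CompoundPoissonGrid.

(** Adding the bound makes the integrand nonnegative, and then measurability in
    the parameter is part of Tonelli's theorem. *)
Lemma measurable_Rintegral {R : realType} d1 d2 (T1 : measurableType d1)
    (T2 : measurableType d2) (Q : probability T2 R) (phi : T1 * T2 -> R) (M : R) :
  measurable_fun setT phi -> (forall z, `|phi z| <= M) ->
  measurable_fun setT (fun x => \int[Q]_y phi (x, y)).
Proof.
move=> mphi phiM.
have mphi2 x : measurable_fun setT (fun v => phi (x, v)).
  exact: (measurableT_comp mphi (pair1_measurable x)).
have -> : (fun x => \int[Q]_y phi (x, y)) =
    (fun x => fine (\int[Q]_y (phi (x, y) + M)%:E) - M).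
  apply/funext => x; rewrite -[fine _]/(\int[Q]_y (phi (x, y) + M)).
  rewrite RintegralD//.
  - by rewrite Rintegral_prob_cst addrK.
  - exact: (@bounded_integrable _ _ _ Q (fun y => phi (x, y)) M).
  - exact: (@bounded_integrable _ _ _ Q (fun=> M) `|M|).
apply: measurable_funB; last exact: measurable_cst.
apply: measurableT_comp => //.
apply: (@measurable_fun_fubini_tonelli_F _ _ _ _ _ Q (fun z => (phi z + M)%:E)).
  by apply/measurable_EFinP; exact: measurable_funD.
by move=> z; rewrite lee_fin -lerBlDr sub0r; have := phiM z; rewrite ler_norml => /andP[].
Qed.

Section BoundedMeasurable.
Context {d : measure_display} {T : measurableType d} {R : realType}.
Implicit Types f g : T -> R.

Definition bounded_measurable f :=
  measurable_fun setT f /\ exists M, forall w, `|f w| <= M.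

Lemma bounded_measurable_cst (c : R) : bounded_measurable (fun=> c).
Proof. by split; [exact: measurable_cst|exists `|c|]. Qed.

Lemma bounded_measurableD f g : bounded_measurable f -> bounded_measurable g ->
  bounded_measurable (fun w => f w + g w).
Proof.
move=> [mf [A fA]] [mg [B gB]]; split; first exact: measurable_funD.
by exists (A + B) => w; apply: le_trans (ler_normD _ _) _; exact: lerD.
Qed.

Lemma bounded_measurableM f g : bounded_measurable f -> bounded_measurable g ->
  bounded_measurable (fun w => f w * g w).
Proof.
move=> [mf [A fA]] [mg [B gB]]; split; first exact: measurable_funM.
by exists (A * B) => w; rewrite normrM; exact: ler_pM.
Qed.

Lemma bounded_measurable_indic (p : T -> bool) : measurable_fun setT p ->
  bounded_measurable (fun w => (p w)%:R).
Proof.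
move=> mp; split; first exact: (measurableT_comp (f := fun b : bool => b%:R : R)).
by exists 1 => w; case: (p w); rewrite ?normr1 ?normr0.
Qed.

Variable Q : probability T R.

Lemma bounded_measurable_int f : bounded_measurable f ->
  Q.-integrable setT (EFin \o f).
Proof. by move=> [mf [M fM]]; exact: bounded_integrable fM. Qed.

Lemma RintegralD_bm f g : bounded_measurable f -> bounded_measurable g ->
  \int[Q]_w (f w + g w) = \int[Q]_w f w + \int[Q]_w g w.
Proof. by move=> bf bg; rewrite RintegralD//; exact: bounded_measurable_int. Qed.

Lemma RintegralZ_bm c f : bounded_measurable f ->
  \int[Q]_w (c * f w) = c * \int[Q]_w f w.
Proof. by move=> bf; rewrite RintegralZl//; exact: bounded_measurable_int. Qed.

Lemma le_Rintegral_bm f g : bounded_measurable f -> bounded_measurable g ->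
  (forall w, f w <= g w) -> \int[Q]_w f w <= \int[Q]_w g w.
Proof. by move=> bf bg fg; apply: le_Rintegral => //; exact: bounded_measurable_int. Qed.

Lemma Rintegral_same_law d' (T' : measurableType d') (X Y : {mfun T >-> T'}) (f : T' -> R)
    (M : R) : (forall D, measurable D -> Q (X @^-1` D) = Q (Y @^-1` D)) ->
  measurable_fun setT f -> (forall v, `|f v| <= M) ->
  \int[Q]_w f (X w) = \int[Q]_w f (Y w).
Proof.
move=> same mf fM; rewrite /Rintegral; congr fine.
have mfE : measurable_fun setT (EFin \o f) by exact/measurable_EFinP.
have intf (Z : {mfun T >-> T'}) : Q.-integrable setT ((EFin \o f) \o Z).
  apply: (@bounded_integrable _ _ _ Q (f \o Z) M) => //.
    exact: (measurableT_comp mf).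
  by move=> w; exact: fM.
have := integral_distribution mfE (intf X) => /= <-.
have := integral_distribution mfE (intf Y) => /= <-.
by apply: eq_measure_integral => D mD _; exact: same.
Qed.

Lemma Rintegral_indic_preimage d' (T' : measurableType d') (V : T -> T') (B : set T')
    (p : T' -> bool) : measurable_fun setT V -> measurable B ->
  (forall v, p v = (v \in B)) ->
  \int[Q]_w (p (V w))%:R = fine (Q (V @^-1` B)).
Proof.
move=> mV mB pB; rewrite /Rintegral; congr fine.
have mD : measurable (V @^-1` B).
  by rewrite -[X in measurable X]setTI; exact: mV.
rewrite -[in RHS](setIT (V @^-1` B)) -integral_indic//.
apply: eq_integral => w _; congr EFin; rewrite indicE pB.
by congr (_ : bool)%:R; apply/idP/idP; rewrite !inE.
Qed.

End BoundedMeasurable.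

Section OneStep.
Context {d : measure_display} {Omega : measurableType d} {R : realType}.
Variable P : probability Omega R.
Variables (lam a : R) (F : R -> R).
Variables (N : R -> {RV P >-> nat}) (J : nat -> {RV P >-> R}).
Hypothesis cp : compound_poisson lam F N J.
Variable past : set (set Omega).
Hypothesis past_meas : past `<=` measurable.
Hypothesis past_indep : independent2 P <<s past>> (copy_sigma N J).
Variable h : R.
Hypothesis h_gt0 : 0 < h.
Hypothesis same_law : forall k D, measurable D -> P (J k @^-1` D) = P (J 0%N @^-1` D).

Local Notation t k := (k%:R * h).
Local Notation fil := (filtration N J past h).
Local Notation incr := (increment N h).
Local Notation nextJ := (next_jump N J h).
Local Notation pmf n := (poisson_pmf (lam * h) n).

Definition jump_mean (W : R -> R) (z : R) : R := \int[P]_w W (z + J 0%N w).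

(** The part of the mean of [W], after a time [h], that comes from at most one
    jump. *)
Definition step_mean (W : R -> R) (z : R) : R :=
  pmf 0 * W (z - a * h) + pmf 1 * jump_mean W (z - a * h).

Lemma bounded_measurable_jump_mean W : bounded_measurable W ->
  bounded_measurable (jump_mean W).
Proof.
move=> [mW [M WM]]; split; last first.
  exists M => z; apply: Rintegral_bounded => //; apply: (measurableT_comp mW).
  exact: measurable_funD.
have := @measurable_Rintegral R _ _ R Omega P (fun z => W (z.1 + J 0%N z.2)) M.
apply => //; apply: (measurableT_comp mW); apply: measurable_funD => //.
exact: (measurableT_comp (measurable_funP (J 0%N))).
Qed.

Lemma bounded_measurable_step_mean W : bounded_measurable W ->
  bounded_measurable (step_mean W).
Proof.
move=> bW; have shift (V : R -> R) : bounded_measurable V ->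
    bounded_measurable (fun z : R => V (z - a * h)).
  move=> [mV [B VB]]; split; last by exists B.
  by apply: (measurableT_comp mV); exact: measurable_funB.
apply: bounded_measurableD; apply: bounded_measurableM.
- exact: bounded_measurable_cst.
- exact: shift.
- exact: bounded_measurable_cst.
- by apply: shift; exact: bounded_measurable_jump_mean.
Qed.

Let fil_meas k l : fil k l `<=` measurable.
Proof. exact: filtration_meas. Qed.

Let jumpE k (W : R -> R) z : bounded_measurable W ->
  \int[P]_w W (z + nextJ k w) = jump_mean W z.
Proof.
move=> [mW [M WM]]; rewrite /jump_mean.
have mnJ : measurable_fun setT (nextJ k) by exact: measurable_next_jump.
pose V : {mfun Omega >-> R} := HB.pack (nextJ k) (isMeasurableFun.Build _ _ _ _ _ mnJ).
apply: (@Rintegral_same_law _ _ _ P _ _ V (J 0%N) (fun v => W (z + v)) M) => //.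
  exact: (next_jump_law cp past_meas past_indep h_gt0 same_law).
by apply: (measurableT_comp mW); exact: measurable_funD.
Qed.

(** The increment over the [k]-th cell is independent of what happens before. *)
Let incr_split k n (H : Omega -> R) : bounded_measurable H -> measurable_wrt (fil k k) H ->
  \int[P]_w (H w * (incr k w == n)%:R) = pmf n * \int[P]_w H w.
Proof.
move=> bH mH; have [_ [M HM]] := bH.
have mi : measurable_fun setT (incr k).
  apply: (measurable_wrt_measurable (@fil_meas k k.+1)).
  exact: (measurable_increment_filtration cp).
rewrite (@independent_integral _ _ _ P (fil k k) _ _ nat (incr k) _ _
   (fun z => H z.1 * (z.2 == n)%:R) M) //=.
- rewrite -RintegralZ_bm//; apply: eq_Rintegral => w _.
  rewrite RintegralZ_bm; last first.
    apply: bounded_measurable_indic.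
    exact: (measurableT_comp (f := fun m : nat => m == n)).
  rewrite mulrC; congr (_ * _).
  rewrite (@Rintegral_indic_preimage _ _ _ P _ nat (incr k) [set n] (fun m => m == n))//.
    by rewrite (increment_law cp h_gt0).
  by move=> v; apply/eqP/idP; rewrite inE.
- move=> E D sE mD; exact: (increment_indep cp past_meas past_indep h_gt0).
- apply: measurable_funM; first exact: (measurableT_comp mH).
  apply: (measurableT_comp (f := fun b : bool => b%:R : R)) => //.
  exact: (measurableT_comp (f := fun m : nat => m == n)).
- move=> z; rewrite normrM -[leRHS]mulr1; apply: ler_pM => //.
  by case: eqP; rewrite ?normr1 ?normr0.
Qed.

Let drop0 k y w : incr k w = 0%N ->
  y + drifted_path a N J (t k.+1) w = y + drifted_path a N J (t k) w - a * h.
Proof.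
have [[_ Nmono _ _ _] _ _ _ _] := cp => i0.
have tS : t k <= t k.+1 by rewrite ler_wpM2r ?ler_nat// ltW.
have NN : N (t k.+1) w = N (t k) w.
  have le1 : (N (t k) w <= N (t k.+1) w)%N by rewrite Nmono// mulr_ge0// ltW.
  by apply/eqP; rewrite eqn_leq le1 andbT -subn_eq0; apply/eqP.
by rewrite /drifted_path NN -natr1; ring.
Qed.

Let drop1 k y w : incr k w = 1%N ->
  y + drifted_path a N J (t k.+1) w
  = y + drifted_path a N J (t k) w - a * h + nextJ k w.
Proof.
have [[_ Nmono _ _ _] _ _ _ _] := cp => i0.
have tS : t k <= t k.+1 by rewrite ler_wpM2r ?ler_nat// ltW.
have NN : N (t k.+1) w = (N (t k) w).+1.
  have -> : N (t k.+1) w = (N (t k) w + incr k w)%N.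
    by rewrite subnKC// Nmono// mulr_ge0// ltW.
  by rewrite i0 addn1.
rewrite /drifted_path NN big_ord_recr /= -natr1 /next_jump.
by move: (\sum_(_ < _) _) (J _ _) => A B; ring.
Qed.

(** Splitting on the number of jumps in the [k]-th cell: none or one give
    [step_mean], and two or more cost at most [M] times their probability. The
    weight [g] restricts the estimate to an event of the past. *)
Lemma one_step k (W : R -> R) (M : R) (y g : Omega -> R) :
  measurable_fun setT W -> (forall z, `|W z| <= M) ->
  measurable_wrt past y -> measurable_wrt (fil k k) g ->
  (forall w, 0 <= g w <= 1) ->
  \int[P]_w (g w * W (y w + drifted_path a N J (t k.+1) w)) <=
  \int[P]_w (g w * step_mean W (y w + drifted_path a N J (t k) w))
  + M * (1 - pmf 0 - pmf 1).
Proof.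
move=> mW WM my mg g01.
pose S j w := y w + drifted_path a N J (t j) w.
have mS : measurable_wrt (fil k k) (S k).
  apply: measurable_funD; first exact: (measurable_past_filtration cp).
  exact: (measurable_path_filtration a cp).
have mSk : measurable_fun setT (S k) := measurable_wrt_measurable (@fil_meas k k) mS.
have mSk1 : measurable_fun setT (S k.+1).
  apply: (measurable_wrt_measurable (@fil_meas k.+1 k.+1)).
  apply: measurable_funD; first exact: (measurable_past_filtration cp).
  exact: (measurable_path_filtration a cp).
have M0 : 0 <= M := le_trans (normr_ge0 _) (WM 0).
have bW : bounded_measurable W by split => //; exists M.
have mgO := measurable_wrt_measurable (@fil_meas k k) mg.
have g1 w : `|g w| <= 1 by have /andP[g0 g1] := g01 w; rewrite ger0_norm.
have bg : bounded_measurable g by split => //; exists 1.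
have bWo (f : Omega -> R) : measurable_fun setT f -> bounded_measurable (fun w => W (f w)).
  by move=> mf; split; [exact: (measurableT_comp mW)|exists M].
have [mjump [M' jumpM]] := bounded_measurable_jump_mean bW.
have mi : measurable_fun setT (incr k).
  apply: (measurable_wrt_measurable (@fil_meas k k.+1)).
  exact: (measurable_increment_filtration cp).
have mnJ : measurable_fun setT (nextJ k) by exact: measurable_next_jump.
have bi n : bounded_measurable (fun w => (incr k w == n)%:R : R).
  apply: bounded_measurable_indic.
  exact: (measurableT_comp (f := fun m : nat => m == n)).
pose H0 w := g w * W (S k w - a * h).
pose H1 w := g w * jump_mean W (S k w - a * h).
have mSh : measurable_fun setT (fun w => S k w - a * h) by exact: measurable_funB.
have mShf : measurable_wrt (fil k k) (fun w => S k w - a * h).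
  exact: measurable_funB.
have bH0 : bounded_measurable H0 by apply: bounded_measurableM => //; exact: bWo.
have bH1 : bounded_measurable H1.
  apply: bounded_measurableM => //; split; last by exists M'.
  exact: (measurableT_comp mjump).
have b1 : bounded_measurable (fun w =>
    g w * (incr k w == 1)%:R * W (S k w - a * h + nextJ k w)).
  apply: bounded_measurableM; first exact: bounded_measurableM.
  by apply: bWo; exact: measurable_funD.
have E0 := @incr_split k 0 H0 bH0.
have E1 : \int[P]_w (g w * (incr k w == 1)%:R * W (S k w - a * h + nextJ k w))
    = pmf 1 * \int[P]_w H1 w.
  rewrite (@independent_integral _ _ _ P (fil k k.+1) _ _ _ (nextJ k) _ _
    (fun z => g z.1 * (incr k z.1 == 1)%:R * W (S k z.1 - a * h + z.2)) M) //=.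
  - rewrite -(@incr_split k)//; last first.
      by apply: measurable_funM => //; exact: (measurableT_comp mjump).
    apply: eq_Rintegral => w _; rewrite /H1 mulrAC -[RHS]mulrA -[jump_mean _ _](@jumpE k)//.
    rewrite RintegralZ_bm; last by apply: bWo; exact: measurable_funD.
    by rewrite -mulrA.
  - by move=> E D; exact: (next_jump_indep cp past_meas past_indep h_gt0 same_law).
  - have mono (f : Omega -> R) : measurable_wrt (fil k k) f -> measurable_wrt (fil k k.+1) f.
      apply: measurable_wrt_mono => E fE; apply: sub_sigma_algebra.
      exact: filtration_mono fE.
    apply: measurable_funM; last first.
      apply: (measurableT_comp mW); apply: measurable_funD => //.
      exact: (measurableT_comp (mono _ mShf)).
    apply: measurable_funM; first exact: (measurableT_comp (mono _ mg)).
    apply: (measurableT_comp (f := fun b : bool => b%:R : R)) => //.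
    apply: (measurableT_comp (f := fun m : nat => m == 1%N)) => //.
    have mi' : measurable_wrt (fil k k.+1) (incr k).
      exact: (measurable_increment_filtration cp).
    exact: (measurableT_comp mi').
  - move=> z; rewrite !normrM -[leRHS]mul1r; apply: ler_pM => //.
    rewrite -[leRHS]mul1r; apply: ler_pM => //.
    by case: eqP; rewrite ?normr1 ?normr0.
have E2 n : \int[P]_w (incr k w == n)%:R = pmf n.
  have := @incr_split k n (fun=> 1); rewrite Rintegral_prob_cst mulr1 => <-.
  - by apply: eq_Rintegral => w _; rewrite mul1r.
  - exact: bounded_measurable_cst.
  - exact: measurable_cst.
pose rest w := M * (1 + - 1 * (incr k w == 0)%:R + - 1 * (incr k w == 1)%:R).
have brest0 c n : bounded_measurable (fun w => c * (incr k w == n)%:R : R).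
  by apply: bounded_measurableM => //; exact: bounded_measurable_cst.
have bone : bounded_measurable (fun w : Omega => 1 + - 1 * (incr k w == 0)%:R : R).
  by apply: bounded_measurableD; [exact: bounded_measurable_cst|exact: brest0].
have brest1 : bounded_measurable
  (fun w => 1 + - 1 * (incr k w == 0)%:R + - 1 * (incr k w == 1)%:R : R).
  exact: bounded_measurableD.
have brest : bounded_measurable rest.
  by apply: bounded_measurableM => //; exact: bounded_measurable_cst.
have Erest : \int[P]_w rest w = M * (1 - pmf 0 - pmf 1).
  rewrite RintegralZ_bm// RintegralD_bm// RintegralD_bm//; last exact: bounded_measurable_cst.
  by rewrite !RintegralZ_bm// Rintegral_prob_cst !E2 !mulN1r.
apply: (@le_trans _ _ (\int[P]_w (H0 w * (incr k w == 0)%:R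
   + g w * (incr k w == 1)%:R * W (S k w - a * h + nextJ k w) + rest w))).
  apply: le_Rintegral_bm.
  - by apply: bounded_measurableM => //; exact: bWo.
  - apply: bounded_measurableD => //; apply: bounded_measurableD => //.
    exact: bounded_measurableM.
  move=> w; rewrite /H0 /rest.
  have [i0|i0] := eqVneq (incr k w) 0%N.
    by rewrite i0 (drop0 _ i0) /S /=; lra.
  have [i1|i1] := eqVneq (incr k w) 1%N.
    by rewrite (drop1 _ i1) /S /=; lra.
  rewrite !mulr0 mul0r !addr0 add0r mulr1.
  apply: le_trans (ler_norm _) _; rewrite normrM -[leRHS]mul1r.
  exact: ler_pM.
rewrite RintegralD_bm//; last first.
  by apply: bounded_measurableD => //; exact: bounded_measurableM.
rewrite RintegralD_bm//; last exact: bounded_measurableM.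
rewrite Erest E1 E0//; last first.
  by apply: measurable_funM => //; exact: (measurableT_comp mW).
rewrite lerD2r -RintegralZ_bm// -RintegralZ_bm// -RintegralD_bm; last 2 first.
- by apply: bounded_measurableM => //; exact: bounded_measurable_cst.
- by apply: bounded_measurableM => //; exact: bounded_measurable_cst.
rewrite le_eqVlt; apply/orP; left; apply/eqP.
by apply: eq_Rintegral => w _; rewrite /H0 /H1 /step_mean /S; ring.
Qed.

End OneStep.

(** * Moments of the drifted compound Poisson process *)

Lemma poisson_pmf0 {R : realType} (q : R) : 0 < q -> poisson_pmf q 0 = expR (- q).
Proof. by move=> q0; rewrite /poisson_pmf q0 expr0 fact0 invr1 !mul1r. Qed.

Lemma poisson_pmf1 {R : realType} (q : R) : 0 < q -> poisson_pmf q 1 = q * expR (- q).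
Proof. by move=> q0; rewrite /poisson_pmf q0 expr1 factS fact0 muln1 invr1 mulr1. Qed.

(** Second order in [q]: summed over a grid, these probabilities are of the order
    of the mesh. *)
Lemma poisson_two_or_more {R : realType} (q : R) : 0 < q ->
  1 - poisson_pmf q 0 - poisson_pmf q 1 <= q ^+ 2.
Proof.
move=> q0; rewrite poisson_pmf0// poisson_pmf1//.
have := expR_ge1Dx (- q); nra.
Qed.

Section PoissonMoments.
Local Open Scope ereal_scope.
Context {R : realType}.
Variables (lam : R) (p : nat -> R).
Hypothesis lam_gt0 : (0 < lam)%R.
Hypothesis pE : forall n, p n = poisson_pmf lam n.
Hypothesis p_sum : \sum_(n <oo) (p n)%:E = 1.

Lemma poisson_pmf_succ n : (n.+1%:R * p n.+1 = lam * p n)%R.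
Proof.
rewrite !pE /poisson_pmf lam_gt0 factS natrM exprS invfM.
have n0 : (n.+1%:R != 0 :> R)%R by rewrite pnatr_eq0.
have f0 : (n`!%:R != 0 :> R)%R by rewrite pnatr_eq0 -lt0n fact_gt0.
move: n0 f0; move: (n.+1%:R)%R (n`!%:R)%R (lam ^+ n)%R (expR _) => u v q e u0 v0.
by field; rewrite u0 v0.
Qed.

Let p_ge0 n : (0 <= p n)%R. Proof. by rewrite pE poisson_pmf_ge0. Qed.

Let series_shift (f : nat -> \bar R) : (forall n, 0 <= f n) -> f 0%N = 0 ->
  \sum_(n <oo) f n = \sum_(n <oo) f n.+1.
Proof.
move=> f0 f00; rewrite (nneseries_split 0 1)//.
rewrite add0n big_nat1 f00 add0e -nneseries_addn//.
by apply: eq_eseriesr => n _; rewrite addn1.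
Qed.

Lemma poisson_mean : \sum_(n <oo) (n%:R * p n)%:E = lam%:E.
Proof.
rewrite series_shift => [|n|]; last 2 first.
- by rewrite lee_fin mulr_ge0.
- by rewrite mul0r.
under eq_eseriesr do rewrite poisson_pmf_succ EFinM.
by rewrite nneseriesZl ?p_sum ?mule1// => n _; rewrite lee_fin.
Qed.

Lemma poisson_factorial_moment :
  \sum_(n <oo) (n%:R * n.-1%:R * p n)%:E = (lam ^+ 2)%:E.
Proof.
rewrite series_shift => [|n|]; last 2 first.
- by rewrite lee_fin !mulr_ge0.
- by rewrite mul0r mul0r.
under eq_eseriesr => n _.
  rewrite mulrAC poisson_pmf_succ /= mulrAC -mulrA EFinM; over.
rewrite nneseriesZl => [|n _]; last by rewrite lee_fin mulr_ge0.
by rewrite poisson_mean -EFinM expr2.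
Qed.

End PoissonMoments.

Section CompoundMoments.
Context {d : measure_display} {Omega : measurableType d} {R : realType}.
Variable P : probability Omega R.
Variables (lam : R) (F : R -> R).
Variables (N : R -> {RV P >-> nat}) (J : nat -> {RV P >-> R}).
Hypothesis cp : compound_poisson lam F N J.
Hypothesis lam_gt0 : 0 < lam.
Hypothesis same_law : forall k D, measurable D -> P (J k @^-1` D) = P (J 0%N @^-1` D).

Let S n w := \sum_(k < n) J k w.
Let p n := poisson_pmf lam n.
Let clock_gen := \bigcup_(s in (time_set : set R)) preimage_set_system setT
   (N s : Omega -> nat) measurable.
Let jump_gen (D : set nat) := \bigcup_(j in D) preimage_set_system setT
   (J j : Omega -> R) measurable.

Let J_gt0 k w : 0 < J k w. Proof. by have [_ ? _ _ _] := cp. Qed.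

Let S_ge0 n w : 0 <= S n w.
Proof. by apply: sumr_ge0 => k _; exact: ltW. Qed.

Let clock_meas : clock_gen `<=` measurable.
Proof. move=> _ [s _ [B mB <-]]; exact: (measurable_funP (N s)). Qed.

Let jump_meas D : jump_gen D `<=` measurable.
Proof. move=> _ [s _ [B mB <-]]; exact: (measurable_funP (J s)). Qed.

Let J_wrt (D : set nat) k : D k -> measurable_wrt (jump_gen D) (J k : Omega -> R).
Proof.
by move=> Dk; apply: (@sigma_generated_wrt _ _ _ _ _ D (fun k => J k : Omega -> R)).
Qed.

Let S_wrt (D : set nat) n : (forall k, (k < n)%N -> D k) -> measurable_wrt (jump_gen D) (S n).
Proof. by move=> nD; apply: measurable_sum => k; apply: J_wrt; exact: nD. Qed.

Let mS n : measurable_fun setT (S n).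
Proof. exact: measurable_sum. Qed.

Let count_law n : P (N 1 @^-1` [set n]) = (p n)%:E.
Proof.
have [[N0 _ _ pp _] _ _ _ _] := cp.
have := pp 0 1 n (lexx _) ltr01; rewrite subr0 mulr1 => <-; congr (P _).
by apply/seteqP; split => w /=; rewrite N0 add0n.
Qed.

Let p_sum : (\sum_(n <oo) (p n)%:E = 1)%E.
Proof.
have := probability_nat_split P (measurable_funP (N 1)) measurableT.
rewrite probability_setT => ->; apply: eq_eseriesr => n _.
by rewrite setTI count_law.
Qed.

(** The number of jumps is independent of their sizes. *)
Let total (q : R -> R) : measurable_fun setT q -> (forall v, 0 <= q v) ->
  (\int[P]_w (q (S (N 1 w) w))%:E = \sum_(n <oo) ((p n)%:E * \int[P]_w (q (S n w))%:E))%E.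
Proof.
move=> mq q0.
pose ind n w : R := (N 1 w == n)%:R.
have mind n : measurable_wrt clock_gen (ind n).
  apply: (measurableT_comp (f := fun m : nat => (m == n)%:R : R)) => //.
  apply: (@sigma_generated_wrt _ _ _ _ _ time_set (fun s => N s : Omega -> nat)) => //.
  by rewrite /time_set /=.
have mindO n : measurable_fun setT (ind n) by exact: measurable_wrt_measurable clock_meas (mind n).
have -> : (\int[P]_w (q (S (N 1 w) w))%:E =
    \int[P]_w (\sum_(n <oo) (ind n w * q (S n w))%:E))%E.
  apply: eq_integral => w _.
  rewrite (@nneseriesD1 _ _ (N 1 w))//; last first.
    by move=> n _; rewrite lee_fin mulr_ge0// /ind ler0n.
  rewrite /ind eqxx mul1r eseries0 ?adde0// => n _ /=.
  by rewrite eq_sym => /negbTE->; rewrite mul0r.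
rewrite integral_nneseries//; last 2 first.
- move=> n; apply/measurable_EFinP; apply: measurable_funM => //.
  exact: (measurableT_comp mq).
- by move=> n w _; rewrite lee_fin mulr_ge0// /ind ler0n.
apply: eq_eseriesr => n _.
have := @ge0_independent_integral _ _ _ P clock_gen clock_meas _ _ (S n) (mS n) _
  (fun z => (ind n z.1 * q z.2)%:E).
rewrite /= => ->; last 3 first.
- move=> E D cE mD; have [_ _ _ _ NJ] := cp; apply: NJ => //.
  exact: (sigma_preimage (@S_wrt setT n (fun _ _ => Logic.I))).
- apply/measurable_EFinP; apply: measurable_funM; first exact: (measurableT_comp (mind n)).
  exact: (measurableT_comp mq).
- by move=> z; rewrite lee_fin mulr_ge0// /ind ler0n.
set c := (X in _ = (_ * X)%E).
have c0 : (0 <= c)%E by apply: integral_ge0 => w _; rewrite lee_fin.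
transitivity (\int[P]_w ((\1_(N 1 @^-1` [set n]) w)%:E * c))%E.
  apply: eq_integral => w _; rewrite /c.
  under eq_integral do rewrite EFinM.
  rewrite ge0_integralZl//; last 3 first.
  - by apply/measurable_EFinP; exact: (measurableT_comp mq).
  - by move=> w' _; rewrite lee_fin.
  - by rewrite lee_fin /ind ler0n.
  congr (_%:E * _)%E; rewrite /ind indicE; congr (_ : bool)%:R.
  by apply/eqP/idP; rewrite inE.
have mN : measurable (N 1 @^-1` [set n]).
  by rewrite -[X in measurable X]setTI; exact: (measurable_funP (N 1)).
rewrite ge0_integralZr//; last by apply/measurable_EFinP; exact: measurable_indic.
rewrite integral_indic// setIT; congr (_ * _)%E; exact: count_law.
Qed.

Hypothesis S2_fin : (\int[P]_w (S (N 1 w) w ^+ 2)%:E < +oo)%E.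

Let p_ge0 n : 0 <= p n. Proof. exact: poisson_pmf_ge0. Qed.

(** The series of [total] for the second moment contains, for a single jump, a
    positive multiple of the second moment of that jump. *)
Let J2_fin : (\int[P]_w (J 0%N w ^+ 2)%:E < +oo)%E.
Proof.
move: S2_fin; rewrite (@total (fun v => v ^+ 2)); last 2 first.
- exact: measurable_funX.
- by move=> v; exact: sqr_ge0.
move=> fin; have p1 : 0 < p 1 by rewrite /p poisson_pmf1// mulr_gt0// expR_gt0.
have : ((p 1)%:E * \int[P]_w (S 1 w ^+ 2)%:E < +oo)%E.
  apply: le_lt_trans fin.
  rewrite (@nneseriesD1 _ _ 1%N)//; last first.
    by move=> n _; rewrite mule_ge0 ?lee_fin ?p_ge0//; apply: integral_ge0 => w _;
      rewrite lee_fin sqr_ge0.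
  rewrite leeDl//; apply: nneseries_ge0 => n _ _.
  by rewrite mule_ge0 ?lee_fin ?p_ge0//; apply: integral_ge0 => w _; rewrite lee_fin sqr_ge0.
have -> : (\int[P]_w (S 1 w ^+ 2)%:E = \int[P]_w (J 0%N w ^+ 2)%:E)%E.
  by apply: eq_integral => w _; rewrite /S big_ord1.
have : (0 <= \int[P]_w (J 0%N w ^+ 2)%:E)%E.
  by apply: integral_ge0 => w _; rewrite lee_fin sqr_ge0.
by case: (\int[P]_w _)%E => [v _ _|_|//]; rewrite ?ltry// gt0_muley ?lte_fin// ltxx.
Qed.

Lemma jump_sq_integrable : P.-integrable setT (fun w => (J 0%N w ^+ 2)%:E).
Proof.
apply/integrableP; split; first by apply/measurable_EFinP; exact: measurable_funX.
rewrite (eq_integral (fun w => (J 0%N w ^+ 2)%:E))// => w _.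
by rewrite /= ger0_norm// sqr_ge0.
Qed.

Lemma jump_integrable : P.-integrable setT (EFin \o J 0%N).
Proof.
apply: (@le_integrable _ _ _ _ _ _ _ (fun w => (1 + J 0%N w ^+ 2)%:E)) => //.
- exact/measurable_EFinP.
- move=> w _ /=; rewrite lee_fin ger0_norm ?(ltW (J_gt0 _ _))//.
  rewrite ger0_norm ?addr_ge0 ?sqr_ge0//.
  have := J_gt0 0 w; nra.
- apply: (@integrableD _ _ _ P setT measurableT (fun=> 1%:E) (fun w => (J 0%N w ^+ 2)%:E)) => //.
  exact: (@bounded_integrable _ _ _ P (fun=> 1) `|1|).
exact: jump_sq_integrable.
Qed.

Definition jump_mean1 : R := \int[P]_w J 0%N w.
Definition jump_mean2 : R := \int[P]_w (J 0%N w ^+ 2).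

Let J1E k : (\int[P]_w (J k w)%:E = jump_mean1%:E)%E.
Proof.
rewrite /jump_mean1 /Rintegral fineK; last exact: (integrable_fin_num measurableT jump_integrable).
rewrite [LHS](eq_integral (fun w => (`|J k w|)%:E)); last by move=> w _; rewrite gtr0_norm.
rewrite [RHS](eq_integral (fun w => (`|J 0%N w|)%:E)); last by move=> w _; rewrite gtr0_norm//.
have mn : measurable_fun setT (fun v : R => (`|v|)%:E).
  by apply/measurable_EFinP; exact: normr_measurable.
rewrite -(@ge0_integral_distribution _ _ _ _ _ P (J k) (fun v => (`|v|)%:E))//.
rewrite -(@ge0_integral_distribution _ _ _ _ _ P (J 0%N) (fun v => (`|v|)%:E))//.
by apply: eq_measure_integral => D mD _; exact: same_law.
Qed.

Let J2E k : (\int[P]_w (J k w ^+ 2)%:E = jump_mean2%:E)%E.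
Proof.
rewrite /jump_mean2 /Rintegral fineK; last exact: (integrable_fin_num measurableT jump_sq_integrable).
have mn : measurable_fun setT (fun v : R => (v ^+ 2)%:E).
  by apply/measurable_EFinP; exact: measurable_funX.
have n0 v : (0 <= (v ^+ 2)%:E :> \bar R)%E by rewrite lee_fin sqr_ge0.
rewrite -(@ge0_integral_distribution _ _ _ _ _ P (J k) (fun v => (v ^+ 2)%:E))//.
rewrite -(@ge0_integral_distribution _ _ _ _ _ P (J 0%N) (fun v => (v ^+ 2)%:E))//.
by apply: eq_measure_integral => D mD _; exact: same_law.
Qed.

Let S1E n : (\int[P]_w (S n w)%:E = (n%:R * jump_mean1)%:E)%E.
Proof.
elim: n => [|n IH].
  by rewrite mul0r integral0_eq// => w _; rewrite /S big_ord0.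
under eq_integral => w _ do rewrite /S big_ord_recr /= EFinD.
rewrite ge0_integralD//=; last 4 first.
- by move=> w _; rewrite lee_fin; exact: S_ge0.
- by apply/measurable_EFinP; exact: mS.
- by move=> w _; rewrite lee_fin ltW.
- exact/measurable_EFinP.
by rewrite IH J1E -EFinD -natr1 mulrDl mul1r.
Qed.

Let SJ n : (\int[P]_w (S n w * J n w)%:E = (n%:R * jump_mean1 ^+ 2)%:E)%E.
Proof.
have [_ _ _ indJ _] := cp.
pose D := [set i | (i < n)%N].
have := @ge0_independent_integral _ _ _ P (jump_gen D) (jump_meas (D := D)) _ _ (J n)
  (measurable_funP (J n)) _ (fun z => (S n z.1 * `|z.2|)%:E).
rewrite /= => H.
transitivity (\int[P]_w (S n w * `|J n w|)%:E)%E.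
  by apply: eq_integral => w _; rewrite gtr0_norm//.
rewrite H; last 3 first.
- move=> E B sE mB.
  apply: (@independent_prefix _ _ _ P nat (fun m => sigma_generated [set: unit]
     (fun=> J m : Omega -> R)) D n) => //.
  + by move=> i; exact: smallest_sigma_algebra.
  + move=> i; apply: sub_gen_measurable => _ [s _ [B' mB' <-]].
    exact: (measurable_funP (J i)).
  + by rewrite /D /= ltnn.
  + apply: sigma_mono sE => E' [i Di iE']; apply: sub_sigma_algebra.
    by exists i => //; apply: sub_sigma_algebra; exists tt.
  + by apply: sub_sigma_algebra; exists tt => //; exists B => //; rewrite setTI.
- apply/measurable_EFinP; apply: measurable_funM.
    exact: (measurableT_comp (@S_wrt D n (fun _ H => H))).
  exact: (measurableT_comp (@normr_measurable _ _)).
- by move=> z; rewrite lee_fin mulr_ge0.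
transitivity (\int[P]_w ((S n w)%:E * jump_mean1%:E))%E.
  apply: eq_integral => w _; under eq_integral do rewrite EFinM.
  rewrite ge0_integralZl//; last 2 first.
  - by apply/measurable_EFinP; exact: (measurableT_comp (@normr_measurable _ _)).
  - by rewrite lee_fin.
  rewrite -(J1E n); congr (_ * _)%E; apply: eq_integral => w' _.
  by rewrite gtr0_norm//.
have j0 : (0 <= jump_mean1%:E)%E.
  by rewrite -(J1E 0); apply: integral_ge0 => w _; rewrite lee_fin ltW.
rewrite ge0_integralZr//; last 2 first.
- by apply/measurable_EFinP; exact: mS.
- by move=> w _; rewrite lee_fin.
by rewrite S1E -EFinM -mulrA.
Qed.

Let S2E n : (\int[P]_w (S n w ^+ 2)%:E =
  (n%:R * jump_mean2 + n%:R * n.-1%:R * jump_mean1 ^+ 2)%:E)%E.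
Proof.
elim: n => [|n IH].
  by rewrite !mul0r addr0 integral0_eq// => w _; rewrite /S big_ord0 expr0n.
transitivity (\int[P]_w ((S n w ^+ 2)%:E + ((S n w * J n w)%:E + ((S n w * J n w)%:E
   + (J n w ^+ 2)%:E))))%E.
  apply: eq_integral => w _; rewrite -!EFinD; congr EFin.
  by rewrite /S big_ord_recr /=; ring.
have mSJ : measurable_fun setT (fun w => (S n w * J n w)%:E).
  by apply/measurable_EFinP; apply: measurable_funM => //; exact: mS.
have SJ0 w : (0 <= (S n w * J n w)%:E)%E by rewrite lee_fin mulr_ge0 ?S_ge0// ltW.
have mJ2 : measurable_fun setT (fun w => (J n w ^+ 2)%:E).
  by apply/measurable_EFinP; exact: measurable_funX.
have J20 w : (0 <= (J n w ^+ 2)%:E)%E by rewrite lee_fin sqr_ge0.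
have mS2 : measurable_fun setT (fun w => (S n w ^+ 2)%:E).
  by apply/measurable_EFinP; apply: measurable_funX; exact: mS.
have S20 w : (0 <= (S n w ^+ 2)%:E)%E by rewrite lee_fin sqr_ge0.
rewrite ge0_integralD//; last 2 first.
- by move=> w _; rewrite !adde_ge0.
- by apply: emeasurable_funD => //; exact: emeasurable_funD.
rewrite ge0_integralD//; last 2 first.
- by move=> w _; rewrite !adde_ge0.
- exact: emeasurable_funD.
rewrite ge0_integralD// IH SJ J2E -!EFinD; congr EFin.
by case: n {IH mSJ SJ0 mJ2 J20 mS2 S20} => [|n] /=; rewrite -?natr1; ring.
Qed.

Lemma compound_mean :
  (\int[P]_w (S (N 1 w) w)%:E = (lam * jump_mean1)%:E)%E.
Proof.
transitivity (\int[P]_w (`|S (N 1 w) w|)%:E)%E.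
  by apply: eq_integral => w _; rewrite ger0_norm// S_ge0.
rewrite (@total (fun v => `|v|))//.
rewrite -(mulrC jump_mean1) EFinM -(poisson_mean lam_gt0 (fun _ => erefl) p_sum).
have j0 : 0 <= jump_mean1.
  by rewrite -lee_fin -(J1E 0); apply: integral_ge0 => w _; rewrite lee_fin ltW.
rewrite -nneseriesZl//; last by move=> n _; rewrite lee_fin mulr_ge0 ?p_ge0.
apply: eq_eseriesr => n _; rewrite (eq_integral (fun w => (S n w)%:E)).
  by rewrite S1E -!EFinM /p; congr EFin; ring.
by move=> w _; rewrite ger0_norm// S_ge0.
Qed.

Lemma compound_second_moment :
  (\int[P]_w (S (N 1 w) w ^+ 2)%:E = (lam * jump_mean2 + lam ^+ 2 * jump_mean1 ^+ 2)%:E)%E.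
Proof.
rewrite (@total (fun v => v ^+ 2)); last 2 first.
- exact: measurable_funX.
- by move=> v; exact: sqr_ge0.
have j2 : 0 <= jump_mean2.
  by rewrite -lee_fin -(J2E 0); apply: integral_ge0 => w _; rewrite lee_fin sqr_ge0.
have -> : (lam * jump_mean2 + lam ^+ 2 * jump_mean1 ^+ 2)%:E =
   (jump_mean2%:E * \sum_(n <oo) (n%:R * p n)%:E
    + (jump_mean1 ^+ 2)%:E * \sum_(n <oo) (n%:R * n.-1%:R * p n)%:E)%E.
  rewrite (poisson_mean lam_gt0 (fun _ => erefl) p_sum).
  rewrite (poisson_factorial_moment lam_gt0 (fun _ => erefl) p_sum).
  by rewrite -!EFinM -EFinD; congr EFin; ring.
rewrite -!nneseriesZl//; last 2 first.
- by move=> n _; rewrite lee_fin !mulr_ge0 ?p_ge0.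
- by move=> n _; rewrite lee_fin !mulr_ge0 ?p_ge0.
rewrite -nneseriesD//; last 2 first.
- move=> n _ _; rewrite -EFinM lee_fin; apply: mulr_ge0 => //.
  by rewrite !mulr_ge0 ?p_ge0.
- move=> n _ _; rewrite -EFinM lee_fin; apply: mulr_ge0; first exact: sqr_ge0.
  by rewrite !mulr_ge0 ?p_ge0.
apply: eq_eseriesr => n _; rewrite S2E -!EFinM -EFinD; congr EFin.
by ring.
Qed.

End CompoundMoments.

Section DriftedMoments.
Context {d : measure_display} {Omega : measurableType d} {R : realType}.
Variable P : probability Omega R.
Variables (lam a : R) (F : R -> R).
Variables (N : R -> {RV P >-> nat}) (J : nat -> {RV P >-> R}).
Hypothesis cp : compound_poisson lam F N J.
Hypothesis lam_gt0 : 0 < lam.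
Hypothesis same_law : forall k D, measurable D -> P (J k @^-1` D) = P (J 0%N @^-1` D).

Let S w := \sum_(k < N 1 w) J k w.
Let X := drifted_path a N J 1.

Let mS : measurable_fun setT S.
Proof.
apply: (@measurable_nat_case _ _ _ R (N 1) (fun n w => \sum_(k < n) J k w)) => // n.
exact: measurable_sum.
Qed.

Let XE w : X w = S w - a. Proof. by rewrite /X /drifted_path mulr1. Qed.

Hypothesis X_mean : ('E_P[X] = 0)%E.
Hypothesis X_var : ('E_P[fun w => (X w ^+ 2)%R] < +oo)%E.

Let mX : measurable_fun setT X.
Proof. by rewrite (_ : X = fun w => S w - a); [exact: measurable_funB|exact/funext]. Qed.

Let mX2 : measurable_fun setT (fun w => (X w ^+ 2)%:E).
Proof. by apply/measurable_EFinP; exact: measurable_funX. Qed.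

Let X2_int : P.-integrable setT (fun w => (X w ^+ 2)%:E).
Proof.
apply/integrableP; split => //; move: X_var; rewrite unlock.
by rewrite (eq_integral (fun w => `|(X w ^+ 2)%:E|%E))// => w _; rewrite /= ger0_norm// sqr_ge0.
Qed.

(** [(X + a) ^ 2 <= 2 X ^ 2 + 2 a ^ 2]. *)
Let S2_fin : (\int[P]_w (S w ^+ 2)%:E < +oo)%E.
Proof.
have int2 : P.-integrable setT (fun w => (2%:E * (X w ^+ 2)%:E + (2 * a ^+ 2)%:E)%E).
  apply: integrableD => //; first exact: integrableZl.
  exact: (@bounded_integrable _ _ _ P (fun=> 2 * a ^+ 2) `|2 * a ^+ 2|).
have : P.-integrable setT (fun w => (S w ^+ 2)%:E).
  apply: (le_integrable _ _ _ int2) => //.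
    by apply/measurable_EFinP; exact: measurable_funX.
  move=> w _; rewrite -EFinM -EFinD /= lee_fin ger0_norm ?sqr_ge0//.
  apply: le_trans (ler_norm _); rewrite XE.
  have := sqr_ge0 (S w - 2 * a); nra.
move/integrableP => [_]; rewrite (eq_integral (fun w => (S w ^+ 2)%:E))// => w _.
by rewrite /= ger0_norm// sqr_ge0.
Qed.

Lemma drifted_jump_integrable : P.-integrable setT (EFin \o J 0%N).
Proof. exact: (jump_integrable cp lam_gt0 S2_fin). Qed.

Lemma drifted_jump_sq_integrable : P.-integrable setT (fun w => (J 0%N w ^+ 2)%:E).
Proof. exact: (jump_sq_integrable cp lam_gt0 S2_fin). Qed.

Let S_mean := compound_mean cp lam_gt0 same_law S2_fin.
Let S_second := compound_second_moment cp lam_gt0 same_law S2_fin.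

Let S_int : P.-integrable setT (EFin \o S).
Proof.
apply/integrableP; split; first exact/measurable_EFinP.
rewrite (eq_integral (fun w => (S w)%:E)) ?S_mean ?ltry// => w _ /=.
have [_ J0 _ _ _] := cp.
by rewrite ger0_norm// sumr_ge0// => k _; exact: ltW.
Qed.

Let S2_int : P.-integrable setT (fun w => (S w ^+ 2)%:E).
Proof.
apply/integrableP; split; first by apply/measurable_EFinP; exact: measurable_funX.
rewrite (eq_integral (fun w => (S w ^+ 2)%:E)) ?S_second ?ltry// => w _ /=.
by rewrite ger0_norm// sqr_ge0.
Qed.

Lemma drift_balance : lam * jump_mean1 J = a.
Proof.
have : \int[P]_w (S w - a) = 0.
  move: X_mean; rewrite unlock => /(congr1 fine) /= <-; congr fine.
  by apply: eq_integral => w _; rewrite XE.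
rewrite RintegralB//; last exact: (@bounded_integrable _ _ _ P (fun=> a) `|a|).
by rewrite Rintegral_prob_cst /Rintegral S_mean /= => /eqP; rewrite subr_eq0 => /eqP.
Qed.

Lemma drifted_variance :
  fine ('E_P[fun w => (X w ^+ 2)%R])%E = lam * jump_mean2 J.
Proof.
rewrite unlock; have -> : fine (\int[P]_w ((X w ^+ 2)%:E))%E =
    \int[P]_w (S w ^+ 2 + (- (2 * a) * S w + a ^+ 2)).
  by rewrite /Rintegral; congr fine; apply: eq_integral => w _; rewrite XE; congr EFin; ring.
have int1 : P.-integrable setT (EFin \o (fun w => - (2 * a) * S w)).
  exact: (integrableZl measurableT (- (2 * a)) S_int).
have inta : P.-integrable setT (EFin \o (fun=> a ^+ 2 : R)).
  exact: (@bounded_integrable _ _ _ P (fun=> a ^+ 2) `|a ^+ 2|).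
rewrite RintegralD//; last exact: (integrableD measurableT int1 inta).
rewrite RintegralD// RintegralZl// Rintegral_prob_cst.
rewrite {1}/Rintegral S_second {1}/Rintegral S_mean /=.
have e := drift_balance; rewrite -[in LHS]e; ring.
Qed.

End DriftedMoments.

(** * Exit times of paths without downward jumps *)

Section FirstTimes.
Context {R : realType}.
Implicit Types E : set R.

Lemma ereal_inf_real E (s : R) :
  (forall t, E t -> s <= t) -> (forall e, 0 < e -> exists2 t, E t & t < s + e) ->
  ereal_inf [set t%:E | t in E] = s%:E.
Proof.
move=> lbE nearE; apply/eqP; rewrite eq_le; apply/andP; split.
- apply/lee_addgt0Pr => e e0; have [t Et ts] := nearE e e0.
  apply: le_trans (_ : (t%:E <= _)%E); first by apply: ge_ereal_inf; exists t%:E => //; exists t.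
  by rewrite -EFinD lee_fin ltW.
- by apply/ereal_infP => _ [t Et <-]; rewrite lee_fin lbE.
Qed.

Lemma ereal_inf_cases E : (forall t, E t -> 0 <= t) ->
  (E = set0 /\ ereal_inf [set t%:E | t in E] = +oo%E) \/
  exists s, [/\ 0 <= s, ereal_inf [set t%:E | t in E] = s%:E,
    forall t, E t -> s <= t & forall e, 0 < e -> exists2 t, E t & t < s + e].
Proof.
move=> E0; have [->|/set0P[t0 Et0]] := eqVneq E set0.
  by left; rewrite image_set0 ereal_inf0.
have hE : has_inf E by split; [exists t0|exists 0].
right; exists (inf E); split.
- by apply: lb_le_inf; [exists t0|].
- apply: ereal_inf_real => [t Et|e e0]; first by apply: ge_inf => //; case: hE.
  by have [t Et ts] := inf_adherent e0 hE; exists t.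
- by move=> t Et; apply: ge_inf => //; case: hE.
- by move=> e e0; have [t Et ts] := inf_adherent e0 hE; exists t.
Qed.

End FirstTimes.

Section SkipFree.
Context {R : realType}.

(** The paths of the model: they move down only through the drift, so that a level
    below is reached continuously, and they stay linear for some time after each
    instant. The last clause excludes jumps downwards. *)
Definition skip_free (a : R) (f : R -> R) : Prop := [/\ f 0 = 0,
  forall t, 0 <= t -> exists2 e, 0 < e &
    forall u, t <= u -> u < t + e -> f u = f t - a * (u - t)
  & forall s t, 0 <= s -> s <= t -> f s - a * (t - s) <= f t].

Definition exit_from (X : R -> R) (lo hi : R) : \bar R :=
  ereal_inf [set t%:E | t in [set t | 0 <= t /\ ~~ (lo <= X t <= hi)]].

(** At the exit time itself the path may still be inside: it can sit at the lower
    end and leave immediately afterwards. The last clause, on what happens just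
    after [s], is what a grid can observe. *)
Definition exit_at (a : R) (X : R -> R) (lo hi s : R) : Prop :=
  [/\ 0 <= s, forall t, 0 <= t -> t < s -> lo <= X t <= hi,
      X s = lo \/ hi < X s &
      exists2 e, 0 < e & (forall u, s <= u -> u < s + e -> X u = X s - a * (u - s)) /\
        forall u, s < u -> u < s + e -> ~~ (lo <= X u <= hi)].

(** A path without jumps downwards leaves an interval either at its lower end or by
    a jump over the upper one. *)
Lemma exit_fromP a f y lo hi : 0 < a -> skip_free a f -> lo <= y <= hi ->
  let X t := y + f t in
  (exit_from X lo hi = +oo%E /\ forall t, 0 <= t -> lo <= X t <= hi) \/
  exists2 s, exit_from X lo hi = s%:E & exit_at a X lo hi s.
Proof.
move=> a0 [f0 frc fdown] yin X.
pose E := [set t | 0 <= t /\ ~~ (lo <= X t <= hi)].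
rewrite -[exit_from X lo hi]/(ereal_inf [set t%:E | t in E]).
have [|[E0 ->]|[s [s0 sE sle snear]]] := @ereal_inf_cases _ E; first by move=> t [].
  left; split => // t t0; apply: contrapT => /negP Xt.
  by have : E t by []; rewrite E0.
right; exists s => //.
have inb t : 0 <= t -> t < s -> lo <= X t <= hi.
  move=> t0 ts; apply: contrapT => /negP Xt.
  by have := sle t (conj t0 Xt); rewrite leNgt ts.
have [e e0 fe] := frc s s0.
have XE u : s <= u -> u < s + e -> X u = X s - a * (u - s).
  by move=> su ue; rewrite /X fe// addrA.
have Xlo : lo <= X s.
  have [s00|s_gt0] := eqVneq s 0; first by rewrite /X s00 f0 addr0; case/andP: yin.
  have sp : 0 < s by rewrite lt_def s_gt0.
  apply/ler_addgt0Pr => eps eps0.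
  pose r := Num.min (s / 2) (eps / (2 * a)).
  have r0 : 0 < r by rewrite lt_min !divr_gt0// mulr_gt0.
  have rs : r <= s / 2 by rewrite ge_min lexx.
  have re : a * r <= eps.
    have : r <= eps / (2 * a) by rewrite ge_min lexx orbT.
    rewrite ler_pdivlMr ?mulr_gt0// => H; nra.
  have sr0 : 0 <= s - r by lra.
  have /andP[/= lor _] := inb (s - r) sr0 ltac:(lra).
  have := fdown (s - r) s sr0 ltac:(lra).
  rewrite /X in lor *; have -> : s - (s - r) = r by ring.
  lra.
have Xcase : X s = lo \/ hi < X s.
  have [|Xhi] := ltP hi (X s); first by right.
  left; apply/eqP; rewrite eq_le Xlo andbT.
  apply/ler_addgt0Pr => eps eps0.
  have m0 : 0 < Num.min e (eps / a) by rewrite lt_min e0 divr_gt0.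
  have [u [u0 Xu] us] := snear _ m0.
  have su := sle u (conj u0 Xu).
  have ue : u < s + e.
    by apply: lt_le_trans us _; rewrite lerD2l ge_min lexx.
  have ua : u - s < eps / a.
    by rewrite ltrBlDl; apply: lt_le_trans us _; rewrite lerD2l ge_min lexx orbT.
  rewrite ltr_pdivlMr// in ua.
  have XuE := XE u su ue.
  have : X u < lo.
    rewrite ltNge; apply/negP => loX; move/negP: Xu; apply.
    by rewrite loX/= XuE (le_trans _ Xhi)// gerBl mulr_ge0 ?subr_ge0// ltW.
  rewrite XuE; nra.
split => //.
case: Xcase => [Xs|Xs].
  exists e => //; split => // u su ue; rewrite XE ?(ltW su)// Xs.
  by rewrite negb_and -ltNge gtrBl mulr_gt0// subr_gt0.
have m0 : 0 < Num.min e ((X s - hi) / a) by rewrite lt_min e0 divr_gt0// subr_gt0.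
exists (Num.min e ((X s - hi) / a)) => //; split => u su um.
  by apply: XE => //; apply: lt_le_trans um _; rewrite lerD2l ge_min lexx.
rewrite XE ?(ltW su)//; last by apply: lt_le_trans um _; rewrite lerD2l ge_min lexx.
have : u - s < (X s - hi) / a.
  by rewrite ltrBlDl; apply: lt_le_trans um _; rewrite lerD2l ge_min lexx orbT.
rewrite ltr_pdivlMr// => H.
rewrite negb_and -!ltNge; apply/orP; right; lra.
Qed.

(** The value [K] also stands for no exit before the [K]-th grid point. *)
Definition grid_exit (inside : R -> bool) (g : nat -> R) (K : nat) : nat :=
  find (fun j => ~~ inside (g j)) (iota 0 K).

Lemma grid_exit_lt inside g K : (grid_exit inside g K < K)%N ->
  ~~ inside (g (grid_exit inside g K)).
Proof.
rewrite /grid_exit => Hlt.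
have hs : has (fun j => ~~ inside (g j)) (iota 0 K) by rewrite has_find size_iota.
by have := nth_find 0%N hs; rewrite nth_iota.
Qed.

Lemma grid_exit_le_idx inside g K j : (j < K)%N -> ~~ inside (g j) ->
  (grid_exit inside g K <= j)%N.
Proof.
move=> jK gj; rewrite /grid_exit leqNgt; apply/negP => jf.
have := @before_find _ 0%N (fun j => ~~ inside (g j)) (iota 0 K) j jf.
by rewrite nth_iota// add0n (negbTE gj).
Qed.

Lemma grid_exitS inside g K : grid_exit inside g K.+1 =
  if all (fun j => inside (g j)) (iota 0 K.+1) then K.+1 else grid_exit inside g K.
Proof.
rewrite /grid_exit -addn1 iotaD find_cat size_iota add0n /= all_cat /= andbT.
have -> : all (fun j => inside (g j)) (iota 0 K) = ~~ has (fun j => ~~ inside (g j)) (iota 0 K).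
  by rewrite has_predC negbK.
case: ifP => //= /negbT hs.
have -> : find (fun j => ~~ inside (g j)) (iota 0 K) = K.
  by rewrite hasNfind// size_iota.
by case: (inside (g K)); rewrite /= ?addn0 ?addn1.
Qed.

Lemma grid_exit_all inside g K : all (fun j => inside (g j)) (iota 0 K) ->
  grid_exit inside g K = K.
Proof.
move=> gall; rewrite /grid_exit hasNfind ?size_iota//.
by apply/hasPn => j jK; rewrite negbK; exact: (allP gall).
Qed.

(** The path is outside just after [s], hence at the first grid point after [s]:
    the grid sees the exit with a delay of at most one mesh, during which only the
    drift acts. *)
Lemma grid_exit_near a X lo hi s e h K : 0 < a -> 0 < h ->
  exit_at a X lo hi s ->
  (forall u, s <= u -> u < s + e -> X u = X s - a * (u - s)) ->
  (forall u, s < u -> u < s + e -> ~~ (lo <= X u <= hi)) ->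
  h < e -> s + h < K%:R * h ->
  let k := grid_exit (fun z => lo <= z <= hi) (fun j => X (j%:R * h)) K in
  [/\ (k < K)%N, s <= k%:R * h, k%:R * h <= s + h &
      X (k%:R * h) = X s - a * (k%:R * h - s)].
Proof.
move=> a0 h0 [s0 sin _ _] XE Xout he sK k.
have sh0 : 0 <= s / h by rewrite divr_ge0// ltW.
pose j0 := (Num.trunc (s / h)).+1.
have /andP[j0l j0u] := truncn_itv sh0.
have sj0 : s < j0%:R * h by rewrite -ltr_pdivrMr.
have j0s : j0%:R * h <= s + h.
  rewrite /j0 -natr1 mulrDl mul1r lerD2r -ler_pdivlMr//.
have j0K : (j0 < K)%N.
  by rewrite -(ltr_nat R) -(ltr_pM2r h0); exact: le_lt_trans j0s sK.
have j0out : ~~ (lo <= X (j0%:R * h) <= hi) by apply: Xout => //; lra.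
have kj0 : (k <= j0)%N by exact: grid_exit_le_idx.
have kK : (k < K)%N := leq_ltn_trans kj0 j0K.
have kout := grid_exit_lt kK.
have ks : s <= k%:R * h.
  rewrite leNgt; apply/negP => ks; move/negP: kout; apply; apply: sin => //.
  by rewrite mulr_ge0// ltW.
have ksh : k%:R * h <= s + h.
  by apply: le_trans j0s; rewrite ler_wpM2r ?ler_nat// ltW.
split => //; apply: XE => //; lra.
Qed.

End SkipFree.

Section GridLimit.
Context {R : realType}.

(** The horizon [horizon p * mesh p = p + 1] tends to infinity, so no exit is
    missed in the limit, while [horizon p * mesh p ^ 2] tends to 0, so errors that
    are quadratic in the mesh disappear when they are summed over all cells. *)
Definition mesh (p : nat) : R := p.+1%:R ^- 3.
Definition horizon (p : nat) : nat := (p.+1 ^ 4)%N.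

Lemma mesh_gt0 p : 0 < mesh p.
Proof. by rewrite invr_gt0 exprn_gt0. Qed.

Lemma mesh_le_harmonic p : mesh p <= harmonic p.
Proof.
rewrite /mesh /harmonic lef_pV2 ?posrE// ?exprn_gt0//.
by rewrite -[leLHS]expr1 ler_weXn2l// ler1n.
Qed.

Lemma mesh_le1 p : mesh p <= 1.
Proof.
apply: le_trans (mesh_le_harmonic p) _.
by rewrite /harmonic invf_le1// ler1n.
Qed.

Lemma cvg_mesh : mesh @ \oo --> (0 : R).
Proof.
apply: (@squeeze_cvgr _ _ _ _ (fun=> 0) harmonic); last exact: cvg_harmonic.
- by apply: nearW => p; rewrite mesh_le_harmonic ltW// mesh_gt0.
- exact: cvg_cst.
Qed.

Lemma horizon_mesh p : (horizon p)%:R * mesh p = p.+1%:R.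
Proof.
by rewrite /horizon /mesh natrX exprSr mulrAC mulfV ?mul1r// expf_neq0.
Qed.

Lemma near_succ_gt (A : R) : \forall p \near \oo, A < p.+1%:R.
Proof.
near=> p; apply: lt_trans (_ : p%:R < _); last by rewrite ltr_nat.
by near: p; exact: nbhs_infty_gtr.
Unshelve. all: by end_near. Qed.

(** The discount of an infinite time is 0, so that the default value of
    [exit_position] never contributes. *)
Definition exit_discount (r : R) (s : \bar R) : R :=
  if s is s'%:E then expR (- (r * s')) else 0.

Definition exit_position (X : R -> R) (s : \bar R) : R :=
  if s is s'%:E then X s' else 0.

Variables (a : R) (f : R -> R) (y lo hi r : R).
Hypotheses (a_gt0 : 0 < a) (r_gt0 : 0 < r) (f_sf : skip_free a f).
Hypothesis y_in : lo <= y <= hi.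

Let X t := y + f t.
Let inside z := lo <= z <= hi.

Definition grid_index p := grid_exit inside (fun j => X (j%:R * mesh p)) (horizon p).

Let k p := grid_index p.
Let s := exit_from X lo hi.

Lemma cvg_grid_finite s' : s = s'%:E ->
  [/\ \forall p \near \oo, (k p < horizon p)%N,
      (k p)%:R * mesh p @[p --> \oo] --> s' &
      X ((k p)%:R * mesh p) @[p --> \oo] --> X s'].
Proof.
move=> ss; have [[]|[s'' ]] := exit_fromP a_gt0 f_sf y_in; first by rewrite -/s ss.
rewrite -/s ss => -[<-] ex; have [s0 _ _ [e e0 [XE Xout]]] := ex.
have near_e : \forall p \near \oo, mesh p < e.
  exact: (cvgr_lt (0 : R) cvg_mesh).
have near_s : \forall p \near \oo, s' + 1 < p.+1%:R.
  exact: near_succ_gt.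
have key : \forall p \near \oo, [/\ (k p < horizon p)%N, s' <= (k p)%:R * mesh p,
    (k p)%:R * mesh p <= s' + mesh p &
    X ((k p)%:R * mesh p) = X s' - a * ((k p)%:R * mesh p - s')].
  near=> p; apply: (@grid_exit_near _ a X lo hi s' e (mesh p) (horizon p)) => //.
  - exact: mesh_gt0.
  - by near: p.
  - rewrite horizon_mesh; apply: le_lt_trans (_ : s' + 1 < _).
      by rewrite lerD2l mesh_le1.
    by near: p.
have cvgs : (k p)%:R * mesh p @[p --> \oo] --> s'.
  apply: (@squeeze_cvgr _ _ _ _ (fun=> s') (fun p => s' + mesh p)).
  - by near=> p; have [//|_ -> -> _] := near key p _.
  - exact: cvg_cst.
  - by rewrite -[X in _ --> X]addr0; apply: cvgD; [exact: cvg_cst|exact: cvg_mesh].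
split => //.
- by near=> p; have [//|] := near key p _.
- have : X s' - a * ((k p)%:R * mesh p - s') @[p --> \oo] --> X s' - a * (s' - s').
    apply: cvgB; first exact: cvg_cst.
    by apply: cvgMr; apply: cvgB => //; exact: cvg_cst.
  rewrite subrr mulr0 subr0; apply: cvg_trans; apply: near_eq_cvg.
  by near=> p; have [//|_ _ _ ->] := near key p _.
Unshelve. all: by end_near. Qed.

Lemma grid_infinite p : s = +oo%E -> k p = horizon p.
Proof.
move=> ss; have [[_ Xin]|[s'' ]] := exit_fromP a_gt0 f_sf y_in; last by rewrite -/s ss.
rewrite /k /grid_index; apply: grid_exit_all; apply/allP => j _.
by apply: Xin; rewrite mulr_ge0// ltW// mesh_gt0.
Qed.

Lemma cvg_grid_discount :
  (if (k p < horizon p)%N then expR (- (r * ((k p)%:R * mesh p))) else 0) @[p --> \oo]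
    --> exit_discount r s.
Proof.
have [|[s' ss _]] := exit_fromP a_gt0 f_sf y_in.
  move=> [ss _]; rewrite /s ss /=.
  rewrite [X in X @ _ --> _](_ : _ = (fun=> 0)); first exact: cvg_cst.
  by apply/funext => p; rewrite grid_infinite// ltnn.
have [nk cs _] := cvg_grid_finite ss; rewrite /s ss /=.
have : expR (- (r * ((k p)%:R * mesh p))) @[p --> \oo] --> expR (- (r * s')).
  apply: (continuous_cvg _ (@continuous_expR R _)).
  by apply: cvgN; apply: cvgMr.
apply: cvg_trans; apply: near_eq_cvg.
by near=> p; rewrite (near nk p).
Unshelve. all: by end_near. Qed.

Lemma cvg_grid_position :
  (if (k p < horizon p)%N then X ((k p)%:R * mesh p) else 0) @[p --> \oo]
    --> exit_position X s.
Proof.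
have [|[s' ss _]] := exit_fromP a_gt0 f_sf y_in.
  move=> [ss _]; rewrite /s ss /=.
  rewrite [X in X @ _ --> _](_ : _ = (fun=> 0)); first exact: cvg_cst.
  by apply/funext => p; rewrite grid_infinite// ltnn.
have [nk _ cX] := cvg_grid_finite ss; rewrite /s ss /=.
move: cX; apply: cvg_trans; apply: near_eq_cvg.
by near=> p; rewrite (near nk p).
Unshelve. all: by end_near. Qed.

(** When there is no exit, the discount at the horizon tends to 0; otherwise the
    grid exit times and positions converge. *)
Lemma cvg_grid_value (W : R -> R) (M : R) : continuous W -> (forall z, `|W z| <= M) ->
  expR (- (r * ((k p)%:R * mesh p))) * W (X ((k p)%:R * mesh p)) @[p --> \oo]
    --> exit_discount r s * W (exit_position X s).
Proof.
move=> cW WM.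
have [|[s' ss _]] := exit_fromP a_gt0 f_sf y_in.
  move=> [ss _]; rewrite /s ss /= mul0r; apply/norm_cvg0P.
  apply: (@squeeze_cvgr _ _ _ _ (fun=> 0) (fun p => r^-1 * M * harmonic p)); last 2 first.
  - exact: cvg_cst.
  - by rewrite -[X in _ --> X](mulr0 (r^-1 * M)); apply: cvgMr; exact: cvg_harmonic.
  apply: nearW => p; rewrite normr_ge0/= normrM ger0_norm ?expR_ge0//.
  rewrite grid_infinite// horizon_mesh expRN.
  have rp : 0 < r * p.+1%:R by rewrite mulr_gt0.
  rewrite mulrAC; apply: ler_pM => //.
  rewrite /harmonic -invfM lef_pV2 ?posrE ?expR_gt0//.
  by apply: le_trans (expR_ge1Dx _); rewrite lerDr.
have [nk cs cX] := cvg_grid_finite ss; rewrite /s ss /=.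
apply: cvgM.
  apply: (continuous_cvg _ (@continuous_expR R _)).
  by apply: cvgN; apply: cvgMr.
exact: (continuous_cvg _ (cW _)).
Qed.

End GridLimit.

Lemma cvg_Rintegral_ae {d} {T : measurableType d} {R : realType}
    (Q : probability T R) (f_ : nat -> T -> R) (f : T -> R) (M : R) :
  (forall n, measurable_fun setT (f_ n)) -> measurable_fun setT f ->
  (forall n w, `|f_ n w| <= M) -> (forall w, `|f w| <= M) ->
  {ae Q, forall w, f_ n w @[n --> \oo] --> f w} ->
  \int[Q]_w f_ n w @[n --> \oo] --> \int[Q]_w f w.
Proof.
move=> mf_ mf fM fM' cf.
have [|||||_ _ H] := @dominated_convergence _ _ _ Q setT measurableT
  (fun n => EFin \o f_ n) (EFin \o f) (fun=> M%:E).
- by move=> n; exact/measurable_EFinP.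
- exact/measurable_EFinP.
- by apply: filterS cf => w cw _; apply: cvg_comp cw _.
- exact: (@bounded_integrable _ _ _ Q (fun=> M) `|M|).
- by apply: aeW => w n _; rewrite /= lee_fin.
apply: fine_cvg; rewrite fineK//.
by apply: integrable_fin_num => //; exact: bounded_integrable fM'.
Qed.

Lemma cvg_Rintegral {d} {T : measurableType d} {R : realType}
    (Q : probability T R) (f_ : nat -> T -> R) (f : T -> R) (M : R) :
  (forall n, measurable_fun setT (f_ n)) ->
  (forall n w, `|f_ n w| <= M) ->
  (forall w, f_ n w @[n --> \oo] --> f w) ->
  \int[Q]_w f_ n w @[n --> \oo] --> \int[Q]_w f w.
Proof.
move=> mf fM cf; apply: (@cvg_Rintegral_ae _ _ _ Q f_ f M) => //.
- by apply: measurable_fun_cvg mf _ => w _.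
- move=> w; have cn : `|f_ n w| @[n --> \oo] --> `|f w| by apply: cvg_norm; exact: cf.
  rewrite -(cvg_lim _ cn)//; apply: limr_le; first exact: cvgP cn.
  by apply: nearW => n.
- exact: aeW.
Qed.

Section DriftedPath.
Context {d : measure_display} {Omega : measurableType d} {R : realType}.
Variable P : probability Omega R.
Variables (lam a : R) (F : R -> R).
Variables (N : R -> {RV P >-> nat}) (J : nat -> {RV P >-> R}).
Hypothesis cp : compound_poisson lam F N J.

Lemma drifted_path_skip_free w : skip_free a (fun t => drifted_path a N J t w).
Proof.
have [[N0 Nmono Nrc _ _] J0 _ _ _] := cp; split.
- by rewrite /drifted_path N0 big_ord0 mulr0 subrr.
- move=> t t0; have [e e0 He] := Nrc w t t0.
  exists e => // u tu ue; rewrite /drifted_path.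
  have -> : N u w = N t w.
    move: tu; rewrite le_eqVlt => /predU1P[->//|tu].
    by apply: He => //=; rewrite ltr0_norm ?subr_lt0// opprB ltrBlDl.
  ring.
- move=> s t s0 st; rewrite /drifted_path.
  have Nst := Nmono w s t s0 st.
  have : \sum_(k < N s w) J k w <= \sum_(k < N t w) J k w.
    rewrite (big_ord_widen _ (fun k => J k w) Nst) big_mkcond /=.
    by apply: ler_sum => k _; case: ifP => // _; exact: ltW.
  lra.
Qed.

Lemma measurable_drifted_path (G : set (set Omega)) t :
  measurable_wrt G (N t : Omega -> nat) ->
  (forall k, measurable_wrt G (J k : Omega -> R)) ->
  measurable_wrt G (drifted_path a N J t).
Proof.
move=> mN mJ; apply: (@measurable_nat_case _ _ (g_sigma_algebraType G) R (N t)
  (fun n w => \sum_(k < n) J k w - a * t)) => // n.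
apply: measurable_funB; last exact: measurable_cst.
by apply: measurable_sum => i; exact: mJ.
Qed.

End DriftedPath.

Section ExitMeasurable.
Context {d : measure_display} {T : measurableType d} {R : realType}.
Variables (a lo hi r : R) (y : T -> R) (f : R -> T -> R).
Hypothesis a_gt0 : 0 < a.
Hypothesis f_sf : forall w, skip_free a (f ^~ w).
Hypothesis my : measurable_fun setT y.
Hypothesis mf : forall t, 0 <= t -> measurable_fun setT (f t).

Let S h (j : nat) w := y w + f (j%:R * h) w.
Let inside z := lo <= z <= hi.

Lemma measurable_inside g : measurable_fun setT g ->
  measurable_fun setT (fun w : T => lo <= g w <= hi).
Proof.
move=> mg; apply: measurable_and; apply: measurable_fun_ler => //; exact: measurable_cst.
Qed.

Lemma measurable_grid_value h j : 0 <= h -> measurable_fun setT (S h j).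
Proof. by move=> h0; apply: measurable_funD => //; apply: mf; rewrite mulr_ge0. Qed.

Lemma measurable_grid_exit h K : 0 <= h ->
  measurable_fun setT (fun w => grid_exit inside (fun j => S h j w) K : nat).
Proof.
move=> h0; elim: K => [|K IH]; first exact: measurable_cst.
under eq_fun do rewrite grid_exitS.
apply: measurable_fun_if => //; last exact: measurable_funTS.
elim: (K.+1) => [|n IHn]; first exact: measurable_cst.
have -> : (fun w => all (fun j => inside (S h j w)) (iota 0 n.+1)) =
  (fun w => all (fun j => inside (S h j w)) (iota 0 n) && inside (S h n w)).
  by apply/funext => w; rewrite -addn1 iotaD all_cat /= andbT add0n.
by apply: measurable_and => //; apply: measurable_inside; exact: measurable_grid_value.
Qed.

Let X w t := y w + f t w.

(** Limits of functions of finitely many values of the path. *)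
Lemma measurable_exit_discount :
  measurable_fun setT (fun w => if inside (y w)
    then exit_discount r (exit_from (X w) lo hi) else 0).
Proof.
pose k p w := grid_index (f ^~ w) (y w) lo hi p.
have mk p : measurable_fun setT (k p) by apply: measurable_grid_exit; exact: ltW (mesh_gt0 p).
apply: (@measurable_fun_cvg _ _ _ _ (fun p w => if inside (y w) then
  if (k p w < horizon p)%N then expR (- (r * ((k p w)%:R * mesh p))) else 0 else 0)).
  move=> p; apply: measurable_fun_if => //.
  - exact: measurable_inside.
  - apply: measurable_funTS.
    exact: (measurableT_comp (f := fun n : nat => if (n < horizon p)%N
       then expR (- (r * (n%:R * mesh p))) else 0)).
move=> w _; case: ifPn => [yin|_]; last exact: cvg_cst.
exact: (cvg_grid_discount a_gt0 (f_sf w) yin).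
Qed.

Lemma measurable_exit_position :
  measurable_fun setT (fun w => if inside (y w)
    then exit_position (X w) (exit_from (X w) lo hi) else 0).
Proof.
pose k p w := grid_index (f ^~ w) (y w) lo hi p.
have mk p : measurable_fun setT (k p) by apply: measurable_grid_exit; exact: ltW (mesh_gt0 p).
apply: (@measurable_fun_cvg _ _ _ _ (fun p w => if inside (y w) then
  if (k p w < horizon p)%N then X w ((k p w)%:R * mesh p) else 0 else 0)).
  move=> p; apply: measurable_fun_if => //.
  - exact: measurable_inside.
  - apply: measurable_funTS; apply: measurable_fun_if => //.
    + exact: (measurableT_comp (f := fun n : nat => (n < horizon p)%N)).
    + apply: measurable_funTS.
      apply: (@measurable_nat_case _ _ _ _ (k p) (fun n w => S (mesh p) n w)) => //.
      by move=> n; apply: measurable_grid_value; exact: ltW (mesh_gt0 p).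
move=> w _; case: ifPn => [yin|_]; last exact: cvg_cst.
exact: (cvg_grid_position a_gt0 (f_sf w) yin).
Qed.

End ExitMeasurable.

(** * The supermartingale bound over one stage *)

Section Stage.
Context {d : measure_display} {Omega : measurableType d} {R : realType}.
Variable P : probability Omega R.
Variables (lam a : R) (F : R -> R).
Variables (N : R -> {RV P >-> nat}) (J : nat -> {RV P >-> R}).
Hypothesis cp : compound_poisson lam F N J.
Hypotheses (lam_gt0 : 0 < lam) (a_gt0 : 0 < a).
Hypothesis same_law : forall k D, measurable D -> P (J k @^-1` D) = P (J 0%N @^-1` D).
Variable past : set (set Omega).
Hypothesis past_meas : past `<=` measurable.
Hypothesis past_indep : independent2 P <<s past>> (copy_sigma N J).
Variables (lo hi r C M : R) (W : R -> R) (y g0 : Omega -> R).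
Hypotheses (r_gt0 : 0 < r) (C_ge0 : 0 <= C).
Hypotheses (W_cont : continuous W) (W_le : forall z, `|W z| <= M).
Hypothesis y_past : measurable_wrt past y.
Hypothesis g0_past : measurable_wrt past g0.
Hypothesis g0_01 : forall w, 0 <= g0 w <= 1.
Hypothesis g0_in : forall w, g0 w != 0 -> lo <= y w <= hi.
Hypothesis step_le : forall h, 0 < h -> h <= 1 -> forall z, lo <= z <= hi ->
  expR (- (r * h)) * step_mean lam a J h W z <= W z + C * h ^+ 2.

Let xi t := drifted_path a N J t.
Let S h (j : nat) w := y w + xi (j%:R * h) w.
Let inside z := lo <= z <= hi.
Let index h k w := grid_exit inside (fun j => S h j w) k.
(** The discounted value at the exit observed on the grid, stopped after [k]
    cells. *)
Let value h k w := expR (- (r * ((index h k w)%:R * h))) * W (S h (index h k w) w).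
Let all_in h k w := all (fun j => inside (S h j w)) (iota 0 k).

Let mW : measurable_fun setT W.
Proof. exact: continuous_measurable_fun. Qed.

Let my : measurable_fun setT y := measurable_wrt_measurable past_meas y_past.
Let mg0 : measurable_fun setT g0 := measurable_wrt_measurable past_meas g0_past.

Let mxi t : measurable_fun setT (xi t).
Proof.
apply: (@measurable_nat_case _ _ _ R (N t) (fun n w => \sum_(k < n) J k w - a * t)) => // n.
apply: measurable_funB; last exact: measurable_cst.
exact: measurable_sum.
Qed.

Let mS h j : measurable_fun setT (S h j).
Proof. exact: measurable_funD. Qed.

Let M_ge0 : 0 <= M. Proof. exact: le_trans (normr_ge0 _) (W_le 0). Qed.

Let mvalue h k : 0 <= h -> measurable_fun setT (value h k).
Proof.
move=> h0; apply: (@measurable_nat_case _ _ _ R (index h k)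
   (fun n w => expR (- (r * (n%:R * h))) * W (S h n w))).
  by apply: (@measurable_grid_exit _ _ _ lo hi y xi) => //; move=> t _; exact: mxi.
move=> n; apply: measurable_funM; first exact: measurable_cst.
exact: (measurableT_comp mW).
Qed.

Let value_le h k w : 0 <= h -> `|value h k w| <= M.
Proof.
move=> h0; rewrite normrM ger0_norm ?expR_ge0// -[leRHS]mul1r.
apply: ler_pM => //.
by rewrite -expR0 ler_expR oppr_le0 mulr_ge0 ?mulr_ge0// ltW.
Qed.

Let bvalue h k : 0 <= h -> bounded_measurable (value h k).
Proof. by move=> h0; split; [exact: mvalue|exists M => w; exact: value_le]. Qed.

Let bg0 : bounded_measurable g0.
Proof.
split => //; exists 1 => w.
by have /andP[g00 g01] := g0_01 w; rewrite ger0_norm.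
Qed.

Let Cstep := C + M * lam ^+ 2.

(** While the path has stayed inside, [one_step] and the hypothesis on [step_mean]
    bound the change over one cell by a multiple of [h ^ 2]; after the exit the
    value is frozen. *)
Let value_step h k : 0 < h -> h <= 1 ->
  \int[P]_w (g0 w * value h k.+1 w) <= \int[P]_w (g0 w * value h k w) + Cstep * h ^+ 2.
Proof.
move=> h0 h1; have h_ge0 := ltW h0.
pose gk w := g0 w * (all_in h k.+1 w)%:R * expR (- (r * (k%:R * h))).
pose fil := filtration N J past h.
have mfS j : (j <= k)%N -> measurable_wrt (fil k k) (S h j).
  move=> jk; apply: measurable_funD; first exact: (measurable_past_filtration cp).
  exact: (measurable_path_filtration a cp).
have mall : forall n, (n <= k.+1)%N -> measurable_wrt (fil k k) (all_in h n).
  elim=> [|n IHn] nk; first exact: measurable_cst.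
  have -> : all_in h n.+1 = (fun w => all_in h n w && inside (S h n w)).
    by apply/funext => w; rewrite /all_in -addn1 iotaD all_cat /= andbT add0n.
  apply: measurable_and; first exact: (IHn (ltnW nk)).
  by apply: measurable_inside; exact: mfS.
have mgk : measurable_wrt (fil k k) gk.
  apply: measurable_funM; last exact: measurable_cst.
  apply: measurable_funM; first exact: (measurable_past_filtration cp).
  apply: (measurableT_comp (f := fun b : bool => b%:R : R)) => //.
  exact: mall.
have gk01 w : 0 <= gk w <= 1.
  have /andP[g00 g01] := g0_01 w.
  have e1 : expR (- (r * (k%:R * h))) <= 1.
    by rewrite -expR0 ler_expR oppr_le0 mulr_ge0 ?mulr_ge0// ltW.
  rewrite /gk; case: (all_in _ _ _); rewrite ?mulr0 ?mul0r ?lexx ?ler01//= mulr1.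
  by rewrite mulr_ge0 ?expR_ge0// mulr_ile1 ?expR_ge0.
have fm : fil k k `<=` measurable by exact: (filtration_meas past_meas h0).
have bgk : bounded_measurable gk.
  split; first exact: measurable_wrt_measurable fm mgk.
  by exists 1 => w; have /andP[? ?] := gk01 w; rewrite ger0_norm.
have bWS j : bounded_measurable (fun w => W (S h j w)).
  by split; [exact: (measurableT_comp mW)|exists M].
pose rest w := g0 w * (~~ all_in h k.+1 w)%:R * value h k w.
have brest : bounded_measurable rest.
  apply: bounded_measurableM; last exact: bvalue.
  apply: bounded_measurableM => //; apply: bounded_measurable_indic.
  apply: (measurableT_comp (f := negb)) => //.
  exact: measurable_wrt_measurable fm (mall _ (leqnn _)).
have V1 w : g0 w * value h k.+1 w =
    expR (- (r * h)) * (gk w * W (S h k.+1 w)) + rest w.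
  rewrite /value /index grid_exitS -/(index h k w) -/(all_in h k.+1 w) /gk /rest.
  case: ifP => Ha.
    rewrite /= mulr0 mul0r addr0 mulr1 -natr1 mulrDl mul1r mulrDr opprD expRD; ring.
  by rewrite /= !(mulr0, mul0r, add0r) mulr1.
have V0 w : g0 w * value h k w = gk w * W (S h k w) + rest w.
  rewrite /gk /rest; case: (boolP (all_in h k.+1 w)) => Ha /=.
    have : index h k w = k.
      apply: grid_exit_all; move: Ha.
      by rewrite /all_in -addn1 iotaD all_cat => /andP[].
    rewrite /value => ->; rewrite !(mulr0, mul0r, addr0) mulr1; ring.
  by rewrite !(mulr0, mul0r, add0r) mulr1.
have lam_h : 0 < lam * h by rewrite mulr_gt0.
have bgW j : bounded_measurable (fun w => gk w * W (S h j w)).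
  exact: bounded_measurableM.
have bc (c : R) (f : Omega -> R) : bounded_measurable f -> bounded_measurable (fun w => c * f w).
  by move=> bf; apply: bounded_measurableM => //; exact: bounded_measurable_cst.
under eq_Rintegral do rewrite V1.
rewrite [in leRHS](eq_Rintegral _ (g := fun w => gk w * W (S h k w) + rest w)); last first.
  by move=> w _; exact: V0.
rewrite RintegralD_bm//; last exact: bc.
rewrite RintegralD_bm// addrAC lerD2r RintegralZ_bm//.
have := @one_step _ _ _ P lam a F N J cp past past_meas past_indep h h0 same_law k W M
  y gk mW W_le y_past mgk gk01.
rewrite -/(S h k.+1 _).
set I1 := \int[P]_w _; set I2 := \int[P]_w _ => os.
set I3 := \int[P]_w _.
have e1 : expR (- (r * h)) <= 1.
  by rewrite -expR0 ler_expR oppr_le0 mulr_ge0// ltW.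
have e0 : 0 < expR (- (r * h)) by exact: expR_gt0.
have p2 := poisson_two_or_more lam_h.
suff I23 : expR (- (r * h)) * I2 <= I3 + C * h ^+ 2.
  rewrite /Cstep; set p := (1 - _ - _) in os p2.
  have Mp : M * p <= M * (lam * h) ^+ 2 by exact: ler_wpM2l.
  have eMp : expR (- (r * h)) * (M * p) <= M * (lam * h) ^+ 2.
    apply: le_trans (_ : expR (- (r * h)) * (M * (lam * h) ^+ 2) <= _).
      by rewrite ler_pM2l.
    by rewrite ler_piMl// mulr_ge0// sqr_ge0.
  have : expR (- (r * h)) * I1 <= expR (- (r * h)) * (I2 + M * p) by rewrite ler_pM2l.
  rewrite mulrDr; move: eMp I23; rewrite exprMn; lra.
have bstep : bounded_measurable (step_mean lam a J h W).
  by apply: bounded_measurable_step_mean; split => //; exists M.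
rewrite -RintegralZ_bm; last first.
  apply: bounded_measurableM => //; have [mst [B stB]] := bstep.
  by split; [exact: (measurableT_comp mst (mS h k))|exists B].
have Ih : \int[P]_w (C * h ^+ 2) = C * h ^+ 2 by rewrite Rintegral_prob_cst.
rewrite -[X in _ <= _ + X]Ih -RintegralD_bm//; last exact: bounded_measurable_cst.
apply: le_Rintegral_bm.
- apply: bc; apply: bounded_measurableM => //; have [mst [B stB]] := bstep.
  by split; [exact: (measurableT_comp mst (mS h k))|exists B].
- by apply: bounded_measurableD => //; exact: bounded_measurable_cst.
move=> w; have Ch0 : 0 <= C * h ^+ 2 by rewrite mulr_ge0// sqr_ge0.
have [gk0|gkn0] := eqVneq (gk w) 0.
  by rewrite gk0 !mul0r mulr0 add0r.
have Sin : inside (S h k w).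
  move: gkn0; rewrite /gk; case: (boolP (all_in h k.+1 w)); last by rewrite mulr0 mul0r eqxx.
  by rewrite /all_in -addn1 iotaD all_cat /= add0n andbT => /andP[].
have /andP[gk0 gk1] := gk01 w.
have := step_le h0 h1 Sin.
move: (step_mean _ _ _ _ _ _) => st Hst.
rewrite mulrCA; apply: le_trans (_ : gk w * (W (S h k w) + C * h ^+ 2) <= _).
  exact: ler_wpM2l.
by rewrite mulrDr lerD2l ler_piMl.
Qed.

Let value_iter h k : 0 < h -> h <= 1 ->
  \int[P]_w (g0 w * value h k w) <= \int[P]_w (g0 w * W (y w)) + k%:R * (Cstep * h ^+ 2).
Proof.
move=> h0 h1; elim: k => [|k IH].
  rewrite mul0r addr0 le_eqVlt; apply/orP; left; apply/eqP.
  apply: eq_Rintegral => w _; rewrite /value /index /grid_exit /= /S /xi.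
  have [[N0 _ _ _ _] _ _ _ _] := cp.
  by rewrite mul0r mulr0 oppr0 expR0 mul1r /drifted_path N0 big_ord0 mulr0 subr0 addr0.
apply: le_trans (value_step k h0 h1) _.
by rewrite -natr1 [X in _ <= _ + X]mulrDl mul1r addrA lerD2r.
Qed.

(** Summed over [horizon p] cells, the errors of [value_step] are of the order of
    [horizon p * mesh p ^ 2], and the discrete exits converge to the exit. *)
Lemma stage_supermartingale :
  \int[P]_w (g0 w * (exit_discount r (exit_from (fun t => y w + xi t w) lo hi)
     * W (exit_position (fun t => y w + xi t w)
           (exit_from (fun t => y w + xi t w) lo hi))))
  <= \int[P]_w (g0 w * W (y w)).
Proof.
have sf (w : Omega) : skip_free a (fun t => xi t w).
  exact: (drifted_path_skip_free a cp).
have cvg_value : \int[P]_w (g0 w * value (mesh p) (horizon p) w) @[p --> \oo] -->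
   \int[P]_w (g0 w * (exit_discount r (exit_from (fun t => y w + xi t w) lo hi)
     * W (exit_position (fun t => y w + xi t w)
           (exit_from (fun t => y w + xi t w) lo hi)))).
  apply: (@cvg_Rintegral _ _ _ P _ _ M).
  - by move=> p; apply: measurable_funM => //; apply: mvalue; exact: ltW (mesh_gt0 p).
  - move=> p w; rewrite normrM -[leRHS]mul1r; apply: ler_pM => //.
      by have /andP[g00 g01] := g0_01 w; rewrite ger0_norm.
    by apply: value_le; exact: ltW (mesh_gt0 p).
  - move=> w; have [->|/g0_in yin] := eqVneq (g0 w) 0.
      by rewrite mul0r; under eq_fun do rewrite mul0r; exact: cvg_cst.
    apply: cvgMr; exact: (cvg_grid_value a_gt0 r_gt0 (sf w) yin W_cont W_le).
apply: (ler_cvg_to cvg_value (g := fun p => \int[P]_w (g0 w * W (y w)) + Cstep * harmonic p)).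
  rewrite -[X in _ --> X]addr0 -[X in _ --> _ + X](mulr0 Cstep).
  by apply: cvgD; [exact: cvg_cst|apply: cvgMr; exact: cvg_harmonic].
apply: nearW => p; apply: le_trans (value_iter _ (mesh_gt0 p) (mesh_le1 p)) _.
rewrite lerD2l mulrCA; apply: ler_wpM2l.
  by rewrite /Cstep addr_ge0// mulr_ge0// sqr_ge0.
rewrite expr2 mulrA horizon_mesh /mesh /harmonic /=.
rewrite exprSr invfM mulrA -[leRHS]mul1r; apply: ler_wpM2r; first by rewrite invr_ge0.
by rewrite expr2 invfM mulrA mulfV// mul1r invf_le1// ler1n.
Qed.

End Stage.

(** * The chain of stages of the oscillating process *)

Section Chain.
Context {R : realType}.
Variables (b B x r : R) (a : bool -> R) (f : bool -> nat -> R -> R).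
Hypotheses (b_gt0 : 0 < b) (b_ltB : b < B) (x_gt0 : 0 < x) (x_leB : x <= B).
Hypothesis a_gt0 : forall i, 0 < a i.
Hypothesis f_sf : forall i n, skip_free (a i) (f i n).

Definition regime_lo (i : bool) : R := if i then b else 0.
Definition regime_hi (i : bool) : R := if i then B else b.
Definition alive (y : R) : bool := 0 < y <= B.

Definition stage_path (n : nat) (y : R) (t : R) : R := y + f (b < y) n t.

Definition stage_exit (n : nat) (y : R) : \bar R :=
  exit_from (stage_path n y) (regime_lo (b < y)) (regime_hi (b < y)).

(** Discount accumulated and position reached after [n] stages. A stage of the
    chain lasts until the path leaves the closed interval of its regime, that is,
    until the process switches or leaves [[0, B]]; from then on the chain is
    constant. *)
Fixpoint chain (n : nat) : R * R :=
  if n is m.+1 then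
    let: (th, y) := chain m in
    if alive y then
      (th * exit_discount r (stage_exit m y), exit_position (stage_path m y) (stage_exit m y))
    else (th, y)
  else (1, x).

Lemma alive_in_regime y : alive y -> regime_lo (b < y) <= y <= regime_hi (b < y).
Proof.
move=> /andP[y0 yB]; rewrite /regime_lo /regime_hi; case: ltP => [by_|yb].
  by rewrite ltW.
by rewrite ltW.
Qed.

Let osc := oscillating b f x.

Lemma stage_step_ge0 g y : (0 <= (stage_step b g y).1)%E.
Proof.
rewrite /stage_step; case: ifP => _ /=; apply/ereal_infP => _ [t [t0 _] <-];
  by rewrite lee_fin.
Qed.

Lemma stageS n : stage b f x n.+1 =
  (((stage b f x n).1 + (stage_step b (fun i => f i n) (stage b f x n).2).1)%E,
   (stage_step b (fun i => f i n) (stage b f x n).2).2).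
Proof. by rewrite /=; case: (stage b f x n) => T y /=; case: (stage_step _ _ _). Qed.

Lemma stage_time_mono n m : (n <= m)%N ->
  ((stage b f x n).1 <= (stage b f x m).1)%E.
Proof.
elim: m => [|m IH]; first by rewrite leqn0 => /eqP->.
rewrite leq_eqVlt => /predU1P[->//|nm]; apply: le_trans (IH nm) _.
by rewrite stageS /= leeDl// stage_step_ge0.
Qed.

(** The starting times of the stages are monotone, so that the stage running at a
    given time is unique. *)
Lemma oscillating_eval n (T y t : R) : stage b f x n = (T%:E, y) -> T <= t ->
  (t%:E < (stage b f x n.+1).1)%E -> osc t = stage_path n y (t - T).
Proof.
move=> sn Tt tn; rewrite /osc /oscillating.
set P := [set n | _].
have Pn : P n by split => //; rewrite sn lee_fin.
have [Pg1 Pg2] : P (get P) by apply: getPex; exists n.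
have -> : get P = n.
  apply/eqP; rewrite eqn_leq; apply/andP; split; rewrite leqNgt; apply/negP => lt.
    have := lt_le_trans tn (stage_time_mono lt).
    by rewrite ltNge Pg1.
  have := lt_le_trans Pg2 (stage_time_mono lt).
  by rewrite sn lte_fin ltNge Tt.
by rewrite sn.
Qed.

(** The condition that ends a stage of the process: it concerns the level [b]
    only, and not the boundary of [[0, B]]. *)
Let trigger n y t := if b < y then stage_path n y t <= b else b < stage_path n y t.

Lemma stage_durationE n y :
  (stage_step b (fun i => f i n) y).1 =
  ereal_inf [set t%:E | t in [set t | 0 <= t /\ trigger n y t]].
Proof.
rewrite /stage_step /trigger /stage_path /above /below; case: ifP => by_ /=.
  congr ereal_inf; congr image; apply/seteqP.
  have E t : (f true n t <= - (y - b)) = (y + f true n t <= b).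
    by rewrite opprB lerBrDl.
  by split => t [t0 H]; split => //; [rewrite -[is_true _]/(is_true (y + f true n t <= b)) -E|
    rewrite -[is_true _]/(is_true (f true n t <= - (y - b))) E].
congr ereal_inf; congr image; apply/seteqP.
have E t : (b - y < f false n t) = (b < y + f false n t) by rewrite ltrBlDl.
by split => t [t0 H]; split => //; [rewrite -[is_true _]/(is_true (b < y + f false n t)) -E|
  rewrite -[is_true _]/(is_true (b - y < f false n t)) E].
Qed.

(** Above [b], the trigger condition at a time [t] puts the path strictly below
    [b], outside of its interval, right after [t]. *)
Lemma trigger_after n y (s t : R) : alive y ->
  (forall u, 0 <= u -> u < s ->
     regime_lo (b < y) <= stage_path n y u <= regime_hi (b < y)) ->
  0 <= t -> trigger n y t -> s <= t.
Proof.
move=> ay sin t0; rewrite /trigger [s <= t]leNgt; case: ifP => by_ tr; apply/negP => ts.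
  have [_ frc _] := f_sf above n; have [e e0 fe] := frc t t0.
  pose u := t + Num.min (e / 2) ((s - t) / 2).
  have m0 : 0 < Num.min (e / 2) ((s - t) / 2).
    have st0 : 0 < s - t by rewrite subr_gt0.
    by rewrite lt_min !divr_gt0.
  have me : Num.min (e / 2) ((s - t) / 2) <= e / 2 by rewrite ge_min lexx.
  have ms : Num.min (e / 2) ((s - t) / 2) <= (s - t) / 2 by rewrite ge_min lexx orbT.
  have := sin u; rewrite by_ /= /stage_path by_.
  rewrite (fe u); [|rewrite /u; lra|rewrite /u; lra].
  have au : 0 < a above * (u - t) by rewrite mulr_gt0// /u; lra.
  move: tr; rewrite /stage_path by_ => tr.
  have u0 : 0 <= u by rewrite /u; lra.
  have us : u < s by rewrite /u; lra.
  move=> /(_ u0 us) /andP[+ _].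
  rewrite -[above]/true in au *; lra.
have /andP[_] := sin t t0 ts; rewrite by_ /= => /le_lt_trans/(_ tr).
by rewrite ltxx.
Qed.

(** An exit of the regime interval at [p] is a switch when it takes place at the
    end that is common to the two regimes. *)
Definition switches (y p : R) := if b < y then p == b else b < p.

Lemma stage_switch n y (s : R) : alive y ->
  exit_at (a (b < y)) (stage_path n y) (regime_lo (b < y)) (regime_hi (b < y)) s ->
  switches y (stage_path n y s) ->
  stage_step b (fun i => f i n) y = (s%:E, stage_path n y s).
Proof.
move=> ay [s0 sin sc [e e0 [XE _]]] sw.
have trs : trigger n y s.
  by move: sw; rewrite /switches /trigger; case: ifP => _ // /eqP->.
have D1 : (stage_step b (fun i => f i n) y).1 = s%:E.
  rewrite stage_durationE; apply: ereal_inf_real.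
    by move=> t [t0 tr]; exact: trigger_after tr.
  by move=> eps eps0; exists s => //; rewrite ltrDl.
rewrite [LHS]surjective_pairing D1; congr pair.
move: D1 sw; rewrite /stage_step /switches; case: ifP => by_ /=.
  by move=> _ /eqP->.
by rewrite /overshoot => -> _ /=; rewrite /stage_path by_; rewrite -[below]/false; lra.
Qed.

(** After an exit through the boundary of [[0, B]] the stage of the process goes on
    for a while, so that the process really leaves [[0, B]] at that time. *)
Lemma stage_noswitch n y (s : R) : alive y ->
  exit_at (a (b < y)) (stage_path n y) (regime_lo (b < y)) (regime_hi (b < y)) s ->
  ~~ switches y (stage_path n y s) ->
  exists2 e, 0 < e & ((s + e)%:E <= (stage_step b (fun i => f i n) y).1)%E.
Proof.
move=> ay [s0 sin sc [e e0 [XE _]]] nsw.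
pose e' := if b < y then Num.min e ((stage_path n y s - b) / a (b < y)) else e.
have e'0 : 0 < e'.
  move: nsw sc; rewrite /e' /switches; case: ifP => by_ //= nb [pb|pB].
    by rewrite pb eqxx in nb.
  by rewrite lt_min e0 divr_gt0// subr_gt0; apply: lt_trans pB.
exists e' => //; rewrite stage_durationE; apply/ereal_infP => _ [t [t0 tr] <-].
rewrite lee_fin leNgt; apply/negP => tse.
have st : s <= t by exact: trigger_after tr.
have te : t < s + e.
  apply: lt_le_trans tse _; rewrite lerD2l /e'; case: ifP => // _.
  by rewrite ge_min lexx.
move: tr; rewrite /trigger (XE t st te).
have at0 : 0 <= a (b < y) * (t - s) by rewrite mulr_ge0 ?subr_ge0// ltW.
move: nsw sc at0 tse; rewrite /switches /e'; case: ifP => by_ nb sc at0 tse.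
  have : t - s < (stage_path n y s - b) / a true.
    by rewrite ltrBlDl; apply: lt_le_trans tse _; rewrite lerD2l ge_min lexx orbT.
  rewrite ltr_pdivlMr// => H1 H2; lra.
by rewrite -leNgt in nb; lra.
Qed.

(** After [n] stages the process has neither left [[0, B]] nor lost track of the
    chain. *)
Definition in_progress n (T y : R) := [/\ 0 <= T, stage b f x n = (T%:E, y),
  chain n = (expR (- (r * T)), y), alive y &
  forall t, 0 <= t -> t < T -> 0 <= osc t <= B].

Lemma in_progress0 : in_progress 0 0 x.
Proof.
split => //=; first by rewrite mulr0 oppr0 expR0.
- by rewrite /alive x_gt0.
- by move=> t t0 /(le_lt_trans t0); rewrite ltxx.
Qed.

Lemma regime_sub y z : regime_lo (b < y) <= z <= regime_hi (b < y) -> 0 <= z <= B.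
Proof.
rewrite /regime_lo /regime_hi; case: ifP => _ /andP[z1 z2].
  by rewrite z2 (le_trans _ z1)// ltW.
by rewrite z1 (le_trans z2)// ltW.
Qed.

Lemma chain_frozen n m : ~~ alive (chain n).2 -> (n <= m)%N -> chain m = chain n.
Proof.
move=> dead; elim: m => [|m IH]; first by rewrite leqn0 => /eqP->.
rewrite leq_eqVlt => /predU1P[->//|nm].
have cm := IH nm; rewrite /= cm; move: dead.
by case: (chain n) => th y /= /negbTE->.
Qed.

Definition exited n := exists T, [/\ exit_time osc B = T%:E,
  forall m, (n <= m)%N -> chain m = (expR (- (r * T)), osc T) & osc T = 0 \/ B < osc T].

Definition never_exits n := exit_time osc B = +oo%E /\
  forall m, (n <= m)%N -> chain m = (0, 0).

(** A stage of the chain ends with the exit from [[0, B]], never, or with a switch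
    that starts the next stage. *)
Lemma progress n (T y : R) : in_progress n T y ->
  [\/ exited n.+1, never_exits n.+1 | exists s, [/\ 0 <= s, in_progress n.+1 (T + s) (stage_path n y s)
                  & switches y (stage_path n y s)]].
Proof.
move=> [T0 sn cn ay oscT].
have := exit_fromP (a_gt0 (b < y)) (f_sf (b < y) n) (alive_in_regime ay).
rewrite -/(stage_path n y) => -[[sE' Xin]|[s sE' ex]].
  have sE : stage_exit n y = +oo%E by exact: sE'.
  have dur : (stage b f x n.+1).1 = +oo%E.
    rewrite stageS sn /= stage_durationE.
    rewrite (_ : [set t | _] = set0) ?image_set0 ?ereal_inf0//.
    apply/seteqP; split => // t [t0 tr].
    have : t + 1 <= t by apply: (trigger_after ay _ t0 tr) => u u0 _; exact: Xin.
    lra.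
  constructor 2; split.
    rewrite /exit_time (_ : [set t | _] = set0) ?image_set0 ?ereal_inf0//.
    apply/seteqP; split => // t [t0 /negP]; apply.
    have [tT|Tt] := ltP t T; first exact: oscT.
    rewrite (oscillating_eval sn Tt); last by rewrite dur ltry.
    by apply: (@regime_sub y); apply: Xin; rewrite subr_ge0.
  have c1 : chain n.+1 = (0, 0) by rewrite /= cn ay sE /= mulr0.
  have dc : ~~ alive (chain n.+1).2 by rewrite c1 /alive /= ltxx.
  by move=> m nm; rewrite (chain_frozen dc nm).
have sE : stage_exit n y = s%:E by exact: sE'.
have [s0 Xin Xs [e e0 [XE Xout]]] := ex.
set p := stage_path n y s in Xs XE.
have c1 : chain n.+1 = (expR (- (r * (T + s))), p).
  by rewrite /= cn ay sE /= -expRD mulrDr opprD.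
have Ts0 : 0 <= T + s by rewrite addr_ge0.
have osc_before (t : R) : 0 <= t -> t < T + s ->
    ((T + s)%:E <= (stage b f x n.+1).1)%E -> 0 <= osc t <= B.
  move=> t0 tTs le1; have [tT|Tt] := ltP t T; first exact: oscT.
  rewrite (oscillating_eval sn Tt); last by apply: lt_le_trans le1; rewrite lte_fin.
  by apply: (@regime_sub y); apply: Xin; lra.
have exitedI : exit_time osc B = (T + s)%:E -> osc (T + s) = p -> ~~ alive p ->
    p = 0 \/ B < p -> exited n.+1.
  move=> et op dp pc; exists (T + s); split => //; last by move: pc; rewrite -op.
  have dc : ~~ alive (chain n.+1).2 by rewrite c1.
  by move=> m nm; rewrite (chain_frozen dc nm) c1 op.
have [sw|nsw] := boolP (switches y p).
  have st1 : stage b f x n.+1 = ((T + s)%:E, p).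
    by rewrite stageS sn /= (stage_switch ay ex sw).
  have obf (t : R) : 0 <= t -> t < T + s -> 0 <= osc t <= B.
    by move=> t0 tTs; apply: osc_before => //; rewrite st1.
  have [ap|dp] := boolP (alive p).
    by constructor 3; exists s; split.
  have pB : B < p.
    rewrite ltNge; apply/negP => pB; move: dp; rewrite /alive pB andbT => /negP; apply.
    by move: sw; rewrite /switches; case: ifP => _; [move=> /eqP->|exact: lt_trans].
  have bp : b < p by exact: lt_trans pB.
  have oscp : osc (T + s) = p.
    rewrite (oscillating_eval st1 (lexx _)); first by rewrite subrr /stage_path bp;
      have [-> _ _] := f_sf true n.+1; rewrite addr0.
    rewrite stageS st1 /= stage_durationE -[ltLHS]adde0 lteD2lE//.
    have [f0 frc _] := f_sf true n.+1; have [eps eps0 feps] := frc 0 (lexx _).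
    have d0 : 0 < Num.min eps ((p - b) / a true).
      by rewrite lt_min eps0 divr_gt0// subr_gt0.
    apply: lt_le_trans (_ : (Num.min eps ((p - b) / a true))%:E <= _)%E.
      by rewrite lte_fin.
    apply/ereal_infP => _ [t [t0 tr] <-]; rewrite lee_fin leNgt; apply/negP => td.
    move: tr; rewrite /trigger /stage_path bp feps//; last first.
      by rewrite add0r; apply: lt_le_trans td _; rewrite ge_min lexx.
    have : t < (p - b) / a true.
      by apply: lt_le_trans td _; rewrite ge_min lexx orbT.
    rewrite ltr_pdivlMr// f0 => H1 H2; lra.
  constructor 1; apply: exitedI => //; last by right.
    apply: ereal_inf_real.
      move=> t [t0 /negP tout]; rewrite leNgt; apply/negP => tTs; apply: tout.
      exact: obf.
    move=> eps eps0; exists (T + s); last by rewrite ltrDl.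
    by split => //; rewrite oscp negb_and -!ltNge pB orbT.
have [e' e'0 dur] := stage_noswitch ay ex nsw.
have dur1 : ((T + s + e')%:E <= (stage b f x n.+1).1)%E.
  by rewrite stageS sn /= -addrA EFinD leeD2l.
have obf (t : R) : 0 <= t -> t < T + s -> 0 <= osc t <= B.
  move=> t0 tTs; apply: osc_before => //; apply: le_trans dur1.
  by rewrite lee_fin lerDl ltW.
have osc_after (u : R) : s <= u -> u < s + e' -> osc (T + u) = stage_path n y u.
  move=> su ue; rewrite (oscillating_eval sn); [|lra|].
    by rewrite addrAC subrr add0r.
  by apply: lt_le_trans dur1; rewrite lte_fin; lra.
have opE : osc (T + s) = p by rewrite osc_after//; lra.
have pc : p = 0 \/ B < p.
  move: nsw Xs; rewrite /switches /regime_lo /regime_hi; case: ifP => _ np [pl|ph].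
  - by rewrite pl eqxx in np.
  - by right.
  - by left.
  - by rewrite ph in np.
have dp : ~~ alive p.
  by rewrite /alive negb_and -leNgt -ltNge; case: pc => [->|->]; rewrite ?lexx ?orbT.
constructor 1; apply: exitedI => //.
rewrite /exit_time; apply: ereal_inf_real.
  move=> t [t0 /negP tout]; rewrite leNgt; apply/negP => tTs; apply: tout.
  exact: obf.
move=> eps eps0; case: pc => [p0|pB]; last first.
  exists (T + s); last by lra.
  by split => //; rewrite opE negb_and -!ltNge pB orbT.
pose m := Num.min eps (Num.min e e') / 2.
have m0 : 0 < m by rewrite divr_gt0// !lt_min eps0 e0.
have m1 : m < eps.
  have : Num.min eps (Num.min e e') <= eps by rewrite ge_min lexx.
  rewrite /m; lra.
have m2 : m < e.
  have : Num.min eps (Num.min e e') <= e by rewrite !ge_min lexx orbT.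
  rewrite /m; lra.
have m3 : m < e'.
  have : Num.min eps (Num.min e e') <= e' by rewrite !ge_min lexx !orbT.
  rewrite /m; lra.
exists (T + (s + m)); last by lra.
split; first by lra.
rewrite osc_after; [|lra|lra].
rewrite XE; [|lra|lra].
rewrite p0 negb_and -!ltNge sub0r addrAC subrr add0r oppr_lt0.
by rewrite mulr_gt0.
Qed.

Definition progressing n := exists T y, in_progress n T y.

Lemma chain_cases : [\/ exists n, exited n, exists n, never_exits n
  | forall n, progressing n].
Proof.
have [[n [T [y ip]] nnext]|all] :=
    pselect (exists2 n, progressing n & ~ progressing n.+1).
  have [ex|ne|[s [_ ip' _]]] := progress ip.
  - by constructor 1; exists n.+1.
  - by constructor 2; exists n.+1.
  - by exfalso; apply: nnext; exists (T + s), (stage_path n y s).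
constructor 3; elim=> [|n IH]; first by exists 0, x; exact: in_progress0.
by apply: contrapT => nn; apply: all; exists n.
Qed.

(** A lower path that is quiet stays below its starting point, hence below [b],
    during one unit of time. Infinitely many quiet stages prevent the switching
    times from accumulating. *)
Definition quiet n := forall t, 0 <= t -> t <= 1 -> f below n t <= 0.

(** The step 2 comes from the alternation of the regimes: once a stage starts below
    [b], so does every second stage after it. *)
Hypothesis quiet_often : forall n, exists k, quiet (n + k.*2).
Hypothesis r_gt0 : 0 < r.

Section Progressing.
Hypothesis all_prog : forall n, progressing n.

Lemma progress_next n T y : in_progress n T y ->
  exists s, [/\ 0 <= s, in_progress n.+1 (T + s) (stage_path n y s)
                  & switches y (stage_path n y s)].
Proof.
move=> ip; have [T' [y' ip']] := all_prog n.+1.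
have [[T'' [_ c oT]]|[_ c]|//] := progress ip.
  have [_ _ c' ay _] := ip'; move: (c n.+1 (leqnn _)); rewrite c' => -[_ y'E].
  move: ay; rewrite y'E /alive; case: oT => [->|]; first by rewrite ltxx.
  by rewrite ltNge => /negbTE->; rewrite andbF.
have [_ _ c' ay _] := ip'; move: (c n.+1 (leqnn _)); rewrite c' => -[/eqP].
by rewrite gt_eqF// expR_gt0.
Qed.

Lemma progress_skip n T y k : in_progress n T y -> ~~ (b < y) ->
  exists T' y', [/\ T <= T', in_progress (n + k.*2) T' y' & ~~ (b < y')].
Proof.
move=> ip yb; elim: k => [|k [T' [y' [TT' ip' y'b]]]].
  by exists T, y; rewrite addn0.
have [s [s0 ip1 sw1]] := progress_next ip'.
have [s' [s'0 ip2 sw2]] := progress_next ip1.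
exists (T' + s + s'), (stage_path (n + k.*2).+1 (stage_path (n + k.*2) y' s) s'); split.
- lra.
- by rewrite doubleS !addnS.
- move: sw1 sw2; rewrite /switches (negbTE y'b) => -> /eqP->.
  by rewrite ltxx.
Qed.

Lemma below_start : exists n T y, in_progress n T y /\ ~~ (b < y).
Proof.
have [T [y ip]] := all_prog 0.
have [by_|yb] := boolP (b < y); last by exists 0, T, y.
have [s [s0 ip1 sw1]] := progress_next ip.
exists 1, (T + s), (stage_path 0 y s); split => //.
by move: sw1; rewrite /switches by_ => /eqP->; rewrite ltxx.
Qed.

(** Each quiet stage that starts below [b] adds at least one unit of time. *)
Lemma progress_long (m : nat) :
  exists n T y, [/\ in_progress n T y, ~~ (b < y) & m%:R <= T].
Proof.
elim: m => [|m [n [T [y [ip yb mT]]]]].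
  have [n [T [y [ip yb]]]] := below_start; exists n, T, y; split => //.
  by case: ip.
have [k qk] := quiet_often n.
have [T' [y' [TT' ip' y'b]]] := progress_skip k ip yb.
have [s [s0 ip1 sw1]] := progress_next ip'.
have [s' [s'0 ip2 sw2]] := progress_next ip1.
have y'leb : y' <= b by rewrite leNgt.
have s1 : 1 < s.
  rewrite ltNge; apply/negP => s1; move: sw1.
  rewrite /switches (negbTE y'b) /stage_path (negbTE y'b).
  have := qk s s0 s1; rewrite -[below]/false; lra.
exists (n + k.*2).+2, (T' + s + s'), (stage_path (n + k.*2).+1 (stage_path (n + k.*2) y' s) s').
split => //.
  by move: sw1 sw2; rewrite /switches (negbTE y'b) => -> /eqP->; rewrite ltxx.
rewrite -natr1; lra.
Qed.

Lemma in_progress_mono n m T y T' y' : (n <= m)%N ->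
  in_progress n T y -> in_progress m T' y' -> T <= T'.
Proof.
move=> nm [_ sn _ _ _] [_ sm _ _ _].
by have := stage_time_mono nm; rewrite sn sm lee_fin.
Qed.

Lemma progressing_never_exits : exit_time osc B = +oo%E.
Proof.
rewrite /exit_time (_ : [set t | _] = set0) ?image_set0 ?ereal_inf0//.
apply/seteqP; split => // t [t0 /negP]; apply.
have [n [T [y [ip _ mT]]]] := progress_long (Num.bound t).
have [_ _ _ _ Hin] := ip; apply: Hin => //.
by apply: lt_le_trans mT; have := archi_boundP t0.
Qed.

Lemma progressing_discount : (chain n).1 @[n --> \oo] --> (0 : R).
Proof.
apply/cvgrPdist_le => e e0.
have [n [T [y [ip _ mT]]]] := progress_long (Num.bound (r^-1 * e^-1)).
near=> m; have nm : (n <= m)%N by near: m; exists n.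
have [T' [y' ip']] := all_prog m.
have TT' := in_progress_mono nm ip ip'.
have [_ _ -> _ _] := ip'; rewrite /= sub0r normrN ger0_norm ?expR_ge0//.
have re0 : 0 < r^-1 * e^-1 by rewrite mulr_gt0// invr_gt0.
have T'0 : r^-1 * e^-1 < T'.
  by apply: lt_le_trans TT'; apply: lt_le_trans mT; apply: archi_boundP; exact: ltW.
have rT : e^-1 <= r * T'.
  by rewrite -ler_pdivrMl//; apply: ltW.
rewrite expRN -[leRHS]invrK lef_pV2 ?posrE ?expR_gt0 ?invr_gt0//.
apply: le_trans rT _; apply: le_trans (expR_ge1Dx _); lra.
Unshelve. all: by end_near. Qed.

End Progressing.

Definition exit_value (g : R -> R) : R :=
  if exit_time osc B is t%:E then expR (- (r * t)) * g (osc t) else 0.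

Lemma exit_side t : exit_time osc B = t%:E -> osc t = 0 \/ B < osc t.
Proof.
move=> et; have [[n [T [eT _ oT]]]|[n [eT _]]|all] := chain_cases.
- by move: et; rewrite eT => -[<-].
- by move: et; rewrite eT.
- by move: et; rewrite progressing_never_exits.
Qed.

(** Either the chain is eventually constant, or its discount tends to 0 and the
    process never leaves [[0, B]]. *)
Lemma chain_exit_value (g : R -> R) (M : R) : (forall z, `|g z| <= M) ->
  (chain n).1 * g (chain n).2 @[n --> \oo] --> exit_value g.
Proof.
move=> gM; rewrite /exit_value.
have [[n [T [-> c _]]]|[n [-> c]]|all] := chain_cases.
- apply: cvg_near_cst; near=> m; rewrite c//; near: m; exact: nbhs_infty_ge.
- apply: cvg_near_cst; near=> m; rewrite c ?mul0r//; near: m; exact: nbhs_infty_ge.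
rewrite progressing_never_exits//; apply/norm_cvg0P.
apply: (@squeeze_cvgr _ _ _ _ (fun=> 0) (fun n => `|(chain n).1| * M)).
- by apply: nearW => n; rewrite normr_ge0 normrM ler_wpM2l.
- exact: cvg_cst.
- rewrite -[X in _ --> X](mul0r M) -(normr0 R); apply: cvgMl.
  by apply: cvg_norm; exact: progressing_discount.
Unshelve. all: by end_near. Qed.

End Chain.

(** For integrands of unknown measurability, such as that of the exit transform on
    the null event where switching times may accumulate: the integral of a
    nonnegative function is a supremum over the simple functions below it. *)
Lemma ge0_le_integral_any {d} {T : measurableType d} {R : realType}
    (mu : {measure set T -> \bar R}) (f g : T -> \bar R) :
  (forall w, 0 <= f w)%E -> (forall w, f w <= g w)%E ->
  (\int[mu]_w f w <= \int[mu]_w g w)%E.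
Proof.
move=> f0 fg; rewrite !ge0_integralTE//; last by move=> w; exact: le_trans (fg w).
apply: le_ereal_sup => _ [h /= hf <-]; exists h => //= w.
exact: le_trans (hf w) (fg w).
Qed.

Lemma measurable_ite d d' (T : measurableType d) (T' : measurableType d')
    (p : T -> bool) (f g : T -> T') :
  measurable_fun setT p -> measurable_fun setT f -> measurable_fun setT g ->
  measurable_fun setT (fun w => if p w then f w else g w).
Proof.
by move=> mp mf mg; apply: measurable_fun_if => //; exact: measurable_funTS.
Qed.

Section Copies.
Context {d : measure_display} {Omega : measurableType d} {R : realType}.
Variable P : probability Omega R.
Variables (a lambda : bool -> R) (F : bool -> R -> R).
Variables (N : bool -> nat -> R -> {RV P >-> nat}).
Variables (J : bool -> nat -> nat -> {RV P >-> R}).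
Hypothesis a_gt0 : forall i, 0 < a i.
Hypothesis lambda_gt0 : forall i, 0 < lambda i.
Hypothesis copies : forall i n, compound_poisson (lambda i) (F i) (N i n) (J i n).
Hypothesis indep : independent_family P
     (fun c : bool * nat => copy_sigma (N c.1 c.2) (J c.1 c.2)).

Let xi i n := drifted_path (a i) (N i n) (J i n).

Lemma jump_law i n k D : measurable D ->
  P (J i n k @^-1` D) = P (J i 0 0%N @^-1` D).
Proof.
have Fcdf m l y : distribution P (J i m l) `]-oo, y]%classic = (F i y)%:E.
  by have [_ _ cE _ _] := copies i m; rewrite -(cE l y).
apply: (@eq_probability_cdf _ (distribution P (J i n k)) (distribution P (J i 0%N 0%N))).
- by rewrite -ge0_fin_numE// fin_num_measure.
- by move=> y; exact: etrans (Fcdf _ _ _) (esym (Fcdf _ _ _)).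
Qed.

Lemma copy_sigma_meas i n : copy_sigma (N i n) (J i n) `<=` measurable.
Proof.
apply: sub_gen_measurable => E [|].
- apply: sub_gen_measurable => _ [s _ [B mB <-]]; exact: (measurable_funP (N i n s)).
- apply: sub_gen_measurable => _ [s _ [B mB <-]]; exact: (measurable_funP (J i n s)).
Qed.

Definition past_copies (n : nat) : set (set Omega) :=
  \bigcup_(c in [set c : bool * nat | (c.2 < n)%N]) copy_sigma (N c.1 c.2) (J c.1 c.2).

Lemma past_copies_meas n : past_copies n `<=` measurable.
Proof. by move=> E [c _ cE]; exact: copy_sigma_meas cE. Qed.

Lemma past_copies_indep i n :
  independent2 P <<s past_copies n>> (copy_sigma (N i n) (J i n)).
Proof.
apply: (@independent_prefix _ _ _ P _
  (fun c : bool * nat => copy_sigma (N c.1 c.2) (J c.1 c.2)) _ (i, n)) => //.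
- by move=> c; exact: smallest_sigma_algebra.
- by move=> c; exact: copy_sigma_meas.
- by rewrite /= ltnn.
Qed.

Lemma past_copies_mono n : past_copies n `<=` <<s past_copies n.+1>>.
Proof.
move=> E [c cn cE]; apply: sub_sigma_algebra; exists c => //=.
by rewrite /= in cn *; exact: ltn_trans cn _.
Qed.

Lemma measurable_path_past i n t : 0 <= t ->
  measurable_wrt (past_copies n.+1) (xi i n t).
Proof.
move=> t0; apply: measurable_drifted_path.
- apply: measurable_wrtP => D mD; apply: sub_sigma_algebra; exists (i, n) => //=.
  apply: sub_sigma_algebra; left; apply: sub_sigma_algebra.
  by exists t => //; exists D => //; rewrite setTI.
- move=> k; apply: measurable_wrtP => D mD; apply: sub_sigma_algebra; exists (i, n) => //=.
  apply: sub_sigma_algebra; right; apply: sub_sigma_algebra.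
  by exists k => //; exists D => //; rewrite setTI.
Qed.

Lemma path_skip_free i n w : skip_free (a i) (fun t => xi i n t w).
Proof. exact: drifted_path_skip_free (copies i n) w. Qed.

(** With positive probability the clock of a given copy does not ring before
    time 1, so by independence this happens almost surely along every arithmetic
    progression of stages. *)
Definition quiet_event : set Omega :=
  \bigcap_n \bigcup_k [set w | N below (n + k.*2)%N 1 w = 0%N].

Let N0_meas n : measurable [set w | N below n 1 w = 0%N].
Proof.
rewrite (_ : [set _ | _] = N below n 1 @^-1` [set 0%N])//.
by rewrite -[X in measurable X]setTI; exact: (measurable_funP (N below n 1)).
Qed.

Lemma measurable_quiet_event : measurable quiet_event.
Proof. by apply: bigcapT_measurable => n; apply: bigcup_measurable => k _. Qed.

Let silent_prob n : P [set w | N below n 1 w <> 0%N] = (1 - expR (- lambda below))%:E.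
Proof.
have [[N00 _ _ pp _] _ _ _ _] := copies below n.
have := pp 0 1 0%N (lexx _) ltr01; rewrite subr0 mulr1 poisson_pmf0// => pE.
rewrite (_ : [set _ | _] = ~` [set w | N below n 1 w = 0%N])//.
rewrite probability_setC// EFinB; congr (_ - _)%E; rewrite -pE; congr (P _).
by apply/seteqP; split => w /=; rewrite N00 addn0.
Qed.

Lemma prob_quiet_event : P (~` quiet_event) = 0%E.
Proof.
rewrite /quiet_event setC_bigcap.
apply/eqP; rewrite eq_le measure_ge0 andbT.
have mb n : measurable (~` \bigcup_k [set w | N below (n + k.*2)%N 1 w = 0%N]).
  by apply: measurableC; apply: bigcup_measurable => k _.
apply: le_trans (generalized_Boole_inequality P mb _) _.
  exact: bigcup_measurable.
rewrite eseries0// => n _ _.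
apply/eqP; rewrite eq_le measure_ge0 andbT.
pose q := 1 - expR (- lambda below).
have q1 : q < 1 by rewrite ltrBlDr ltrDl expR_gt0.
have q0 : 0 <= q by rewrite subr_ge0 -expR0 ler_expR oppr_le0 ltW.
have le_qM M : (P (~` \bigcup_k [set w | N below (n + k.*2)%N 1 w = 0%N]) <= (q ^+ M)%:E)%E.
  pose K := [seq (below, (n + k.*2)%N) | k <- iota 0 M].
  pose A (c : bool * nat) := [set w | N c.1 c.2 1 w <> 0%N].
  have uK : uniq K.
    rewrite map_inj_uniq ?iota_uniq// => k l [] /addnI.
    by move=> /(congr1 half); rewrite !doubleK.
  have AK c : copy_sigma (N c.1 c.2) (J c.1 c.2) (A c).
    apply: sub_sigma_algebra; left; apply: sub_sigma_algebra.
    exists 1; first by rewrite /time_set /=.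
    by exists (~` [set 0%N]) => //; rewrite setTI.
  apply: le_trans (_ : P (\big[setI/setT]_(c <- K) A c) <= _)%E.
    apply: le_measure; rewrite ?inE//.
      apply: bigsetI_measurable => c _; exact: (copy_sigma_meas (AK c)).
    move=> w nw; rewrite -bigcap_seq => c /= /mapP[k _ ->] /= Nk0.
    by apply: nw; exists k.
  rewrite indep// big_map.
  rewrite (eq_bigr (fun=> q%:E)); last by move=> k _; rewrite silent_prob.
  by rewrite prodEFin big_const_seq count_predT size_iota iter_mulr_1.
have := @cvg_expr _ q; rewrite ger0_norm// => /(_ q1) cq.
have cq' : (q ^+ M)%:E @[M --> \oo] --> 0%E by apply: cvg_comp cq _.
rewrite -(cvg_lim _ cq')//; apply: lime_ge; first exact: cvgP cq'.
by apply: nearW => M; exact: le_qM.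
Qed.

Lemma quiet_eventP w : quiet_event w ->
  forall n, exists k, quiet (fun i n t => xi i n t w) (n + k.*2).
Proof.
move=> qw n; have [k _ /= Nk] := qw n Logic.I; exists k => t t0 t1.
have [[_ Nmono _ _ _] _ _ _ _] := copies below (n + k.*2)%N.
have : (N below (n + k.*2)%N t w <= 0)%N by rewrite -Nk; exact: Nmono.
rewrite leqn0 => /eqP Nt; rewrite /xi /drifted_path Nt big_ord0 sub0r oppr_le0.
by rewrite mulr_ge0// ltW.
Qed.

End Copies.

Section Verification.
Context {d : measure_display} {Omega : measurableType d} {R : realType}.
Variable P : probability Omega R.
Variables (a lambda : bool -> R) (F : bool -> R -> R).
Variables (N : bool -> nat -> R -> {RV P >-> nat}).
Variables (J : bool -> nat -> nat -> {RV P >-> R}).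
Hypothesis a_gt0 : forall i, 0 < a i.
Hypothesis lambda_gt0 : forall i, 0 < lambda i.
Hypothesis copies : forall i n, compound_poisson (lambda i) (F i) (N i n) (J i n).
Hypothesis indep : independent_family P
     (fun c : bool * nat => copy_sigma (N c.1 c.2) (J c.1 c.2)).

Let xi i n := drifted_path (a i) (N i n) (J i n).

Variables (b B x r : R).
Hypotheses (b_gt0 : 0 < b) (b_ltB : b < B) (x_gt0 : 0 < x) (x_leB : x <= B).
Hypothesis r_gt0 : 0 < r.

Let paths w : bool -> nat -> R -> R := fun i n t => xi i n t w.
Definition random_chain n w := chain b B x r (paths w) n.
Let theta n w := (random_chain n w).1.
Let Y n w := (random_chain n w).2.

Let sf w i n : skip_free (a i) (paths w i n).
Proof. exact: path_skip_free copies i n w. Qed.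

Lemma exit_from_ge0 (X : R -> R) lo hi : (0 <= exit_from X lo hi)%E.
Proof. by apply/ereal_infP => _ [t [t0 _] <-]; rewrite lee_fin. Qed.

Lemma exit_discount01 (s : \bar R) : (0 <= s)%E -> 0 <= exit_discount r s <= 1.
Proof.
case: s => [s s0| |//] /=; last by rewrite lexx ler01.
by rewrite expR_ge0 -expR0 ler_expR oppr_le0 mulr_ge0// ltW.
Qed.

Lemma random_chainS n w : random_chain n.+1 w =
  if alive B (Y n w) then
    (theta n w * exit_discount r (stage_exit b B (paths w) n (Y n w)),
     exit_position (stage_path b (paths w) n (Y n w)) (stage_exit b B (paths w) n (Y n w)))
  else (theta n w, Y n w).
Proof. by rewrite /theta /Y /random_chain /=; case: (chain _ _ _ _ _ n). Qed.

Lemma theta01 n w : 0 <= theta n w <= 1.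
Proof.
elim: n => [|n IH]; first by rewrite /theta /= ler01 lexx.
rewrite /theta random_chainS; case: ifP => _ //=.
have /andP[t0 t1] := IH; have /andP[e0 e1] := exit_discount01 (exit_from_ge0
  (stage_path b (paths w) n (Y n w)) (regime_lo b (b < Y n w)) (regime_hi b B (b < Y n w))).
by rewrite mulr_ge0//= mulr_ile1.
Qed.

Let regime_exit i n w := exit_from (fun t => Y n w + xi i n t w) (regime_lo b i) (regime_hi b B i).
Let in_regime i n w := alive B (Y n w) && ((b < Y n w) == i).

Let in_regime_in i n w : in_regime i n w -> regime_lo b i <= Y n w <= regime_hi b B i.
Proof. by move=> /andP[ay /eqP <-]; exact: alive_in_regime. Qed.

Let measurable_in_regime (G : set (set Omega)) i n :
  measurable_wrt G (Y n) -> measurable_wrt G (in_regime i n : Omega -> bool).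
Proof.
move=> mY; apply: measurable_and.
  apply: measurable_and; first exact: (measurable_fun_ltr (measurable_cst _) mY).
  exact: (measurable_fun_ler mY (measurable_cst _)).
apply: (measurableT_comp (f := fun c : bool => c == i)) => //.
exact: (measurable_fun_ltr (measurable_cst _) mY).
Qed.

(** Each stage consumes a new copy of the paths, so that the state after [n] stages
    depends only on the copies of index less than [n]. *)
Lemma measurable_random_chain n :
  measurable_wrt (past_copies N J n) (theta n) /\ measurable_wrt (past_copies N J n) (Y n).
Proof.
elim: n => [|n [mt mY]]; first by split; exact: measurable_cst.
have {}mt : measurable_wrt (past_copies N J n.+1) (theta n).
  by apply: measurable_wrt_mono mt; exact: past_copies_mono.
have {}mY : measurable_wrt (past_copies N J n.+1) (Y n).
  by apply: measurable_wrt_mono mY; exact: past_copies_mono.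
have mreg i := measurable_in_regime i mY.
have mxi i t : 0 <= t -> measurable_wrt (past_copies N J n.+1) (xi i n t).
  exact: measurable_path_past.
have sfi i w := sf w i n.
have mdisc i := @measurable_exit_discount _ (g_sigma_algebraType (past_copies N J n.+1)) R
   (a i) (regime_lo b i) (regime_hi b B i) r (Y n) (xi i n) (a_gt0 i) (sfi i) mY (mxi i).
have mpos i := @measurable_exit_position _ (g_sigma_algebraType (past_copies N J n.+1)) R
   (a i) (regime_lo b i) (regime_hi b B i) (Y n) (xi i n) (a_gt0 i) (sfi i) mY (mxi i).
split.
- have -> : theta n.+1 = fun w =>
    if in_regime true n w then theta n w *
      (if regime_lo b true <= Y n w <= regime_hi b B true then exit_discount r (regime_exit true n w) else 0)
    else if in_regime false n w then theta n w *
      (if regime_lo b false <= Y n w <= regime_hi b B false then exit_discount r (regime_exit false n w) else 0)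
    else theta n w.
    apply/funext => w; rewrite {1}/theta random_chainS /in_regime.
    case: (boolP (alive B (Y n w))) => //= ay.
    have : regime_lo b (b < Y n w) <= Y n w <= regime_hi b B (b < Y n w).
      exact: alive_in_regime.
    rewrite /stage_exit /stage_path /regime_exit.
    by case: (b < Y n w) => /= ->.
  apply: measurable_ite; [exact: mreg|exact: measurable_funM mt (mdisc true)|].
  by apply: measurable_ite; [exact: mreg|exact: measurable_funM mt (mdisc false)|].
- have -> : Y n.+1 = fun w =>
    if in_regime true n w then
      (if regime_lo b true <= Y n w <= regime_hi b B true then
        exit_position (fun t => Y n w + xi true n t w) (regime_exit true n w) else 0)
    else if in_regime false n w then
      (if regime_lo b false <= Y n w <= regime_hi b B false then
        exit_position (fun t => Y n w + xi false n t w) (regime_exit false n w) else 0)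
    else Y n w.
    apply/funext => w; rewrite {1}/Y random_chainS /in_regime.
    case: (boolP (alive B (Y n w))) => //= ay.
    have : regime_lo b (b < Y n w) <= Y n w <= regime_hi b B (b < Y n w).
      exact: alive_in_regime.
    rewrite /stage_exit /stage_path /regime_exit.
    by case: (b < Y n w) => /= ->.
  apply: measurable_ite; [exact: mreg|exact: mpos|].
  by apply: measurable_ite; [exact: mreg|exact: mpos|].
Qed.

Let mtheta n : measurable_fun setT (theta n).
Proof.
apply: (measurable_wrt_measurable _ (measurable_random_chain n).1).
exact: past_copies_meas.
Qed.

Let mY n : measurable_fun setT (Y n).
Proof.
apply: (measurable_wrt_measurable _ (measurable_random_chain n).2).
exact: past_copies_meas.
Qed.

Section Supersolution.
Variables (W : R -> R) (M C : R).
Hypotheses (W_cont : continuous W) (W_le : forall z, `|W z| <= M) (C_ge0 : 0 <= C).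
Hypothesis step_le : forall i n h, 0 < h -> h <= 1 ->
  forall z, regime_lo b i <= z <= regime_hi b B i ->
  expR (- (r * h)) * step_mean (lambda i) (a i) (J i n) h W z <= W z + C * h ^+ 2.

Let bW (f : Omega -> R) : measurable_fun setT f -> bounded_measurable (fun w => W (f w)).
Proof.
move=> mf; split; last by exists M.
by apply: (measurableT_comp (continuous_measurable_fun W_cont)).
Qed.

Let btheta n : bounded_measurable (theta n).
Proof.
by split => //; exists 1 => w; have /andP[? ?] := theta01 n w; rewrite ger0_norm.
Qed.

(** On each of the two events that decide the regime of the next stage, the copies
    used so far are the past of [stage_supermartingale]; where the chain has
    stopped nothing changes. *)
Lemma chain_supermartingale n :
  \int[P]_w (theta n.+1 w * W (Y n.+1 w)) <= \int[P]_w (theta n w * W (Y n w)).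
Proof.
pose g i w := theta n w * (in_regime i n w)%:R.
pose rest w := theta n w * (~~ alive B (Y n w))%:R * W (Y n w).
have [pt pY] := measurable_random_chain n.
have mreg i : measurable_wrt (past_copies N J n) (in_regime i n) := measurable_in_regime i pY.
have pg i : measurable_wrt (past_copies N J n) (g i).
  apply: measurable_funM => //.
  apply: (measurableT_comp (f := fun c : bool => c%:R : R)) => //.
  exact: mreg.
have g01 i w : 0 <= g i w <= 1.
  rewrite /g; case: (in_regime _ _ _); rewrite ?mulr1 ?mulr0; first exact: theta01.
  by rewrite lexx ler01.
have gin i w : g i w != 0 -> regime_lo b i <= Y n w <= regime_hi b B i.
  rewrite /g; case: (boolP (in_regime i n w)) => [/in_regime_in//|_].
  by rewrite mulr0 eqxx.
pose V i w := exit_discount r (regime_exit i n w) *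
  W (exit_position (fun t => Y n w + xi i n t w) (regime_exit i n w)).
have stg i : \int[P]_w (g i w * V i w) <= \int[P]_w (g i w * W (Y n w)).
  apply: (@stage_supermartingale _ _ _ P (lambda i) (a i) (F i) (N i n) (J i n)
    (copies i n) (lambda_gt0 i) (a_gt0 i) _ (past_copies N J n) _ _
    (regime_lo b i) (regime_hi b B i) r C M W (Y n) (g i)) => //.
  - by move=> k D mD; rewrite (jump_law copies i n k mD) (jump_law copies i n 0 mD).
  - exact: past_copies_meas.
  - exact: past_copies_indep.
  - exact: gin.
  - by move=> h h0 h1 z zin; exact: step_le.
have E1 w : theta n.+1 w * W (Y n.+1 w) = g true w * V true w + g false w * V false w + rest w.
  rewrite /theta /Y random_chainS /g /rest /V /in_regime /regime_exit.
  rewrite /stage_exit /stage_path /paths.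
  by case: (alive B (Y n w)) => /=; [case: (b < Y n w) => /=|];
    rewrite !(mulr0, mul0r, mulr1, addr0, add0r) ?mulrA.
have E0 w : theta n w * W (Y n w) = g true w * W (Y n w) + g false w * W (Y n w) + rest w.
  rewrite /g /rest /in_regime.
  by case: (alive B (Y n w)) => /=; [case: (b < Y n w) => /=|];
    rewrite !(mulr0, mul0r, mulr1, addr0, add0r).
have bind (p : Omega -> bool) : measurable_fun setT p -> bounded_measurable (fun w => (p w)%:R : R).
  exact: bounded_measurable_indic.
have mregO i : measurable_fun setT (in_regime i n).
  apply: (measurable_wrt_measurable _ (mreg i)).
  exact: past_copies_meas.
have bg i : bounded_measurable (g i) by apply: bounded_measurableM => //; exact: bind.
have brest : bounded_measurable rest.
  apply: bounded_measurableM; last exact: bW.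
  apply: bounded_measurableM => //; apply: bind.
  apply: (measurableT_comp (f := negb)) => //.
  apply: measurable_and; first exact: (measurable_fun_ltr (measurable_cst _) (mY n)).
  exact: (measurable_fun_ler (mY n) (measurable_cst _)).
have bgW i : bounded_measurable (fun w => g i w * W (Y n w)).
  by apply: bounded_measurableM => //; exact: bW.
have bgV i : bounded_measurable (fun w => g i w * V i w).
  have -> : (fun w => g i w * V i w) = (fun w => theta n.+1 w * W (Y n.+1 w) * (in_regime i n w)%:R).
    apply/funext => w; rewrite E1 /g /rest /in_regime.
    by case: (alive B (Y n w)) => /=; [case: (b < Y n w) => /=|]; case: (i) => /=;
      rewrite !(mulr0, mul0r, mulr1, addr0, add0r).
  apply: bounded_measurableM; last exact: bind.
  by apply: bounded_measurableM => //; exact: bW.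
rewrite (eq_Rintegral _ (g := fun w => g true w * V true w + g false w * V false w + rest w));
  last by move=> w _; exact: E1.
rewrite [leRHS](eq_Rintegral _ (g := fun w => g true w * W (Y n w) + g false w * W (Y n w) + rest w));
  last by move=> w _; exact: E0.
rewrite !RintegralD_bm//; last 2 first.
- exact: bounded_measurableD.
- exact: bounded_measurableD.
by rewrite lerD2r lerD.
Qed.

Lemma chain_value_le n : \int[P]_w (theta n w * W (Y n w)) <= W x.
Proof.
elim: n => [|n IH]; last exact: le_trans (chain_supermartingale n) IH.
rewrite (eq_Rintegral _ (g := fun=> W x)); first by rewrite Rintegral_prob_cst.
by move=> w _; rewrite /theta /Y /= mul1r.
Qed.

End Supersolution.

End Verification.

(** * Exit transforms as expectations *)

Section Transforms.
Context {d : measure_display} {Omega : measurableType d} {R : realType}.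
Variable P : probability Omega R.
Variables (a lambda : bool -> R) (F : bool -> R -> R).
Variables (N : bool -> nat -> R -> {RV P >-> nat}).
Variables (J : bool -> nat -> nat -> {RV P >-> R}).
Hypothesis a_gt0 : forall i, 0 < a i.
Hypothesis lambda_gt0 : forall i, 0 < lambda i.
Hypothesis copies : forall i n, compound_poisson (lambda i) (F i) (N i n) (J i n).
Hypothesis indep : independent_family P
     (fun c : bool * nat => copy_sigma (N c.1 c.2) (J c.1 c.2)).

Let xi i n := drifted_path (a i) (N i n) (J i n).

Variables (b B x r : R).
Hypotheses (b_gt0 : 0 < b) (b_ltB : b < B) (x_gt0 : 0 < x) (x_leB : x <= B).
Hypothesis r_gt0 : 0 < r.

Let paths w : bool -> nat -> R -> R := fun i n t => xi i n t w.
Let osc w := oscillating b (paths w) x.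
Let ch n w := random_chain a N J b B x r n w.
Let good := quiet_event N.

(** Restricted to the almost sure event on which switching times do not accumulate,
    the payoff is a limit of functions of the chain, hence measurable. *)
Definition exit_payoff (g : R -> R) (w : Omega) : R :=
  if w \in good then exit_value b B x r (paths w) g else 0.

Let sf w i n : skip_free (a i) (paths w i n).
Proof. exact: path_skip_free copies i n w. Qed.

Let exit_time_ge0 (X : R -> R) : (0 <= exit_time X B)%E.
Proof. by apply/ereal_infP => _ [t [t0 _] <-]; rewrite lee_fin. Qed.

Let discount_le1 t w : exit_time (osc w) B = t%:E -> 0 <= expR (- (r * t)) <= 1.
Proof.
move=> et; have := exit_time_ge0 (osc w); rewrite et lee_fin => t0.
by rewrite expR_ge0 -expR0 ler_expR oppr_le0 mulr_ge0// ltW.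
Qed.

Let cvg_payoff (g : R -> R) (M : R) w : (forall z, `|g z| <= M) ->
  (w \in good)%:R * ((ch n w).1 * g (ch n w).2) @[n --> \oo] --> exit_payoff g w.
Proof.
move=> gM; rewrite /exit_payoff; case: (boolP (w \in good)) => [|_]; last first.
  by under eq_fun do rewrite mul0r; exact: cvg_cst.
rewrite inE => gw; under eq_fun do rewrite mul1r.
exact: (chain_exit_value b_gt0 b_ltB x_gt0 x_leB a_gt0 (sf w)
  (quiet_eventP a_gt0 copies gw) r_gt0 gM).
Qed.

Let mchain (g : R -> R) n : measurable_fun setT g ->
  measurable_fun setT (fun w => (ch n w).1 * g (ch n w).2).
Proof.
have [mt mY] := measurable_random_chain a_gt0 copies b B x r n.
have pm := @past_copies_meas _ _ _ P N J n.
move=> mg; apply: measurable_funM; first exact: measurable_wrt_measurable pm mt.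
exact: (measurableT_comp mg (measurable_wrt_measurable pm mY)).
Qed.

Let good_bool : measurable_fun setT (fun w => (w \in good)%:R : R).
Proof. exact: measurable_indic (measurable_quiet_event N). Qed.

Lemma measurable_exit_payoff (g : R -> R) (M : R) :
  measurable_fun setT g -> (forall z, `|g z| <= M) ->
  measurable_fun setT (exit_payoff g).
Proof.
move=> mg gM; apply: (measurable_fun_cvg (h := fun n w =>
  (w \in good)%:R * ((ch n w).1 * g (ch n w).2))).
  by move=> n; apply: measurable_funM => //; exact: mchain.
by move=> w _; exact: cvg_payoff gM.
Qed.

Lemma exit_payoff_le (g : R -> R) (M : R) w : (forall z, `|g z| <= M) ->
  `|exit_payoff g w| <= M.
Proof.
move=> gM; have M0 : 0 <= M := le_trans (normr_ge0 _) (gM 0).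
rewrite /exit_payoff /exit_value; case: ifP => _; last by rewrite normr0.
case E : (exit_time _ _) => [t| |]; rewrite ?normr0//.
have /andP[e0 e1] := discount_le1 E.
by rewrite normrM ger0_norm// -[leRHS]mul1r ler_pM.
Qed.

Let chain_le (g : R -> R) (M : R) n w : (forall z, `|g z| <= M) ->
  `|(ch n w).1 * g (ch n w).2| <= M.
Proof.
move=> gM; have /andP[t0 t1] := theta01 a N J b B x r_gt0 n w.
by rewrite normrM ger0_norm// -[leRHS]mul1r ler_pM.
Qed.

Lemma cvg_exit_payoff (g : R -> R) (M : R) :
  measurable_fun setT g -> (forall z, `|g z| <= M) ->
  \int[P]_w ((ch n w).1 * g (ch n w).2) @[n --> \oo] --> \int[P]_w exit_payoff g w.
Proof.
move=> mg gM; apply: (@cvg_Rintegral_ae _ _ _ P _ _ M).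
- by move=> n; exact: mchain.
- exact: measurable_exit_payoff gM.
- by move=> n w; exact: chain_le.
- by move=> w; exact: exit_payoff_le.
- exists (~` good); split.
  + by apply: measurableC; exact: measurable_quiet_event.
  + exact: (prob_quiet_event lambda_gt0 copies indep).
  + move=> w /= ncv gw; apply: ncv; have := cvg_payoff (w := w) gM.
    by rewrite mem_set//; under eq_fun do rewrite mul1r.
Qed.

Definition below_payoff (z : R) : R := (z <= 0)%R%:R.
Definition above_payoff (z : R) : R := (B < z)%R%:R.

Let indic_le (p : R -> bool) z : `|(p z)%:R : R| <= 1.
Proof. by case: (p z); rewrite ?normr1 ?normr0. Qed.

(** The integrand of the exit transform is nonnegative, at most 1, and agrees with
    the payoff outside of a null event. *)
Let transformE (p : R -> bool) : measurable_fun setT p ->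
  exit_transform P r osc B [set w | (exit_time (osc w) B < +oo)%E /\
      p (osc w (fine (exit_time (osc w) B)))] =
  (\int[P]_w exit_payoff (fun z => (p z)%:R) w)%:E.
Proof.
move=> mp; set g := fun z => (p z)%:R.
have mg : measurable_fun setT g.
  by apply: (measurableT_comp (f := fun c : bool => c%:R : R)).
have gM z : `|g z| <= 1 by exact: indic_le.
have mpay := measurable_exit_payoff mg gM.
have ipay : P.-integrable setT (EFin \o exit_payoff g).
  by apply: bounded_integrable => // w; exact: exit_payoff_le gM.
have ev_ge0 w : 0 <= exit_value b B x r (paths w) g.
  rewrite /exit_value; case: (exit_time _ _) => [t| |]//.
  by rewrite mulr_ge0 ?expR_ge0 ?ler0n.
have ev_le1 w : exit_value b B x r (paths w) g <= 1.
  rewrite /exit_value; case E : (exit_time _ _) => [t| |]//.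
  have /andP[e0 e1] := discount_le1 E.
  by rewrite mulr_ile1 ?ler0n//; rewrite /g; case: (p _).
rewrite /exit_transform integral_mkcond.
rewrite (_ : _ \_ _ = fun w => (exit_value b B x r (paths w) g)%:E); last first.
  apply/funext => w; rewrite patchE /exit_value -/(osc w).
  case E : (exit_time (osc w) B) => [t| |].
  - rewrite /g; case: ifPn => [|].
      by rewrite inE /= E /= => -[_ ->]; rewrite mulr1.
    rewrite notin_setE /= E /= => /not_andP[|]; first by rewrite ltry.
    by move=> /negP/negbTE->; rewrite mulr0.
  - by rewrite memNset//= E ltxx => -[].
  - by have := exit_time_ge0 (osc w); rewrite E.
have payE : (\int[P]_w exit_payoff g w)%:E = (\int[P]_w (exit_payoff g w)%:E)%E.
  by rewrite /Rintegral fineK//; exact: integrable_fin_num.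
rewrite payE; apply/eqP; rewrite eq_le; apply/andP; split.
  apply: (@le_trans _ _ (\int[P]_w ((exit_payoff g w)%:E + (\1_(~` good) w)%:E))%E).
    apply: ge0_le_integral_any => w; first by rewrite lee_fin.
    rewrite -EFinD lee_fin.
    rewrite /exit_payoff indicE; case: (boolP (w \in good)) => gw.
      by rewrite lerDl ler0n.
    by rewrite add0r mem_set ?ev_le1//= => gw'; rewrite mem_set in gw.
  rewrite ge0_integralD//.
  - rewrite integral_indic// ?setIT; last by apply: measurableC; exact: measurable_quiet_event.
    by rewrite [X in (_ + X)%E](prob_quiet_event lambda_gt0 copies indep) adde0.
  - by move=> w _; rewrite lee_fin /exit_payoff; case: ifP.
  - exact/measurable_EFinP.
  - apply/measurable_EFinP; apply: measurable_indic.
    by apply: measurableC; exact: measurable_quiet_event.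
by apply: ge0_le_integral_any => w; rewrite lee_fin /exit_payoff; case: ifP.
Qed.

Lemma lower_transformE :
  exit_transform P r osc B [set w | exits_below (osc w) B] =
  (\int[P]_w exit_payoff below_payoff w)%:E.
Proof.
apply: (@transformE (fun z => z <= 0)).
exact: (measurable_fun_ler (@measurable_id _ _ _) (measurable_cst _)).
Qed.

Lemma upper_transformE :
  exit_transform P r osc B [set w | exits_above (osc w) B] =
  (\int[P]_w exit_payoff above_payoff w)%:E.
Proof.
apply: (@transformE (fun z => B < z)).
exact: (measurable_fun_ltr (measurable_cst _) (@measurable_id _ _ _)).
Qed.

(** Optional stopping: the mean of [W] at the exit is at most [W x], and at the exit
    [W] is at least [c0] on the lower side, where the position is exactly 0, and at
    least [c1] on the upper side. *)
Lemma transform_supersolution (W : R -> R) (M C c0 c1 : R) :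
  continuous W -> (forall z, `|W z| <= M) -> 0 <= C ->
  (forall i n h, 0 < h -> h <= 1 ->
   forall z, regime_lo b i <= z <= regime_hi b B i ->
   expR (- (r * h)) * step_mean (lambda i) (a i) (J i n) h W z <= W z + C * h ^+ 2) ->
  c0 <= W 0 -> (forall z, B < z -> c1 <= W z) ->
  c0 * \int[P]_w exit_payoff below_payoff w + c1 * \int[P]_w exit_payoff above_payoff w
  <= W x.
Proof.
move=> cW WM C0 step W0 WB.
have mW := continuous_measurable_fun cW.
have bpay (g : R -> R) A : measurable_fun setT g -> (forall z, `|g z| <= A) ->
    bounded_measurable (exit_payoff g).
  move=> mg gA; split; first exact: measurable_exit_payoff gA.
  by exists A => w; exact: exit_payoff_le gA.
have mbelow : measurable_fun setT below_payoff.
  apply: (measurableT_comp (f := fun c : bool => c%:R : R)) => //.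
  exact: (measurable_fun_ler (@measurable_id _ _ _) (measurable_cst _)).
have mabove : measurable_fun setT above_payoff.
  apply: (measurableT_comp (f := fun c : bool => c%:R : R)) => //.
  exact: (measurable_fun_ltr (measurable_cst _) (@measurable_id _ _ _)).
have bl : bounded_measurable (exit_payoff below_payoff).
  by apply: (bpay _ 1) => // z; exact: indic_le.
have bu : bounded_measurable (exit_payoff above_payoff).
  by apply: (bpay _ 1) => // z; exact: indic_le.
have bc c (f : Omega -> R) : bounded_measurable f -> bounded_measurable (fun w => c * f w).
  by move=> bf; apply: bounded_measurableM => //; exact: bounded_measurable_cst.
rewrite -!RintegralZ_bm// -RintegralD_bm; [|exact: bc|exact: bc].
apply: (@le_trans _ _ (\int[P]_w exit_payoff W w)).
  apply: le_Rintegral_bm; first by apply: bounded_measurableD; exact: bc.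
    exact: bpay WM.
  move=> w; rewrite /exit_payoff; case: (boolP (w \in good)) => [|_]; last first.
    by rewrite !mulr0 addr0.
  rewrite inE => gw; rewrite /exit_value.
  case E : (exit_time _ _) => [t| |]; rewrite ?mulr0 ?addr0//.
  have /andP[e0 e1] := discount_le1 E.
  rewrite mulrCA (mulrCA c1) -mulrDr; apply: ler_wpM2l => //.
  have [->|tB] := exit_side r b_gt0 b_ltB x_gt0 x_leB a_gt0 (sf w) (quiet_eventP a_gt0 copies gw) E.
    have B0 : (B < 0) = false by apply/negbTE; rewrite -leNgt ltW// (lt_trans b_gt0).
    by rewrite /below_payoff /above_payoff lexx mulr1 B0 mulr0 addr0.
  have B0 : 0 < B by exact: lt_trans b_ltB.
  have o0 : (oscillating b (paths w) x t <= 0) = false.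
    by apply/negbTE; rewrite -ltNge (lt_trans B0).
  by rewrite /below_payoff /above_payoff tB o0 mulr0 add0r mulr1 WB.
have cv := cvg_exit_payoff mW WM.
rewrite -(cvg_lim _ cv)//; apply: limr_le; first exact: cvgP cv.
apply: nearW => n.
by have := chain_value_le a_gt0 lambda_gt0 copies indep x r_gt0 cW WM C0 step n.
Qed.

End Transforms.

(** * From the generator to a grid step *)

Section ExpBounds.
Context {R : realType}.
Implicit Types q : R.

Lemma expR_sub1D_ge0 q : 0 <= expR q - 1 - q.
Proof. have := expR_ge1Dx q; lra. Qed.

Lemma expR_sub1D_le q : expR q - 1 - q <= q ^+ 2 * expR `|q|.
Proof.
have e0 := expR_gt0 q; have e1 := expR_ge1Dx q.
have eN := expR_ge1Dx (- q).
have ee : expR q * expR (- q) = 1 by rewrite -expRD subrr expR0.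
have key : expR q * (1 - q) <= 1 by rewrite -ee ler_pM2l//; lra.
have [q0|q0] := leP 0 q.
  rewrite ger0_norm//; nra.
have f1 : 1 <= expR `|q| by rewrite -expR0 ler_expR.
have : expR q - 1 - q <= q ^+ 2 by nra.
by move/le_trans; apply; rewrite ler_peMr ?sqr_ge0.
Qed.

Let mono (f g : R -> R) : f 0 = 0 -> (forall t : R, is_derive t (1 : R) f (g t)) ->
  (forall t, 0 <= t -> 0 <= g t) -> forall t, 0 <= t -> 0 <= f t.
Proof.
move=> f0 fg g0 t t0; rewrite -f0.
apply: (@ger0_derive1_ndecry R f 0 _ _ _ 0 t (lexx _) t0).
- by move=> x _; have fx := fg x; exact: ex_derive.
- move=> x; rewrite in_itv/= andbT => x0; rewrite derive1E.
  have fx := fg x; rewrite derive_val; exact/g0/ltW.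
- apply: continuous_subspaceT => x; apply: differentiable_continuous.
  by apply/derivable1_diffP; have fx := fg x; exact: ex_derive.
Qed.

Lemma expR_taylor2_pos q : 0 <= q ->
  0 <= expR q - 1 - q - q ^+ 2 / 2 <= q ^+ 3 * expR q.
Proof.
move=> q0; apply/andP; split.
  apply: (mono (f := fun q => expR q - 1 - q - q ^+ 2 / 2)
    (g := fun q => expR q - 1 - q)) => //; first by rewrite expR0; lra.
  - move=> t; apply: is_derive_eq; rewrite /GRing.scale/=; lra.
  - by move=> t _; exact: expR_sub1D_ge0.
rewrite -subr_ge0.
apply: (mono (f := fun q => q ^+ 3 * expR q - (expR q - 1 - q - q ^+ 2 / 2))
  (g := fun q => 3 * q ^+ 2 * expR q + q ^+ 3 * expR q - (expR q - 1 - q))) => //.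
- by rewrite expR0; lra.
- move=> t; apply: is_derive_eq; rewrite /GRing.scale/=; lra.
- move=> t t0; have := expR_sub1D_le t; rewrite ger0_norm// => H.
  have e0 := expR_gt0 t.
  have : 0 <= t ^+ 3 * expR t by rewrite mulr_ge0 ?exprn_ge0// ltW.
  have : 0 <= t ^+ 2 * expR t by rewrite mulr_ge0 ?sqr_ge0// ltW.
  lra.
Qed.

Lemma expR_taylor2_neg q : 0 <= q ->
  - q ^+ 3 <= expR (- q) - 1 + q - q ^+ 2 / 2 <= 0.
Proof.
have up (t : R) : 0 <= t -> expR (- t) - 1 + t - t ^+ 2 / 2 <= 0.
  move=> t0; rewrite -oppr_ge0.
  apply: (mono (f := fun q => - (expR (- q) - 1 + q - q ^+ 2 / 2))
    (g := fun q => expR (- q) - 1 + q)) => //.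
  - by rewrite oppr0 expR0; lra.
  - move=> u; apply: is_derive_eq; rewrite /GRing.scale/=; lra.
  - by move=> u _; have := expR_sub1D_ge0 (- u); lra.
move=> q0; rewrite up// andbT -subr_ge0.
apply: (mono (f := fun q => expR (- q) - 1 + q - q ^+ 2 / 2 - - q ^+ 3)
  (g := fun q => - expR (- q) + 1 - q + 3 * q ^+ 2)) => //.
- by rewrite oppr0 expR0; lra.
- move=> t; apply: is_derive_eq; rewrite /GRing.scale/=; lra.
- move=> t t0; have := up t t0; have := sqr_ge0 t; lra.
Qed.

Lemma expR_taylor2 q : `|expR q - 1 - q - q ^+ 2 / 2| <= `|q| ^+ 3 * expR `|q|.
Proof.
have [q0|q0] := leP 0 q.
  have /andP[l u] := expR_taylor2_pos q0.
  by rewrite ger0_norm// (ger0_norm q0).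
have t0 : 0 <= - q by lra.
have /andP[l u] := expR_taylor2_neg t0; rewrite opprK sqrrN in l u.
rewrite (ltr0_norm q0) ler0_norm; last lra.
apply: (@le_trans _ _ ((- q) ^+ 3)); first lra.
by rewrite ler_peMr ?exprn_ge0// -expR0 ler_expR.
Qed.

Lemma expR_taylor1 q : `|expR q - 1 - q| <= q ^+ 2 * expR `|q|.
Proof. by rewrite ger0_norm ?expR_sub1D_ge0// expR_sub1D_le. Qed.

End ExpBounds.

(** [exp (- q) (1 + q) = 1 + O (q ^ 2)]: a step with at most one jump loses only
    second-order mass. *)
Lemma expR_near1 {R : realType} (q : R) : 0 <= q ->
  0 <= 1 - expR (- q) * (1 + q) <= q ^+ 2.
Proof.
move=> q0; have e0 := expR_gt0 (- q); have e1 := expR_ge1Dx (- q).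
have e2 := expR_ge1Dx q.
have ee : expR (- q) * expR q = 1 by rewrite -expRD addNr expR0.
apply/andP; split; last nra.
by rewrite subr_ge0 -[leRHS]ee ler_pM2l//; lra.
Qed.

Section StepOfGenerator.
Context {d : measure_display} {Omega : measurableType d} {R : realType}.
Variable P : probability Omega R.
Variables (lam a r : R) (J : nat -> {RV P >-> R}).
Hypotheses (lam_gt0 : 0 < lam) (a_gt0 : 0 < a) (r_gt0 : 0 < r).
Variables (W : R -> R) (M L K slope z : R).
Hypotheses (L_ge0 : 0 <= L) (K_ge0 : 0 <= K).
Hypothesis mW : measurable_fun setT W.
Hypothesis W_le : forall z, `|W z| <= M.
Hypothesis W_lip : forall u v, `|W u - W v| <= L * `|u - v|.
Hypothesis W_back : forall h, 0 < h -> h <= 1 ->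
  W (z - a * h) <= W z - a * h * slope + K * h ^+ 2.
Hypothesis W_gen : lam * (jump_mean J W z - W z) - a * slope <= r * W z.

Let bWz y : bounded_measurable (fun w => W (y + J 0%N w)).
Proof.
split; last by exists M.
by apply: (measurableT_comp mW); exact: measurable_funD.
Qed.

(** To first order in [h] the left-hand side differs from [W z] by [h] times the
    generator minus [r W z], which is nonpositive by [W_gen]. The expansion along
    the drift is one-sided, as [W_back] is used backwards from [z]. *)
Lemma step_of_generator h : 0 < h -> h <= 1 ->
  expR (- (r * h)) * step_mean lam a J h W z <=
  W z + (K + lam * L * a + M * (r + lam) ^+ 2) * h ^+ 2.
Proof.
move=> h0 h1.
have lh : 0 < lam * h by rewrite mulr_gt0.
rewrite /step_mean poisson_pmf0// poisson_pmf1//.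
have jm : jump_mean J W (z - a * h) <= jump_mean J W z + L * (a * h).
  have -> : jump_mean J W z + L * (a * h) = \int[P]_w (W (z + J 0%N w) + L * (a * h)).
    rewrite (RintegralD_bm P (bWz z) (bounded_measurable_cst _)).
    by rewrite Rintegral_prob_cst.
  apply: le_Rintegral_bm => //.
    exact: (bounded_measurableD (bWz z) (bounded_measurable_cst _)).
  move=> w; rewrite -lerBlDl; apply: le_trans (ler_norm _) _.
  apply: le_trans (W_lip _ _) _; apply: ler_wpM2l => //.
  rewrite (_ : _ - _ = - (a * h)); last by ring.
  by rewrite normrN ger0_norm// mulr_ge0//; exact: ltW.
have wb := W_back h0 h1.
set q := (r + lam) * h.
have q0 : 0 <= q by rewrite mulr_ge0 ?addr_ge0// ltW.
have /andP[n0 n1] := expR_near1 q0.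
have eE : expR (- (r * h)) * expR (- (lam * h)) = expR (- q).
  by rewrite -expRD; congr expR; rewrite /q; ring.
have -> : expR (- (r * h)) * (expR (- (lam * h)) * W (z - a * h) +
    lam * h * expR (- (lam * h)) * jump_mean J W (z - a * h)) =
    expR (- q) * (W (z - a * h) + lam * h * jump_mean J W (z - a * h)).
  by rewrite -eE; ring.
have e0 := expR_gt0 (- q).
have e1 : expR (- q) <= 1 by rewrite -expR0 ler_expR oppr_le0.
have lam_jm : lam * h * jump_mean J W (z - a * h) <= lam * h * (jump_mean J W z + L * (a * h)).
  by rewrite ler_pM2l.
have hwg : h * (lam * (jump_mean J W z - W z) - a * slope) <= h * (r * W z) by rewrite ler_pM2l.
have br : W (z - a * h) + lam * h * jump_mean J W (z - a * h) <=
    W z * (1 + q) + (K + lam * L * a) * h ^+ 2.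
  rewrite /q; move: (jump_mean J W z) (jump_mean J W (z - a * h)) (W (z - a * h)) (W z)
    lam_jm hwg wb => j1 j2 w1 w0; lra.
have K0 : 0 <= (K + lam * L * a) * h ^+ 2.
  by rewrite mulr_ge0 ?sqr_ge0 ?addr_ge0 ?mulr_ge0// ltW.
apply: (@le_trans _ _ (expR (- q) * (W z * (1 + q) + (K + lam * L * a) * h ^+ 2))).
  by rewrite ler_pM2l.
have k1 : expR (- q) * ((K + lam * L * a) * h ^+ 2) <= (K + lam * L * a) * h ^+ 2.
  by rewrite ler_piMl.
have k2 : expR (- q) * (W z * (1 + q)) <= W z + M * ((r + lam) ^+ 2 * h ^+ 2).
  rewrite -exprMn -/q -lerBlDl.
  have -> : expR (- q) * (W z * (1 + q)) - W z = - W z * (1 - expR (- q) * (1 + q)) by ring.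
  apply: le_trans (ler_norm _) _; rewrite normrM normrN.
  by apply: ler_pM => //; rewrite ger0_norm.
rewrite mulrDr; lra.
Qed.

End StepOfGenerator.

Section ScaledGenerator.
Context {d : measure_display} {Omega : measurableType d} {R : realType}.
Variable P : probability Omega R.
Variables (J : nat -> {RV P >-> R}).
Hypothesis J_gt0 : forall w, 0 < J 0%N w.
Hypothesis J_int : P.-integrable setT (EFin \o J 0%N).
Hypothesis J2_int : P.-integrable setT (fun w => (J 0%N w ^+ 2)%:E).

(** Truncated second moment; its decay is all that a finite variance gives. *)
Definition jump_tail (c : R) : R := \int[P]_w (J 0%N w ^+ 2 * (c < J 0%N w)%R%:R).

Let tail_int c : P.-integrable setT (EFin \o (fun w => J 0%N w ^+ 2 * (c < J 0%N w)%R%:R)).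
Proof.
apply: (le_integrable _ _ _ J2_int) => //.
  apply/measurable_EFinP; apply: measurable_funM; first exact: measurable_funX.
  apply: (measurableT_comp (f := fun c : bool => c%:R : R)) => //.
  by apply: measurable_fun_ltr => //; exact: measurable_cst.
move=> w _; rewrite /= lee_fin !ger0_norm ?mulr_ge0 ?sqr_ge0 ?(ltW (J_gt0 w))//.
rewrite ler_piMr ?sqr_ge0//; last by case: (c < _).
Qed.

Lemma jump_tail_small e : 0 < e -> exists c, 0 < c /\ forall c', c <= c' -> jump_tail c' <= e.
Proof.
move=> e0.
have cvg_tail : jump_tail n%:R @[n --> \oo] --> (0 : R).
  have [|||||_ _ H] := @dominated_convergence _ _ _ P setT measurableT
    (fun n => EFin \o (fun w => J 0%N w ^+ 2 * (n%:R < J 0%N w)%R%:R)) (cst 0%E)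
    (fun w => (J 0%N w ^+ 2)%:E).
  - by move=> n; exact: measurable_int (tail_int _).
  - exact: measurable_cst.
  - apply: aeW => w _; apply: cvg_near_cst; near=> n => /=.
    rewrite ltNge (_ : J 0%N w <= n%:R) ?mulr0//; near: n; exact: nbhs_infty_ger.
  - exact: J2_int.
  - apply: aeW => w n _; rewrite /= lee_fin ger0_norm ?mulr_ge0 ?sqr_ge0 ?(ltW (J_gt0 w))//.
    by rewrite ler_piMr ?sqr_ge0//; case: (_ < _).
  apply: fine_cvg; rewrite integral0 in H; exact: H.
have [n _ nP] : \forall n \near \oo, jump_tail n%:R < e.
  by have := cvgr_lt _ cvg_tail _ e0; apply.
exists n.+1%:R; split => // c' nc'.
apply: le_trans (ltW (nP n.+1 _)); last by rewrite /=.
apply: le_Rintegral => //; try exact: tail_int.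
move=> w _; apply: ler_wpM2l; first exact: sqr_ge0.
by have [H|//] := ltP c' (J 0%N w); rewrite (le_lt_trans nc' H).
Unshelve. all: by end_near.
Qed.

Variables (lam a : R) (U dU : R -> R) (B eps kappa Lq Ueta z : R).
Hypotheses (lam_gt0 : 0 < lam) (B_gt0 : 0 < B) (Lq_ge0 : 0 <= Lq).
Hypothesis balance : lam * jump_mean1 J = a.
Hypothesis mU : measurable_fun setT U.
Hypothesis U_bd : exists M, forall v, `|U v| <= M.
Hypothesis U_near : forall k, 0 <= k -> k <= eps ->
  U (z + k) - U z - k * dU z <= k ^+ 2 / 2 * kappa * Ueta.
Hypothesis U_far : forall k, eps < k ->
  U (z + k) - U z - k * dU z <= k ^+ 2 * (Lq + kappa / 2 * Ueta).

(** The zero mean, through [balance], turns the generator into a second-order Taylor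
    remainder of [U] under the scaled jump. Small jumps give the diffusion term,
    and jumps longer than [eps * B] are paid by the truncated second moment. *)
Lemma scaled_generator (W := fun y => U (y / B)) :
  lam * (jump_mean J W (z * B) - W (z * B)) - a * (dU z / B) <=
  (lam * jump_mean2 J / 2 * kappa * Ueta + lam * Lq * jump_tail (eps * B)) / B ^+ 2.
Proof.
pose k w := J 0%N w / B.
have bU : bounded_measurable (fun w => U (z + k w)).
  split; last by have [M UM] := U_bd; exists M.
  apply: (measurableT_comp mU); apply: measurable_funD => //; exact: measurable_funM.
have k0 w : 0 <= k w by exact: divr_ge0 (ltW (J_gt0 w)) (ltW B_gt0).
have WE : jump_mean J W (z * B) = \int[P]_w U (z + k w).
  apply: eq_Rintegral => w _; rewrite /W /k; congr U; field; exact: lt0r_neq0.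
have W0 : W (z * B) = U z by rewrite /W mulfK// lt0r_neq0.
have iJ : P.-integrable setT (EFin \o (fun w => dU z / B * J 0%N w)).
  exact: (integrableZl measurableT (dU z / B) J_int).
have i0 : P.-integrable setT (EFin \o (fun w => U (z + k w) - U z)).
  apply: bounded_measurable_int; apply: bounded_measurableD => //; exact: bounded_measurable_cst.
have E1 : jump_mean J W (z * B) - W (z * B) - jump_mean1 J * (dU z / B) =
    \int[P]_w (U (z + k w) - U z - dU z / B * J 0%N w).
  rewrite WE W0 RintegralB// RintegralZl// RintegralD_bm//; last exact: bounded_measurable_cst.
  by rewrite Rintegral_prob_cst /jump_mean1 mulrC.
have i2 : P.-integrable setT (EFin \o (fun w => kappa * Ueta / 2 / B ^+ 2 * J 0%N w ^+ 2)).
  exact: (integrableZl measurableT (kappa * Ueta / 2 / B ^+ 2) J2_int).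
have i3 : P.-integrable setT (EFin \o (fun w => Lq / B ^+ 2 *
    (J 0%N w ^+ 2 * (eps * B < J 0%N w)%R%:R))).
  exact: (integrableZl measurableT (Lq / B ^+ 2) (tail_int (eps * B))).
have key : \int[P]_w (U (z + k w) - U z - dU z / B * J 0%N w) <=
   \int[P]_w (kappa * Ueta / 2 / B ^+ 2 * J 0%N w ^+ 2 +
     Lq / B ^+ 2 * (J 0%N w ^+ 2 * (eps * B < J 0%N w)%R%:R)).
  apply: le_Rintegral => //.
  - exact: (integrableB measurableT i0 iJ).
  - exact: (integrableD measurableT i2 i3).
  move=> w _; have Jk : J 0%N w = k w * B by rewrite /k mulfVK// lt0r_neq0.
  have -> : dU z / B * J 0%N w = k w * dU z by rewrite Jk; field; exact: lt0r_neq0.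
  have -> : kappa * Ueta / 2 / B ^+ 2 * J 0%N w ^+ 2 = k w ^+ 2 / 2 * kappa * Ueta.
    by rewrite Jk; field; exact: lt0r_neq0.
  have -> : (eps * B < J 0%N w) = (eps < k w) by rewrite Jk ltr_pM2r.
  have -> : Lq / B ^+ 2 * (J 0%N w ^+ 2 * (eps < k w)%R%:R) = k w ^+ 2 * Lq * (eps < k w)%R%:R.
    by rewrite Jk; field; exact: lt0r_neq0.
  have [ke|ke] := ltP eps (k w).
    by apply: le_trans (U_far ke) _; rewrite mulr1; lra.
  by rewrite mulr0 addr0; exact: U_near.
rewrite -balance.
have -> : lam * (jump_mean J W (z * B) - W (z * B)) - lam * jump_mean1 J * (dU z / B) =
  lam * (jump_mean J W (z * B) - W (z * B) - jump_mean1 J * (dU z / B)) by ring.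
rewrite E1; apply: (@le_trans _ _ (lam * \int[P]_w (kappa * Ueta / 2 / B ^+ 2 * J 0%N w ^+ 2 +
     Lq / B ^+ 2 * (J 0%N w ^+ 2 * (eps * B < J 0%N w)%R%:R)))).
  by rewrite ler_pM2l.
rewrite RintegralD// RintegralZl// RintegralZl//.
rewrite -/(jump_mean2 J) -/(jump_tail (eps * B)).
by rewrite le_eqVlt; apply/orP; left; apply/eqP; field; exact: lt0r_neq0.
Qed.

End ScaledGenerator.

(** * Test functions *)

Section Taylor.
Context {R : realType}.
Implicit Types (u du : R -> R) (L v w h : R).

(** Regularity C^{1,1} on [[-2, 2]], in a form that survives gluing two functions
    with different second derivatives. *)
Definition taylor_bound u du L :=
  forall v w, `|v| <= 2 -> `|w| <= 2 ->
    `|u w - u v - (w - v) * du v| <= L * (w - v) ^+ 2.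

Lemma taylor_bound_le u du L L' : L <= L' -> taylor_bound u du L -> taylor_bound u du L'.
Proof.
move=> LL tb v w v2 w2; apply: le_trans (tb v w v2 w2) _.
by rewrite ler_wpM2r ?sqr_ge0.
Qed.

Lemma taylor_boundD u du L u' du' L' :
  taylor_bound u du L -> taylor_bound u' du' L' ->
  taylor_bound (fun v => u v + u' v) (fun v => du v + du' v) (L + L').
Proof.
move=> tb tb' v w v2 w2.
rewrite (_ : _ - _ = (u w - u v - (w - v) * du v) + (u' w - u' v - (w - v) * du' v)); last by ring.
by rewrite [leRHS]mulrDl; apply: le_trans (ler_normD _ _) _; apply: lerD; [exact: tb|exact: tb'].
Qed.

Lemma taylor_boundZ c u du L : taylor_bound u du L ->
  taylor_bound (fun v => c * u v) (fun v => c * du v) (`|c| * L).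
Proof.
move=> tb v w v2 w2.
rewrite (_ : _ - _ = c * (u w - u v - (w - v) * du v)); last by ring.
by rewrite normrM -mulrA ler_wpM2l//; exact: tb.
Qed.

(** Add the remainders from [v] to [w] and from [w] to [v]. *)
Lemma taylor_bound_deriv u du L v w : taylor_bound u du L -> `|v| <= 2 -> `|w| <= 2 ->
  `|du w - du v| <= 2 * L * `|w - v|.
Proof.
move=> tb v2 w2; have [->|wv] := eqVneq w v; first by rewrite !subrr normr0 mulr0.
have n0 : 0 < `|w - v| by rewrite normr_gt0 subr_eq0.
rewrite -(ler_pM2l n0) -normrM.
rewrite (_ : (w - v) * _ = (u w - u v - (w - v) * du v) + (u v - u w - (v - w) * du w)); last by ring.
apply: le_trans (ler_normD _ _) _.
have := tb v w v2 w2; have := tb w v w2 v2; rewrite -(real_normK (num_real (w - v))).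
rewrite -(real_normK (num_real (v - w))) (distrC v w) => *; lra.
Qed.

Lemma taylor_bound_lip u du L M v w : 0 <= L -> taylor_bound u du L ->
  (forall v, `|v| <= 2 -> `|du v| <= M) -> `|v| <= 2 -> `|w| <= 2 ->
  `|u w - u v| <= (M + 4 * L) * `|w - v|.
Proof.
move=> L0 tb dM v2 w2.
rewrite (_ : u w - u v = (u w - u v - (w - v) * du v) + (w - v) * du v); last by ring.
apply: le_trans (ler_normD _ _) _; rewrite normrM.
have := tb v w v2 w2; have := dM v v2; rewrite -(real_normK (num_real (w - v))).
have n4 : `|w - v| <= 4 by apply: le_trans (ler_normB _ _) _; lra.
have := normr_ge0 (w - v); move: `|w - v| n4 => n *.
have : n * `|du v| <= n * M by apply: ler_wpM2l.
have : L * n ^+ 2 <= L * (4 * n) by apply: ler_wpM2l => //; rewrite expr2 ler_wpM2r.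
lra.
Qed.

(** Because both sides are tangent at 0, the two remainders and the variation
    of the slope add up to a perfect square, so no constant is lost. *)
Lemma taylor_bound_glue u1 du1 u2 du2 L :
  taylor_bound u1 du1 L -> taylor_bound u2 du2 L -> u1 0 = u2 0 -> du1 0 = du2 0 ->
  taylor_bound (fun v => if 0 < v then u2 v else u1 v)
               (fun v => if 0 < v then du2 v else du1 v) L.
Proof.
have cross u du u' du' v w : taylor_bound u du L -> taylor_bound u' du' L ->
    u 0 = u' 0 -> du 0 = du' 0 -> `|v| <= 2 -> `|w| <= 2 -> v * w <= 0 ->
    `|u' w - u v - (w - v) * du v| <= L * (w - v) ^+ 2.
  move=> tb tb' u0 du0 v2 w2 vw; have z2 : `|0 : R| <= 2 by rewrite normr0.
  rewrite (_ : _ - _ = (u' w - u' 0 - (w - 0) * du' 0) + (u 0 - u v - (0 - v) * du v) +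
    w * (du 0 - du v)); last by rewrite u0 du0; ring.
  have h1 := tb' 0 w z2 w2; have h2 := tb v 0 v2 z2.
  have := taylor_bound_deriv tb v2 z2; move: h1 h2; rewrite !sub0r !subr0 normrN sqrrN => h1 h2 h3.
  apply: le_trans (ler_normD _ _) _; rewrite normrM.
  have h4 := ler_wpM2l (normr_ge0 w) h3.
  have h5 := ler_normD (u' w - u' 0 - w * du' 0) (u 0 - u v - - v * du v).
  have h6 : `|w| * `|v| = - (v * w) by rewrite mulrC -normrM ler0_norm.
  have -> : L * (w - v) ^+ 2 = L * w ^+ 2 + L * v ^+ 2 + 2 * L * - (v * w) by ring.
  rewrite -h6; lra.
move=> tb1 tb2 e de v w v2 w2.
have [v0|v0] := ltP 0 v; have [w0|w0] := ltP 0 w; try by [exact: tb1|exact: tb2].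
- by apply: (cross u2 du2 u1 du1) => //; rewrite mulr_ge0_le0// ltW.
- by apply: (cross u1 du1 u2 du2) => //; rewrite mulr_le0_ge0// ltW.
Qed.

Lemma taylor_bound_expR t : taylor_bound (fun v => expR (t * v)) (fun v => t * expR (t * v))
  (t ^+ 2 * expR (6 * `|t|)).
Proof.
move=> v w v2 w2.
have -> : expR (t * w) - expR (t * v) - (w - v) * (t * expR (t * v)) =
    expR (t * v) * (expR (t * (w - v)) - 1 - t * (w - v)).
  by rewrite (_ : t * w = t * v + t * (w - v)) ?expRD; ring.
rewrite normrM (ger0_norm (expR_ge0 _)).
apply: (@le_trans _ _ (expR (2 * `|t|) * ((t * (w - v)) ^+ 2 * expR (4 * `|t|)))).
  apply: ler_pM; [exact: expR_ge0|exact: normr_ge0| |].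
    rewrite ler_expR; apply: le_trans (ler_norm _) _; rewrite normrM mulrC.
    exact: ler_wpM2r.
  apply: le_trans (expR_taylor1 _) _; apply: ler_wpM2l; first exact: sqr_ge0.
  rewrite ler_expR normrM mulrC; apply: ler_wpM2r => //.
  by apply: le_trans (ler_normB _ _) _; lra.
have -> : 6 * `|t| = 2 * `|t| + 4 * `|t| by ring.
by rewrite expRD exprMn le_eqVlt; apply/orP; left; apply/eqP; ring.
Qed.

Lemma taylor2_expR t v h : `|v| <= 2 -> 0 <= h -> h <= 1 ->
  `|expR (t * (v + h)) - expR (t * v) - h * (t * expR (t * v)) -
     h ^+ 2 / 2 * (t ^+ 2 * expR (t * v))| <= `|t| ^+ 3 * expR (3 * `|t|) * h ^+ 3.
Proof.
move=> v2 h0 h1.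
rewrite (_ : _ - _ = expR (t * v) * (expR (t * h) - 1 - t * h - (t * h) ^+ 2 / 2)); last first.
  by rewrite mulrDr expRD; ring.
rewrite normrM (ger0_norm (expR_ge0 _)).
apply: (@le_trans _ _ (expR (2 * `|t|) * (`|t * h| ^+ 3 * expR (1 * `|t|)))).
  apply: ler_pM; [exact: expR_ge0|exact: normr_ge0| |].
    rewrite ler_expR; apply: le_trans (ler_norm _) _; rewrite normrM mulrC.
    exact: ler_wpM2r.
  apply: le_trans (expR_taylor2 _) _; apply: ler_wpM2l; first exact: exprn_ge0.
  by rewrite ler_expR normrM mulrC; apply: ler_wpM2r => //; rewrite ger0_norm.
have -> : 3 * `|t| = 2 * `|t| + 1 * `|t| by ring.
by rewrite expRD normrM (ger0_norm h0) le_eqVlt; apply/orP; left; apply/eqP; ring.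
Qed.

End Taylor.

Section Kink.
Context {R : realType}.
Implicit Types (v w h e : R).

(** A smoothing of [- |v|]: concave, with curvature bounded away from 0 near the
    origin and linear growth. *)
Definition kink v : R := - Num.sqrt (v ^+ 2 + 1).
Definition dkink v : R := - (v / Num.sqrt (v ^+ 2 + 1)).

Let sqrt_arg v : 0 <= v ^+ 2 + 1. Proof. by rewrite addr_ge0 ?sqr_ge0. Qed.

Let sqrt_ge1 v : 1 <= Num.sqrt (v ^+ 2 + 1).
Proof. by rewrite -[leLHS]sqrtr1 ler_wsqrtr// lerDr sqr_ge0. Qed.

(** The numerator times its conjugate is [(w - v) ^ 2], by Lagrange's identity. *)
Let kinkE v w :
  kink w - kink v - (w - v) * dkink v =
  - (Num.sqrt (w ^+ 2 + 1) * Num.sqrt (v ^+ 2 + 1) - (1 + v * w)) / Num.sqrt (v ^+ 2 + 1).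
Proof.
rewrite /kink /dkink; have S1 := sqrt_ge1 v.
have S2 : Num.sqrt (v ^+ 2 + 1) ^+ 2 = v ^+ 2 + 1 by rewrite sqr_sqrtr.
move: (Num.sqrt (v ^+ 2 + 1)) (Num.sqrt (w ^+ 2 + 1)) S1 S2 => S A S1 S2.
have S0 : S != 0 by rewrite gt_eqF// (lt_le_trans _ S1).
apply: (mulIf S0); rewrite mulfVK//.
have -> : (- A - - S - (w - v) * - (v / S)) * S = - A * S + S ^+ 2 + (w - v) * v by field.
rewrite S2; ring.
Qed.

Let conj_ge0 v w : 0 <= Num.sqrt (w ^+ 2 + 1) * Num.sqrt (v ^+ 2 + 1) - (1 + v * w).
Proof.
rewrite subr_ge0 -sqrtrM//; apply: le_trans (ler_norm _) _.
rewrite -sqrtr_sqr ler_wsqrtr//.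
have -> : (w ^+ 2 + 1) * (v ^+ 2 + 1) = (1 + v * w) ^+ 2 + (w - v) ^+ 2 by ring.
by rewrite lerDl sqr_ge0.
Qed.

Lemma kink_concave v w : kink w - kink v - (w - v) * dkink v <= 0.
Proof.
rewrite kinkE mulNr oppr_le0 divr_ge0//; exact: conj_ge0.
Qed.

Lemma kink_taylor v w : `|kink w - kink v - (w - v) * dkink v| <= (w - v) ^+ 2.
Proof.
rewrite ler0_norm ?kink_concave// kinkE mulNr opprK.
have S1 := sqrt_ge1 v; have c0 := conj_ge0 v w.
apply: (@le_trans _ _ (Num.sqrt (w ^+ 2 + 1) * Num.sqrt (v ^+ 2 + 1) - (1 + v * w))).
  by rewrite ler_pdivrMr ?(lt_le_trans _ S1)// ler_peMr.
have S2 : Num.sqrt (v ^+ 2 + 1) ^+ 2 = v ^+ 2 + 1 by rewrite sqr_sqrtr.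
have A2 : Num.sqrt (w ^+ 2 + 1) ^+ 2 = w ^+ 2 + 1 by rewrite sqr_sqrtr.
have := sqr_ge0 (Num.sqrt (w ^+ 2 + 1) - Num.sqrt (v ^+ 2 + 1)).
have := sqr_ge0 (w - v).
rewrite !sqrrB A2 S2; lra.
Qed.

Lemma kink_near v h : `|v| <= 1 -> 0 <= h -> h <= 1 ->
  kink (v + h) - kink v - h * dkink v <= - (h ^+ 2 / 12).
Proof.
move=> v1 h0 h1; have := kinkE v (v + h); rewrite (_ : v + h - v = h); last by ring.
move=> ->; rewrite mulNr lerN2.
have S1 := sqrt_ge1 v; have c0 := conj_ge0 v (v + h); have A1 := sqrt_ge1 (v + h).
have S2 : Num.sqrt (v ^+ 2 + 1) ^+ 2 = v ^+ 2 + 1 by rewrite sqr_sqrtr.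
have A2 : Num.sqrt ((v + h) ^+ 2 + 1) ^+ 2 = (v + h) ^+ 2 + 1 by rewrite sqr_sqrtr.
have [va vb] : -1 <= v /\ v <= 1 by move: v1; rewrite ler_norml => /andP[].
move: (Num.sqrt (v ^+ 2 + 1)) (Num.sqrt ((v + h) ^+ 2 + 1)) c0 S1 A1 S2 A2 => S A c0 S1 A1 S2 A2.
have Sb : S <= 3 / 2 by nra.
have Ab : A <= 5 / 2 by nra.
rewrite ler_pdivlMr ?(lt_le_trans _ S1)//.
have prodE : (A * S - (1 + v * (v + h))) * (A * S + (1 + v * (v + h))) = h ^+ 2.
  have -> : (A * S - (1 + v * (v + h))) * (A * S + (1 + v * (v + h))) =
     A ^+ 2 * S ^+ 2 - (1 + v * (v + h)) ^+ 2 by ring.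
  by rewrite A2 S2; ring.
have AS : A * S <= 5 / 2 * (3 / 2) by apply: ler_pM => //; lra.
have vvh : v * (v + h) <= 2 by nra.
have hh : h ^+ 2 <= (A * S - (1 + v * (v + h))) * 8.
  by rewrite -prodE; apply: ler_wpM2l => //; lra.
have : h ^+ 2 / 12 * S <= h ^+ 2 / 12 * (3 / 2).
  by apply: ler_wpM2l => //; rewrite divr_ge0 ?sqr_ge0.
lra.
Qed.

Lemma norm_kink v : `|kink v| <= 1 + `|v|.
Proof.
rewrite normrN ger0_norm ?sqrtr_ge0//.
rewrite -[leRHS]ger0_norm ?addr_ge0// -sqrtr_sqr ler_wsqrtr//.
rewrite sqrrD real_normK ?num_real// expr1n mul1r.
by have := normr_ge0 v; lra.
Qed.

Lemma norm_dkink v : `|dkink v| <= `|v|.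
Proof.
rewrite normrN normrM normfV ler_pdivrMr; last by rewrite normr_gt0 gt_eqF// (lt_le_trans _ (sqrt_ge1 v)).
by rewrite ler_peMr// ger0_norm ?sqrtr_ge0.
Qed.

End Kink.

Section TestFunction.
Context {R : realType}.
Implicit Types (s p q v w h : R).

(** The solution of [u'' = s ^ 2 u] with [u 0 = p] and [u' 0 = q]. *)
Definition sol s p q v : R := p * cosh (s * v) + q / s * sinh (s * v).
Definition dsol s p q v : R := p * s * sinh (s * v) + q * cosh (s * v).

Lemma sol0 s p q : sol s p q 0 = p.
Proof. by rewrite /sol /sinh /cosh mulr0 oppr0 expR0; lra. Qed.

Lemma dsol0 s p q : dsol s p q 0 = q.
Proof. by rewrite /dsol /sinh /cosh mulr0 oppr0 expR0; lra. Qed.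

Lemma sol_exp s p q v : s != 0 ->
  sol s p q v = (p + q / s) / 2 * expR (s * v) + (p - q / s) / 2 * expR (- s * v).
Proof. by move=> s0; rewrite /sol /sinh /cosh mulNr; lra. Qed.

Lemma dsol_exp s p q v : s != 0 ->
  dsol s p q v = (p + q / s) / 2 * (s * expR (s * v)) +
                 (p - q / s) / 2 * (- s * expR (- s * v)).
Proof. by move=> s0; rewrite /dsol /sinh /cosh (mulNr s v); field. Qed.

Lemma sol_bounds s p q : s != 0 -> exists2 C, 0 <= C &
  [/\ taylor_bound (sol s p q) (dsol s p q) C,
      forall v, `|v| <= 2 -> `|sol s p q v| <= C /\ `|dsol s p q v| <= C &
      forall v h, `|v| <= 2 -> 0 <= h -> h <= 1 ->
        `|sol s p q (v + h) - sol s p q v - h * dsol s p q v -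
          h ^+ 2 / 2 * (s ^+ 2 * sol s p q v)| <= C * h ^+ 3].
Proof.
move=> s0; set A := (p + q / s) / 2; set A' := (p - q / s) / 2.
pose E := expR (6 * `|s|); pose a := `|A| + `|A'|.
have E0 : 0 < E := expR_gt0 _.
pose n := 1 + `|s| + `|s| ^+ 2 + `|s| ^+ 3.
have ns : 0 <= `|s| by [].
have n1 : 1 <= n by rewrite /n; have := exprn_ge0 2 ns; have := exprn_ge0 3 ns; lra.
have a0 : 0 <= a by rewrite /a addr_ge0.
have expb v t : `|v| <= 2 -> `|t| = `|s| -> expR (t * v) <= E.
  move=> v2 ts; rewrite ler_expR; apply: le_trans (ler_norm _) _.
  by rewrite normrM ts; nra.
exists (a * (n * E)); first by rewrite !mulr_ge0// ltW// (lt_le_trans _ n1).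
have npow k : (k <= 3)%N -> `|s| ^+ k <= n.
  have p2 := exprn_ge0 2 ns; have p3 := exprn_ge0 3 ns.
  by case: k => [|[|[|[|]]]]//; rewrite /n ?expr0 ?expr1; lra.
have comb X Y X' (m : R) : `|X| <= n * m -> `|Y| <= n * m -> X' = A * X + A' * Y ->
    `|X'| <= a * (n * m).
  move=> Xm Ym ->; apply: le_trans (ler_normD _ _) _; rewrite (normrM A X) (normrM A' Y) /a [leRHS]mulrDl.
  by apply: lerD; apply: ler_wpM2l.
split.
- have tb : taylor_bound (fun v => A * expR (s * v) + A' * expR (- s * v))
     (fun v => A * (s * expR (s * v)) + A' * (- s * expR (- s * v)))
     (`|A| * (s ^+ 2 * expR (6 * `|s|)) + `|A'| * ((- s) ^+ 2 * expR (6 * `|- s|))).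
    by apply: taylor_boundD; apply: taylor_boundZ; exact: taylor_bound_expR.
  rewrite (_ : sol s p q = fun v => A * expR (s * v) + A' * expR (- s * v)); last first.
    by apply/funext => v; rewrite sol_exp.
  rewrite (_ : dsol s p q = fun v => A * (s * expR (s * v)) + A' * (- s * expR (- s * v))); last first.
    by apply/funext => v; rewrite dsol_exp.
  apply: taylor_bound_le tb; rewrite normrN sqrrN -mulrDl -/a -/E.
  apply: ler_wpM2l => //; apply: ler_wpM2r; first exact: ltW.
  by rewrite -(real_normK (num_real s)); exact: npow.
- move=> v v2; split.
    apply: (comb (expR (s * v)) (expR (- s * v)) _ E); last exact: sol_exp.
    + rewrite ger0_norm ?expR_ge0// -[leLHS]mul1r; apply: ler_pM; rewrite ?expR_ge0//.
      exact: expb.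
    + rewrite ger0_norm ?expR_ge0// -[leLHS]mul1r; apply: ler_pM; rewrite ?expR_ge0//.
      by apply: expb => //; rewrite normrN.
  apply: (comb (s * expR (s * v)) (- s * expR (- s * v)) _ E); last exact: dsol_exp.
  + rewrite normrM (ger0_norm (expR_ge0 _)); apply: ler_pM; rewrite ?expR_ge0//.
      exact: (npow 1%N).
    exact: expb.
  + rewrite normrM normrN (ger0_norm (expR_ge0 _)); apply: ler_pM; rewrite ?expR_ge0//.
      exact: (npow 1%N).
    by apply: expb => //; rewrite normrN.
- move=> v h v2 h0 h1; rewrite -(mulrA a) -(mulrA n).
  have t2 t : `|t| = `|s| -> `|expR (t * (v + h)) - expR (t * v) - h * (t * expR (t * v)) -
     h ^+ 2 / 2 * (t ^+ 2 * expR (t * v))| <= n * (E * h ^+ 3).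
    move=> ts; apply: le_trans (taylor2_expR t v2 h0 h1) _; rewrite ts -mulrA.
    apply: ler_pM.
    + exact: exprn_ge0.
    + by rewrite mulr_ge0 ?expR_ge0// exprn_ge0.
    + exact: npow.
    + by rewrite ler_wpM2r ?exprn_ge0// ler_expR; lra.
  apply: (comb _ _ _ _ (t2 s erefl) (t2 (- s) (normrN s))).
  by rewrite !sol_exp// dsol_exp// sqrrN -/A -/A'; ring.
Qed.

Variable S : bool -> R.
Hypothesis S_gt0 : forall i, 0 < S i.
Variables p q : R.

(** Both sides share the value [p] and the slope [q] at the switching level; the
    second derivative jumps there. *)
Definition osc_sol v : R := sol (S (0 < v)) p q v.
Definition dosc_sol v : R := dsol (S (0 < v)) p q v.

Definition on_side (i : bool) v := if i then 0 <= v else v <= 0.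

Lemma osc_sol_side i v : on_side i v ->
  osc_sol v = sol (S i) p q v /\ dosc_sol v = dsol (S i) p q v.
Proof.
rewrite /on_side /osc_sol /dosc_sol; case: i => [v0|v0]; last by rewrite ltNge v0.
have [//|v0'] := ltP 0 v; have -> : v = 0 by apply/eqP; rewrite eq_le v0 v0'.
by rewrite !sol0 !dsol0.
Qed.

Lemma osc_sol_bounds : exists2 C, 0 <= C &
  [/\ taylor_bound osc_sol dosc_sol C,
      forall v, `|v| <= 2 -> `|osc_sol v| <= C /\ `|dosc_sol v| <= C &
      forall i v h, `|v| <= 2 -> 0 <= h -> h <= 1 -> on_side i v -> on_side i (v + h) ->
        `|osc_sol (v + h) - osc_sol v - h * dosc_sol v -
          h ^+ 2 / 2 * (S i ^+ 2 * osc_sol v)| <= C * h ^+ 3].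
Proof.
have [C1 C10 [tb1 bd1 th1]] := sol_bounds p q (lt0r_neq0 (S_gt0 false)).
have [C2 C20 [tb2 bd2 th2]] := sol_bounds p q (lt0r_neq0 (S_gt0 true)).
exists (C1 + C2); first exact: addr_ge0.
split.
- rewrite (_ : osc_sol = fun v => if 0 < v then sol (S true) p q v else sol (S false) p q v); last first.
    by apply/funext => v; rewrite /osc_sol; case: (0 < v).
  rewrite (_ : dosc_sol = fun v => if 0 < v then dsol (S true) p q v else dsol (S false) p q v); last first.
    by apply/funext => v; rewrite /dosc_sol; case: (0 < v).
  apply: taylor_bound_glue; rewrite ?sol0 ?dsol0//.
  + by apply: taylor_bound_le tb1; rewrite lerDl.
  + by apply: taylor_bound_le tb2; rewrite lerDr.
- move=> v v2; rewrite /osc_sol /dosc_sol; have [a1 a2] := bd1 v v2; have [b1 b2] := bd2 v v2.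
  by case: (0 < v); split; lra.
- move=> i v h v2 h0 h1 iv ivh; have [-> ->] := osc_sol_side iv; have [-> _] := osc_sol_side ivh.
  have h3 := exprn_ge0 3 h0.
  case: i {iv ivh}; [apply: le_trans (th2 v h v2 h0 h1) _|apply: le_trans (th1 v h v2 h0 h1) _];
  by apply: ler_wpM2r => //; rewrite ?lerDl ?lerDr.
Qed.

(** For a jump that crosses 0 from below, the Taylor remainder of [osc_sol] is only
    [O (h ^ 2)] and may exceed the diffusion term of the lower side. Adding
    [K eps ^ 2 kink (v / eps)] repairs this: it is uniformly of order [K eps],
    concave everywhere, and has curvature at least [K / 6] where such jumps start,
    with [K] fixed by [osc_sol] alone before [eps] is chosen. *)
Lemma test_function eta : 0 < eta -> exists eps C u du,
  [/\ 0 < eps, eps <= 1, 0 <= C & taylor_bound u du C] /\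
  [/\ forall v, `|v| <= 2 -> `|u v| <= C /\ `|du v| <= C,
      forall v, `|v| <= 2 -> `|u v - osc_sol v| <= eta,
      forall v w, `|v| <= 2 -> `|w| <= 2 -> `|w - v| <= eps ->
        `|osc_sol w - osc_sol v| <= eta &
      forall i v h, `|v| <= 1 -> on_side i v -> 0 <= h -> h <= eps ->
        u (v + h) - u v - h * du v <= h ^+ 2 / 2 * S i ^+ 2 * (u v + eta)].
Proof.
move=> eta0; have [C C0 [tb bd th]] := osc_sol_bounds.
have S2 i : 0 < S i ^+ 2 by rewrite exprn_gt0.
pose K := 12 * (C + S false ^+ 2 / 2 * C).
have K0 : 0 <= K by rewrite /K; have := S2 false; nra.
have cs i : 0 <= 2 * C / S i ^+ 2 by rewrite divr_ge0 ?mulr_ge0// ltW.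
pose D := 3 * K + 2 * C / S false ^+ 2 + 2 * C / S true ^+ 2 + 5 * C + 1.
have D0 : 0 < D by rewrite /D; have := cs true; have := cs false; lra.
pose eps := Num.min 1 (eta / D).
have eps0 : 0 < eps by rewrite lt_min ltr01 divr_gt0.
have eps1 : eps <= 1 by rewrite ge_min lexx.
have epsD : D * eps <= eta.
  by rewrite -ler_pdivlMl// mulrC ge_min lexx orbT.
have epsDi i : 3 * K * eps + 2 * C / S i ^+ 2 * eps <= eta.
  apply: le_trans epsD; rewrite -mulrDl ler_pM2r// /D.
  by have := cs true; have := cs false; case: i; lra.
pose k v := eps ^+ 2 * kink (v / eps); pose dk v := eps * dkink (v / eps).
have kE v w : k w - k v - (w - v) * dk v =
    eps ^+ 2 * (kink (w / eps) - kink (v / eps) - (w / eps - v / eps) * dkink (v / eps)).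
  by rewrite /k /dk; field; exact: lt0r_neq0.
have tbk : taylor_bound k dk 1.
  move=> v w _ _; rewrite kE normrM ger0_norm ?sqr_ge0//.
  apply: le_trans (ler_wpM2l (sqr_ge0 _) (kink_taylor _ _)) _.
  by rewrite le_eqVlt; apply/orP; left; apply/eqP; field; exact: lt0r_neq0.
have kb v : `|v| <= 2 -> `|k v| <= 3 * eps.
  move=> v2; rewrite /k normrM ger0_norm ?sqr_ge0//.
  apply: le_trans (ler_wpM2l (sqr_ge0 _) (norm_kink _)) _.
  rewrite normrM normfV (gtr0_norm eps0).
  have -> : eps ^+ 2 * (1 + `|v| / eps) = eps * eps + eps * `|v| by field; exact: lt0r_neq0.
  nra.
have dkb v : `|v| <= 2 -> `|dk v| <= 2.
  move=> v2; rewrite /dk normrM (gtr0_norm eps0).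
  apply: le_trans (ler_wpM2l (ltW eps0) (norm_dkink _)) _.
  by rewrite normrM normfV (gtr0_norm eps0) mulrCA divff ?mulr1// lt0r_neq0.
pose u v := osc_sol v + K * k v; pose du v := dosc_sol v + K * dk v.
exists eps, (C + 3 * K), u, du; split; [split|split] => //.
- by lra.
- apply: taylor_bound_le (taylor_boundD tb (taylor_boundZ K tbk)).
  by rewrite ger0_norm//; lra.
- move=> v v2; have [b1 b2] := bd v v2; split; apply: le_trans (ler_normD _ _) _;
  apply: lerD => //; rewrite normrM (ger0_norm K0) mulrC ler_wpM2r//.
    by apply: le_trans (kb v v2) _; lra.
  by apply: le_trans (dkb v v2) _; lra.
- move=> v v2; rewrite /u addrC addKr normrM (ger0_norm K0).
  apply: le_trans (ler_wpM2l K0 (kb v v2)) _.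
  by have := epsDi true; have := mulr_ge0 (cs true) (ltW eps0); lra.
- move=> v w v2 w2 wv.
  have db v' : `|v'| <= 2 -> `|dosc_sol v'| <= C by move=> /bd[].
  apply: le_trans (taylor_bound_lip C0 tb db v2 w2) _.
  apply: (@le_trans _ _ ((C + 4 * C) * eps)); first by apply: ler_wpM2l => //; lra.
  apply: le_trans epsD; apply: ler_wpM2r; first exact: ltW.
  by rewrite /D; have := cs true; have := cs false; lra.
- move=> i v h v1 iv h0 he; have h1 : h <= 1 by apply: le_trans eps1.
  have v2 : `|v| <= 2 by lra.
  have vh2 : `|v + h| <= 2 by apply: le_trans (ler_normD _ _) _; rewrite (ger0_norm h0); lra.
  have -> : u (v + h) - u v - h * du v = (osc_sol (v + h) - osc_sol v - h * dosc_sol v) +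
      K * (k (v + h) - k v - h * dk v) by rewrite /u /du; ring.
  have kconc : k (v + h) - k v - h * dk v <= 0.
    have := kE v (v + h); rewrite (_ : v + h - v = h); last by ring.
    by move=> ->; rewrite mulr_ge0_le0 ?sqr_ge0//; exact: kink_concave.
  have lowu : osc_sol v - 3 * K * eps <= u v.
    rewrite /u; have := kb v v2; rewrite ler_norml => /andP[l _].
    by have := ler_wpM2l K0 l; lra.
  have [ivh|ivh] := boolP (if i then 0 <= v + h else v + h <= 0).
    (* No crossing: the second-order expansion applies directly. *)
    have := th i v h v2 h0 h1 iv ivh; rewrite ler_norml => /andP[_ t3].
    have hh : 0 <= h ^+ 2 / 2 * S i ^+ 2.
      by apply: mulr_ge0; rewrite ?divr_ge0 ?sqr_ge0.
    have e1 := ler_wpM2l hh (epsDi i).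
    have e2 : C * h ^+ 3 <= h ^+ 2 / 2 * S i ^+ 2 * (2 * C / S i ^+ 2 * eps).
      have -> : h ^+ 2 / 2 * S i ^+ 2 * (2 * C / S i ^+ 2 * eps) = C * (h ^+ 2 * eps).
        by field; exact: lt0r_neq0.
      by apply: ler_wpM2l => //; rewrite exprSr ler_wpM2l ?sqr_ge0.
    have e3 := ler_wpM2l hh lowu.
    have e4 := ler_wpM2l K0 kconc.
    lra.
  case: i iv ivh => /= [v0|v0]; first by rewrite addr_ge0.
  rewrite -ltNge => vh0.
  have vh : `|v| <= h by rewrite ler0_norm//; lra.
  have t2 : osc_sol (v + h) - osc_sol v - h * dosc_sol v <= C * h ^+ 2.
    have := tb v (v + h) v2 vh2; rewrite (_ : v + h - v = h); last by ring.
    by rewrite ler_norml => /andP[].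
  have kn : k (v + h) - k v - h * dk v <= - (h ^+ 2 / 12).
    have := kE v (v + h); rewrite (_ : v + h - v = h); last by ring.
    move=> ->; have := @kink_near R (v / eps) (h / eps).
    rewrite normrM normfV (gtr0_norm eps0) !ler_pdivrMr// !mul1r -mulrDl.
    rewrite (_ : (v + h) / eps - v / eps = h / eps); last by ring.
    have -> : - (h ^+ 2 / 12) = eps ^+ 2 * - ((h / eps) ^+ 2 / 12) by field; exact: lt0r_neq0.
    rewrite ler_pM2l ?exprn_gt0//; apply; [lra|exact: divr_ge0 h0 (ltW eps0)|exact: he].
  have kn' := ler_wpM2l K0 kn.
  have [ub _] := bd v v2.
  have hh : 0 <= h ^+ 2 / 2 * S false ^+ 2 by apply: mulr_ge0; rewrite ?divr_ge0 ?sqr_ge0.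
  have lo : - C <= u v + eta.
    have := epsDi false; have := mulr_ge0 (cs false) (ltW eps0).
    by move: ub; rewrite ler_norml => /andP[]; lra.
  have hlo := ler_wpM2l hh lo.
  have KE : K * - (h ^+ 2 / 12) = - C * h ^+ 2 + h ^+ 2 / 2 * S false ^+ 2 * - C.
    by rewrite /K; field.
  by rewrite KE in kn'; lra.
Qed.

End TestFunction.

(** * Barriers at scale B *)

Section Clamp.
Context {R : realType}.
Implicit Types e t u : R.

(** Test functions are controlled on a bounded interval; composing them with a
    truncation makes them bounded and Lipschitz on the whole line and changes
    nothing for jumps of length at most [e] from [[0, 1]]. *)
Definition clamp e t : R := Num.min (Num.max t (-1)) (1 + e).

Lemma clamp_id e t : -1 <= t -> t <= 1 + e -> clamp e t = t.
Proof. by move=> t0 t1; rewrite /clamp max_l// min_l. Qed.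

Lemma clamp_ge e t : 0 <= e -> -1 <= clamp e t.
Proof. by move=> e0; rewrite /clamp le_min le_max lexx orbT/=; lra. Qed.

Lemma clamp_le e t : clamp e t <= 1 + e.
Proof. by rewrite /clamp ge_min lexx orbT. Qed.

Lemma clamp_lip e t u : `|clamp e t - clamp e u| <= `|t - u|.
Proof.
wlog tu : t u / u <= t.
  by move=> H; have [/H//|/ltW/H] := leP u t; rewrite distrC [leRHS]distrC.
have max1 : Num.max t (-1) - Num.max u (-1) <= t - u.
  by rewrite /Num.max; case: ltP => ?; case: ltP => ?; lra.
have max0 : Num.max u (-1) <= Num.max t (-1) by rewrite ge_max !le_max tu lexx orbT.
rewrite (ger0_norm (_ : 0 <= t - u)) ?subr_ge0//; apply: le_trans max1.
rewrite /clamp; move: (Num.max t (-1)) (Num.max u (-1)) max0 => x y yx.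
rewrite ger0_norm ?subr_ge0; first by rewrite /Num.min; case: ltP => ?; case: ltP => ?; lra.
by rewrite le_min !ge_min yx lexx orbT.
Qed.

End Clamp.

Section Barrier.
Context {R : realType}.
Variables (eps C b eta : R) (u du : R -> R).
Hypotheses (eps_gt0 : 0 < eps) (eps_le1 : eps <= 1) (C_ge0 : 0 <= C).
Hypotheses (b_gt0 : 0 < b) (b_lt1 : b < 1) (eta_gt0 : 0 < eta).
Hypothesis tb : taylor_bound u du C.
Hypothesis bd : forall v, `|v| <= 2 -> `|u v| <= C /\ `|du v| <= C.

Definition profile t := u (clamp eps t - b).

(** The shift makes room for the errors in the generator and at the boundary. *)
Definition barrier B y := profile (y / B) + 2 * eta.

Lemma clamp_range t : `|clamp eps t - b| <= 2.
Proof.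
have := clamp_ge t (ltW eps_gt0); have := clamp_le eps t.
rewrite ler_norml => H1 H2; apply/andP; split; move: b_gt0 b_lt1 eps_le1; lra.
Qed.

Lemma profile_lip t t' : `|profile t - profile t'| <= 5 * C * `|t - t'|.
Proof.
have db v' : `|v'| <= 2 -> `|du v'| <= C by move=> /bd[].
apply: le_trans (taylor_bound_lip C_ge0 tb db (clamp_range t') (clamp_range t)) _.
have -> : clamp eps t - b - (clamp eps t' - b) = clamp eps t - clamp eps t' by ring.
have -> : C + 4 * C = 5 * C by ring.
by apply: ler_wpM2l (clamp_lip _ _ _); rewrite mulr_ge0.
Qed.

Lemma profile_le t : `|profile t| <= C.
Proof. by have [] := bd (clamp_range t). Qed.

Lemma barrier_lip B y y' : 0 < B -> `|barrier B y - barrier B y'| <= 5 * C / B * `|y - y'|.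
Proof.
move=> B0.
have -> : barrier B y - barrier B y' = profile (y / B) - profile (y' / B).
  by rewrite /barrier; ring.
apply: le_trans (profile_lip _ _) _.
by rewrite -mulrBl normrM normfV (gtr0_norm B0) mulrA mulrAC.
Qed.

Lemma barrier_le B y : `|barrier B y| <= C + 2 * eta.
Proof.
apply: le_trans (ler_normD _ _) _; apply: lerD; first exact: profile_le.
by rewrite ger0_norm// mulr_ge0// ltW.
Qed.

Lemma lipschitz_continuous (f : R -> R) L :
  (forall y y', `|f y - f y'| <= L * `|y - y'|) -> continuous f.
Proof.
move=> fL y; apply/cvgrPdist_lt => e e0.
have L1 : 0 < `|L| + 1 by rewrite ltr_wpDl.
near=> y'; apply: le_lt_trans (fL _ _) _.
apply: (@le_lt_trans _ _ ((`|L| + 1) * `|y - y'|)).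
  by apply: ler_wpM2r => //; have := ler_norm L; lra.
rewrite -ltr_pdivlMl//; near: y'.
by apply: cvgr_dist_lt => //; rewrite mulr_gt0// invr_gt0.
Unshelve. all: by end_near.
Qed.

Lemma continuous_barrier B : 0 < B -> continuous (barrier B).
Proof. by move=> B0; apply: lipschitz_continuous => y y'; exact: barrier_lip. Qed.

Lemma continuous_profile : continuous profile.
Proof. by apply: lipschitz_continuous => y y'; exact: profile_lip. Qed.

Context {d : measure_display} {Omega : measurableType d}.
Variable P : probability Omega R.
Variables (lam a s : R) (J : nat -> {RV P >-> R}) (side : R -> bool).
Hypotheses (lam_gt0 : 0 < lam) (a_gt0 : 0 < a) (s_gt0 : 0 < s).
Hypothesis J_gt0 : forall w, 0 < J 0%N w.
Hypothesis J_int : P.-integrable setT (EFin \o J 0%N).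
Hypothesis J2_int : P.-integrable setT (fun w => (J 0%N w ^+ 2)%:E).
Hypothesis balance : lam * jump_mean1 J = a.
Hypothesis J2_gt0 : 0 < jump_mean2 J.
Let kappa := 2 * s / (lam * jump_mean2 J).
Hypothesis near_ : forall v h, `|v| <= 1 -> side v -> 0 <= h -> h <= eps ->
  u (v + h) - u v - h * du v <= h ^+ 2 / 2 * kappa * (u v + eta).

(** With [kappa = 2 s / sigma ^ 2] the diffusion term of [scaled_generator] is
    [s (u + eta) / B ^ 2], which the discount [s / B ^ 2] applied to [u + 2 eta]
    dominates with a margin of [s eta / B ^ 2]; for large [B] the truncated second
    moment fits in that margin. *)
Lemma barrier_supersolution : \forall B \near +oo%R, 0 < B /\ exists2 K, 0 <= K &
  forall y h, 0 <= y / B -> y / B <= 1 -> side (y / B - b) -> 0 < h -> h <= 1 ->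
  expR (- (s / B ^+ 2 * h)) * step_mean lam a J h (barrier B) y <= barrier B y + K * h ^+ 2.
Proof.
move: (eps_gt0) (eps_le1) (C_ge0) (b_gt0) (b_lt1) (eta_gt0) => e0 e1' C0 b0 b1 t0.
have k0 : 0 < kappa by rewrite divr_gt0// mulr_gt0.
pose Lq := 2 * C / eps ^+ 2 + C / eps + kappa / 2 * C.
have Lq0 : 0 <= Lq.
  by rewrite /Lq !addr_ge0// ?mulr_ge0// ?invr_ge0 ?sqr_ge0 ?mulr_ge0// ltW.
have [c [c0 ct]] := jump_tail_small J_gt0 J2_int
  (divr_gt0 (mulr_gt0 s_gt0 eta_gt0) (ltr_wpDl (mulr_ge0 (ltW lam_gt0) Lq0) ltr01)).
near=> B.
have B0 : 0 < B by near: B; apply: nbhs_pinfty_gt; exact: num_real.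
have Ba : a <= B by near: B; apply: nbhs_pinfty_ge; exact: num_real.
have Bc : c <= eps * B.
  by rewrite -ler_pdivrMl//; near: B; apply: nbhs_pinfty_ge; exact: num_real.
split => //.
pose L := 5 * C / B; pose K := C * (a / B) ^+ 2; pose r := s / B ^+ 2.
pose M := C + 2 * eta.
have L0 : 0 <= L by rewrite divr_ge0 ?mulr_ge0// ltW.
have K0 : 0 <= K by rewrite mulr_ge0 ?sqr_ge0.
have M0 : 0 <= M by rewrite /M; lra.
have r0 : 0 < r by rewrite divr_gt0 ?exprn_gt0.
exists (K + lam * L * a + M * (r + lam) ^+ 2).
  apply: addr_ge0; last by rewrite mulr_ge0 ?sqr_ge0.
  by apply: addr_ge0 => //; exact: mulr_ge0 (mulr_ge0 (ltW lam_gt0) L0) (ltW a_gt0).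
move=> y h z0 z1 zs h0 h1.
have iB : 0 < B^-1 by rewrite invr_gt0.
have ids t : -1 <= t -> t <= 1 + eps -> profile t = u (t - b) by move=> *; rewrite /profile clamp_id.
have v1 : `|y / B - b| <= 1 by rewrite ler_norml; apply/andP; split; lra.
have v2 : `|y / B - b| <= 2 by lra.
have py : profile (y / B) = u (y / B - b) by apply: ids; lra.
apply: (step_of_generator lam_gt0 a_gt0 r0 (slope := du (y / B - b) / B)
  L0 K0 _ (barrier_le B)) => //.
- exact: (continuous_measurable_fun (continuous_barrier B0)).
- by move=> v w; exact: barrier_lip.
- move=> {h0 h1}h h0 h1; rewrite /barrier py.
  have ahB : 0 <= a * h / B /\ a * h / B <= 1.
    split; first by rewrite divr_ge0 ?mulr_ge0// ltW.
    by rewrite ler_pdivrMr// mul1r; nra.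
  have -> : (y - a * h) / B = y / B - a * h / B by ring.
  rewrite ids; [|lra|lra].
  have w2 : `|y / B - a * h / B - b| <= 2 by rewrite ler_norml; apply/andP; split; lra.
  have := tb v2 w2; rewrite (_ : _ - b - _ = - (a * h / B)); last by ring.
  rewrite /K ler_norml => /andP[_].
  by rewrite (_ : C * (a / B) ^+ 2 * h ^+ 2 = C * (- (a * h / B)) ^+ 2); [lra|ring].
have jm : jump_mean J (barrier B) y = jump_mean J (fun y => profile (y / B)) y + 2 * eta.
  rewrite /jump_mean /barrier RintegralD_bm; last exact: bounded_measurable_cst.
    by rewrite Rintegral_prob_cst.
  split; last by exists C => w; exact: profile_le.
  apply: (measurableT_comp (continuous_measurable_fun continuous_profile)).
  by apply: measurable_funM => //; exact: measurable_funD.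
rewrite jm /barrier (_ : _ + _ - (_ + _) =
  jump_mean J (fun y => profile (y / B)) y - profile (y / B)); last by ring.
have := @scaled_generator _ _ _ P J J_gt0 J_int J2_int lam a profile (fun t => du (t - b))
  B eps kappa Lq (profile (y / B) + eta) (y / B) lam_gt0 B0 balance
  (continuous_measurable_fun continuous_profile).
rewrite divfK ?lt0r_neq0// => /(_ _ _ _) sg.
apply: le_trans (sg _ _ _) _.
- by exists C; exact: profile_le.
- move=> k kk0 ke; rewrite py ids; [|lra|lra].
  by rewrite (addrAC (y / B)); exact: near_.
- move=> k ke.
  have [_ d2] := bd v2; have pk := profile_le (y / B + k); have p0 := profile_le (y / B).
  have kpos : 0 < k by apply: lt_trans ke.
  have e1 : 1 <= k / eps by rewrite ler_pdivlMr// mul1r ltW.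
  have f1 : profile (y / B + k) - profile (y / B) <= 2 * C.
    by move: pk p0; rewrite !ler_norml => /andP[? ?] /andP[? ?]; lra.
  have f2 : - (k * du (y / B - b)) <= k * C.
    by rewrite -mulrN ler_pM2l//; move: d2; rewrite ler_norml => /andP[? _]; lra.
  have f3 : 2 * C <= k ^+ 2 * (2 * C / eps ^+ 2).
    have -> : k ^+ 2 * (2 * C / eps ^+ 2) = 2 * C * (k / eps) ^+ 2 by field; exact: lt0r_neq0.
    by rewrite ler_peMr ?mulr_ge0// exprn_ege1.
  have f4 : k * C <= k ^+ 2 * (C / eps).
    have -> : k ^+ 2 * (C / eps) = k * C * (k / eps) by field; exact: lt0r_neq0.
    by rewrite ler_peMr// mulr_ge0// ltW.
  have f5 : 0 <= k ^+ 2 * (kappa / 2 * (C + profile (y / B) + eta)).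
    apply: mulr_ge0; [exact: sqr_ge0|apply: mulr_ge0; first exact: divr_ge0 (ltW k0) _].
    by move: p0; rewrite ler_norml => /andP[? _]; lra.
  by rewrite /Lq; lra.
rewrite /r [leRHS]mulrAC ler_pM2r ?invr_gt0 ?exprn_gt0//.
have tl : lam * Lq * jump_tail J (eps * B) <= s * eta.
  have l0 : 0 <= lam * Lq by rewrite mulr_ge0// ltW.
  apply: le_trans (ler_wpM2l l0 (ct _ Bc)) _.
  by rewrite mulrA ler_pdivrMr ?ltr_wpDl//; have := mulr_gt0 s_gt0 eta_gt0; nra.
have -> : lam * jump_mean2 J / 2 * kappa = s by rewrite /kappa; field; rewrite !lt0r_neq0.
lra.
Unshelve. all: by end_near.
Qed.

End Barrier.

(** * Limits of the exit transforms *)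

Section JumpMoments.
Context {d : measure_display} {Omega : measurableType d} {R : realType}.
Variable P : probability Omega R.

(** The second moment is at least the square of the mean: integrate
    [(J - m) ^ 2 >= 0]. *)
Lemma jump_mean2_gt0 (J : nat -> {RV P >-> R}) :
  P.-integrable setT (EFin \o J 0%N) ->
  P.-integrable setT (fun w => (J 0%N w ^+ 2)%:E) ->
  0 < jump_mean1 J -> 0 < jump_mean2 J.
Proof.
move=> i1 i2 m0; set m := jump_mean1 J in m0 *.
have i3 : P.-integrable setT (EFin \o (fun w => 2 * m * J 0%N w)).
  exact: (integrableZl measurableT (2 * m) i1).
have i4 : P.-integrable setT (EFin \o (fun w : Omega => m ^+ 2)).
  by apply: bounded_integrable => // w; exact: lexx.
suff : m ^+ 2 <= jump_mean2 J by apply: lt_le_trans; rewrite exprn_gt0.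
have -> : m ^+ 2 = \int[P]_w (2 * m * J 0%N w - m ^+ 2).
  rewrite RintegralB// RintegralZl// Rintegral_prob_cst -/(jump_mean1 J) -/m; ring.
apply: le_Rintegral => //; first exact: (integrableB measurableT i3 i4).
by move=> w _; have := sqr_ge0 (J 0%N w - m); lra.
Qed.

End JumpMoments.

Section Limit.
Context {d : measure_display} {Omega : measurableType d} {R : realType}.
Variable P : probability Omega R.
Variables (a lambda : bool -> R) (F : bool -> R -> R).
Variables (N : bool -> nat -> R -> {RV P >-> nat}).
Variables (J : bool -> nat -> nat -> {RV P >-> R}).
Hypothesis a_gt0 : forall i, 0 < a i.
Hypothesis lambda_gt0 : forall i, 0 < lambda i.
Hypothesis copies : forall i n, compound_poisson (lambda i) (F i) (N i n) (J i n).
Hypothesis indep : independent_family P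
     (fun c : bool * nat => copy_sigma (N c.1 c.2) (J c.1 c.2)).
Variables (x b s : R).
Hypotheses (x_gt0 : 0 < x) (x_lt1 : x < 1) (b_gt0 : 0 < b) (b_lt1 : b < 1).
Hypothesis s_gt0 : 0 < s.
Let xi i n := drifted_path (a i) (N i n) (J i n).
Hypothesis xi_mean : (forall i, 'E_P[xi i 0%N 1%R] = 0)%E.
Hypothesis xi_var : (forall i, 'E_P[fun w => (xi i 0%N 1%R w ^+ 2)%R] < +oo)%E.

Let sigma i := Num.sqrt (fine ('E_P[fun w => (xi i 0%N 1%R w ^+ 2)%R])%E).
Let S i := Num.sqrt (2 * s) / sigma i.

Let same_law i k D : measurable D -> P (J i 0%N k @^-1` D) = P (J i 0%N 0%N @^-1` D).
Proof. exact: jump_law. Qed.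

Let J_int i := drifted_jump_integrable (copies i 0%N) (lambda_gt0 i) (xi_var i).
Let J2_int i := drifted_jump_sq_integrable (copies i 0%N) (lambda_gt0 i) (xi_var i).
Let balance i :=
  drift_balance (copies i 0%N) (lambda_gt0 i) (@same_law i) (xi_mean i) (xi_var i).

Let J2_gt0 i : 0 < jump_mean2 (J i 0%N).
Proof.
apply: jump_mean2_gt0 => //.
by have := a_gt0 i; rewrite -(balance i) pmulr_rgt0.
Qed.

Let varE i : fine ('E_P[fun w => (xi i 0%N 1%R w ^+ 2)%R])%E = lambda i * jump_mean2 (J i 0%N).
Proof. exact: drifted_variance (copies i 0%N) (lambda_gt0 i) (@same_law i) (xi_mean i) (xi_var i). Qed.

Lemma sigma_gt0 i : 0 < sigma i.
Proof. by rewrite sqrtr_gt0 varE mulr_gt0. Qed.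

Lemma rate_gt0 i : 0 < S i.
Proof. by rewrite divr_gt0 ?sigma_gt0// sqrtr_gt0 mulr_gt0. Qed.

Let rate_sq i : S i ^+ 2 = 2 * s / (lambda i * jump_mean2 (J i 0%N)).
Proof.
rewrite /S expr_div_n !sqr_sqrtr ?varE//; first by rewrite mulr_ge0// ltW.
by rewrite mulr_ge0// ltW.
Qed.

Let lo B := \int[P]_w exit_payoff a N J (b * B) B (x * B) (s / B ^+ 2) below_payoff w.
Let up B := \int[P]_w exit_payoff a N J (b * B) B (x * B) (s / B ^+ 2) (above_payoff B) w.

(** Verification with the barrier built on [osc_sol], started at the scaled and
    centred point [x - b]. *)
Let transform_le p q eta : 0 < eta -> \forall B \near +oo%R,
  osc_sol S p q (- b) * lo B + osc_sol S p q (1 - b) * up B <= osc_sol S p q (x - b) + 3 * eta.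
Proof.
move=> eta0.
move: (x_gt0) (x_lt1) (b_gt0) (b_lt1) (s_gt0) => x0 x1 b0 b1 s0.
have [eps [C [u [du [[e0 e1 C0 tb] [bd uu0 cont nr]]]]]] := test_function rate_gt0 p q eta0.
have J_gt0 i w : 0 < J i 0%N 0%N w by have [_ + _ _ _] := copies i 0%N.
have super i := barrier_supersolution e0 e1 C0 b_gt0 b_lt1 eta0 tb bd (side := on_side i)
  (lambda_gt0 i) (a_gt0 i) s_gt0 (J_gt0 i) (J_int i) (J2_int i) (balance i) (J2_gt0 i).
have {super}super i := super i _.
near=> B.
have [B0 [K1 K10 super1]] : 0 < B /\ exists2 K, 0 <= K & forall y h, 0 <= y / B -> y / B <= 1 ->
    on_side false (y / B - b) -> 0 < h -> h <= 1 ->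
    expR (- (s / B ^+ 2 * h)) * step_mean (lambda false) (a false) (J false 0%N) h
      (barrier eps b eta u B) y <= barrier eps b eta u B y + K * h ^+ 2.
  by near: B; apply: super => v h v1 iv h0 he; rewrite -rate_sq; exact: nr.
have [_ [K2 K20 super2]] : 0 < B /\ exists2 K, 0 <= K & forall y h, 0 <= y / B -> y / B <= 1 ->
    on_side true (y / B - b) -> 0 < h -> h <= 1 ->
    expR (- (s / B ^+ 2 * h)) * step_mean (lambda true) (a true) (J true 0%N) h
      (barrier eps b eta u B) y <= barrier eps b eta u B y + K * h ^+ 2.
  by near: B; apply: super => v h v1 iv h0 he; rewrite -rate_sq; exact: nr.
have cW : continuous (barrier eps b eta u B) by exact: (continuous_barrier e0 e1 C0 b_gt0 b_lt1 tb bd).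
have WM := barrier_le e0 e1 b_gt0 b_lt1 eta0 bd B.
have rng (t : R) : -1 <= t -> t <= 1 -> `|t| <= 2 by move=> *; rewrite ler_norml; apply/andP; split; lra.
have Wx : barrier eps b eta u B (x * B) <= osc_sol S p q (x - b) + 3 * eta.
  rewrite /barrier /profile mulfK ?lt0r_neq0// clamp_id; [|lra|lra].
  have xb2 : `|x - b| <= 2 by apply: rng; lra.
  by have := uu0 _ xb2; rewrite ler_norml => /andP[_]; lra.
apply: le_trans Wx.
apply: (transform_supersolution a_gt0 lambda_gt0 copies indep _ _ _ _ _ cW WM (addr_ge0 K10 K20)).
- by rewrite mulr_gt0.
- by rewrite gtr_pMl.
- by rewrite mulr_gt0.
- by rewrite ger_pMl// ltW.
- by rewrite divr_gt0 ?exprn_gt0.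
- move=> i n h h0 h1 z /andP[zl zh].
  have -> : step_mean (lambda i) (a i) (J i n) h (barrier eps b eta u B) z =
            step_mean (lambda i) (a i) (J i 0%N) h (barrier eps b eta u B) z.
    rewrite /step_mean; congr (_ + _ * _).
    apply: (@Rintegral_same_law _ _ _ P _ _ (J i n 0%N) (J i 0%N 0%N)
      (fun v => barrier eps b eta u B (z - a i * h + v)) (C + 2 * eta)) => //.
      by move=> D mD; exact: jump_law.
    by apply: (measurableT_comp (continuous_measurable_fun cW)); exact: measurable_funD.
  have z0 : 0 <= z / B.
    rewrite divr_ge0 ?(ltW B0)//; apply: le_trans zl.
    by rewrite /regime_lo; case: (i) => //; rewrite mulr_ge0// ltW.
  have z1 : z / B <= 1.
    rewrite ler_pdivrMr// mul1r; apply: le_trans zh _.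
    by rewrite /regime_hi; case: (i) => //; rewrite ger_pMl// ltW.
  have h2 := sqr_ge0 h.
  case: i zl zh => zl zh.
    apply: le_trans (super2 z h z0 z1 _ h0 h1) _.
      by rewrite /on_side subr_ge0 ler_pdivlMr.
    by rewrite lerD2l mulrDl lerDr mulr_ge0.
  apply: le_trans (super1 z h z0 z1 _ h0 h1) _.
    by rewrite /on_side subr_le0 ler_pdivrMr.
  by rewrite lerD2l mulrDl lerDl mulr_ge0.
- rewrite /barrier /profile mul0r clamp_id; [|lra|lra].
  have b2 : `|- b| <= 2 by apply: rng; lra.
  by rewrite sub0r; have := uu0 _ b2; rewrite ler_norml => /andP[+ _]; lra.
- move=> z Bz; rewrite /barrier /profile.
  have z1 : 1 < z / B by rewrite ltr_pdivlMr// mul1r.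
  have c1 : 1 <= clamp eps (z / B) by rewrite /clamp le_min le_max (ltW z1)/=; lra.
  have c2 := clamp_le eps (z / B).
  set v := clamp eps (z / B) - b.
  have v2 : `|v| <= 2 by rewrite ler_norml; apply/andP; split; rewrite /v; lra.
  have b2 : `|1 - b| <= 2 by apply: rng; lra.
  have := uu0 v v2; have := cont (1 - b) v b2 v2.
  rewrite (_ : v - (1 - b) = clamp eps (z / B) - 1); last by rewrite /v; ring.
  rewrite ger0_norm; last by rewrite subr_ge0.
  have ce : clamp eps (z / B) - 1 <= eps by lra.
  by move=> /(_ ce); rewrite !ler_norml => /andP[? _] /andP[? _]; lra.
Unshelve. all: by end_near.
Qed.

Let osc_solN p q v : osc_sol S (- p) (- q) v = - osc_sol S p q v.
Proof. by rewrite /osc_sol /sol; ring. Qed.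

(** [osc_sol] is linear in [(p, q)], so that the upper bound for [(- p, - q)] is the
    matching lower bound. *)
Let transform_cvg p q :
  osc_sol S p q (- b) * lo B + osc_sol S p q (1 - b) * up B @[B --> +oo%R] -->
  osc_sol S p q (x - b).
Proof.
apply/cvgrPdist_le => e e0; have e3 : 0 < e / 3 by rewrite divr_gt0.
near=> B.
have h1 : osc_sol S p q (- b) * lo B + osc_sol S p q (1 - b) * up B <=
    osc_sol S p q (x - b) + 3 * (e / 3) by near: B; exact: transform_le.
have h2 : osc_sol S (- p) (- q) (- b) * lo B + osc_sol S (- p) (- q) (1 - b) * up B <=
    osc_sol S (- p) (- q) (x - b) + 3 * (e / 3) by near: B; exact: transform_le.
by rewrite !osc_solN in h2; rewrite ler_norml; apply/andP; split; lra.
Unshelve. all: by end_near.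
Qed.

Let X B w := oscillating (b * B) (fun i n t => xi i n t w) (x * B).

Let EFin_cvg_near (f : R -> \bar R) (g : R -> R) l :
  (\forall B \near +oo%R, f B = (g B)%:E) -> g B @[B --> +oo%R] --> l ->
  f B @[B --> +oo%R] --> l%:E.
Proof.
move=> fg gl; apply: cvg_EFin; first by apply: filterS fg => B ->.
by apply: cvg_trans gl; apply: near_eq_cvg; apply: filterS fg => B /= ->.
Qed.

Let admissible : \forall B \near +oo%R, [/\ 0 < b * B, b * B < B, 0 < x * B, x * B <= B & 0 < s / B ^+ 2].
Proof.
near=> B; have B0 : 0 < B by near: B; apply: nbhs_pinfty_gt; exact: num_real.
split; [exact: mulr_gt0|by rewrite gtr_pMl|exact: mulr_gt0|by rewrite ger_pMl// ltW|].
by rewrite divr_gt0// exprn_gt0.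
Unshelve. all: by end_near.
Qed.

Lemma lower_cvg p q : osc_sol S p q (- b) = 1 -> osc_sol S p q (1 - b) = 0 ->
  exit_transform P (s / B ^+ 2) (X B) B [set w | exits_below (X B w) B] @[B --> +oo%R] -->
  (osc_sol S p q (x - b))%:E.
Proof.
move=> u0 u1; apply: EFin_cvg_near (filterS _ admissible) _ => [B [h1 h2 h3 h4 h5]|].
  exact: (lower_transformE a_gt0 lambda_gt0 copies indep h1 h2 h3 h4 h5).
have := @transform_cvg p q; rewrite u0 u1.
by under eq_fun do rewrite mul1r mul0r addr0.
Qed.

Lemma upper_cvg p q : osc_sol S p q (- b) = 0 -> osc_sol S p q (1 - b) = 1 ->
  exit_transform P (s / B ^+ 2) (X B) B [set w | exits_above (X B w) B] @[B --> +oo%R] -->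
  (osc_sol S p q (x - b))%:E.
Proof.
move=> u0 u1; apply: EFin_cvg_near (filterS _ admissible) _ => [B [h1 h2 h3 h4 h5]|].
  exact: (upper_transformE a_gt0 lambda_gt0 copies indep h1 h2 h3 h4 h5).
have := @transform_cvg p q; rewrite u0 u1.
by under eq_fun do rewrite mul1r mul0r add0r.
Qed.

End Limit.

(** * Evaluation by hyperbolic functions *)

Section Hyperbolic.
Context {R : realType}.
Implicit Types y z : R.

Lemma sinhN y : sinh (- y) = - sinh y.
Proof. by rewrite /sinh opprK; lra. Qed.

Lemma coshN y : cosh (- y) = cosh y.
Proof. by rewrite /cosh opprK addrC. Qed.

Lemma sinhB y z : sinh (y - z) = sinh y * cosh z - cosh y * sinh z.
Proof. by rewrite /sinh /cosh opprB !expRD; lra. Qed.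

Lemma sinh_gt0 y : 0 < y -> 0 < sinh y.
Proof. by move=> y0; rewrite divr_gt0// subr_gt0 ltr_expR; lra. Qed.

Lemma cosh_gt0 y : 0 < cosh y.
Proof. by rewrite divr_gt0// addr_gt0 ?expR_gt0. Qed.

End Hyperbolic.

Theorem corollary4 (R : realType) (d : measure_display)
  (Omega : measurableType d) (P : probability Omega R)
  (a lambda : bool -> R) (F : bool -> R -> R)
  (N : bool -> nat -> R -> {RV P >-> nat})
  (J : bool -> nat -> nat -> {RV P >-> R})
  (a_gt0 : forall i, 0 < a i)
  (lambda_gt0 : forall i, 0 < lambda i)
  (copies : forall i n, compound_poisson (lambda i) (F i) (N i n) (J i n))
  (indep : independent_family P
     (fun c : bool * nat => copy_sigma (N c.1 c.2) (J c.1 c.2)))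
  (x b s : R) (x_gt0 : 0 < x) (x_lt1 : x < 1) (b_gt0 : 0 < b) (b_lt1 : b < 1)
  (s_gt0 : 0 < s) :
  let xi i n := drifted_path (a i) (N i n) (J i n) in
  (forall i, 'E_P[xi i 0%N 1%R] = 0)%E ->
  (forall i, 'E_P[fun w => (xi i 0%N 1%R w ^+ 2)%R] < +oo)%E ->
  let sigma i := Num.sqrt (fine ('E_P[fun w => (xi i 0%N 1%R w ^+ 2)%R])%E) in
  let sigma1 := sigma below in
  let sigma2 := sigma above in
  let s1 := Num.sqrt (2 * s) / sigma1 in
  let s2 := Num.sqrt (2 * s) / sigma2 in
  let b' := 1 - b in
  let X B w := oscillating (b * B) (fun i n t => xi i n t w) (x * B) in
  let lower B :=
    exit_transform P (s / B ^+ 2) (X B) B [set w | exits_below (X B w) B] in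
  let upper B :=
    exit_transform P (s / B ^+ 2) (X B) B [set w | exits_above (X B w) B] in
  let den := sigma1 * sinh (b * s1) * cosh (b' * s2)
             + sigma2 * sinh (b' * s2) * cosh (b * s1) in
  (x <= b ->
     lower B @[B --> +oo%R] -->
       ((sigma1 * sinh ((b - x) * s1) * cosh (b' * s2)
         + sigma2 * sinh (b' * s2) * cosh ((b - x) * s1)) / den)%:E /\
     upper B @[B --> +oo%R] -->
       ((sigma1 * sinh (x * s1)) / den)%:E) /\
  (b <= x ->
     upper B @[B --> +oo%R] -->
       ((sigma1 * sinh (b * s1) * cosh ((x - b) * s2)
         + sigma2 * sinh ((x - b) * s2) * cosh (b * s1)) / den)%:E /\
     lower B @[B --> +oo%R] -->
       ((sigma2 * sinh ((1 - x) * s2)) / den)%:E).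
Proof.
move=> xi xi_mean xi_var sigma sigma1 sigma2 s1 s2 b' X lower upper den.
pose S i := Num.sqrt (2 * s) / sigma i.
have low p q : osc_sol S p q (- b) = 1 -> osc_sol S p q b' = 0 ->
    lower B @[B --> +oo%R] --> (osc_sol S p q (x - b))%:E.
  exact: (lower_cvg a_gt0 lambda_gt0 copies indep x_gt0 x_lt1 b_gt0 b_lt1 s_gt0 xi_mean xi_var).
have upp p q : osc_sol S p q (- b) = 0 -> osc_sol S p q b' = 1 ->
    upper B @[B --> +oo%R] --> (osc_sol S p q (x - b))%:E.
  exact: (upper_cvg a_gt0 lambda_gt0 copies indep x_gt0 x_lt1 b_gt0 b_lt1 s_gt0 xi_mean xi_var).
have sg i : 0 < sigma i := sigma_gt0 a_gt0 lambda_gt0 copies xi_mean xi_var i.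
have sg1 : 0 < sigma1 := sg below.
have sg2 : 0 < sigma2 := sg above.
pose t := Num.sqrt (2 * s).
have t0 : 0 < t by rewrite sqrtr_gt0 mulr_gt0.
have s10 : 0 < s1 by rewrite divr_gt0.
have s20 : 0 < s2 by rewrite divr_gt0.
have b'0 : 0 < b' by rewrite subr_gt0.
have denE : sigma1 * sinh (b * s1) * cosh (b' * s2) +
    sigma2 * sinh (b' * s2) * cosh (b * s1) = den by [].
have den0 : den != 0.
  apply: lt0r_neq0; apply: addr_gt0; apply: mulr_gt0; rewrite ?cosh_gt0 //;
    by rewrite mulr_gt0 // sinh_gt0 // mulr_gt0.
have uneg p q y : 0 <= y ->
    osc_sol S p (q * t) (- y) = p * cosh (y * s1) - q * sigma1 * sinh (y * s1).
  move=> y0; have [|-> _] := @osc_sol_side _ S p (q * t) below (- y); first by rewrite /= oppr_le0.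
  have qE : q * t / s1 = q * sigma1 by rewrite /s1 -/t; field; rewrite !lt0r_neq0.
  by rewrite /sol -/s1 qE mulrN sinhN coshN (mulrC s1) mulrN.
have upos p q y : 0 <= y ->
    osc_sol S p (q * t) y = p * cosh (y * s2) + q * sigma2 * sinh (y * s2).
  move=> y0; have [//|-> _] := @osc_sol_side _ S p (q * t) above y.
  have qE : q * t / s2 = q * sigma2 by rewrite /s2 -/t; field; rewrite !lt0r_neq0.
  by rewrite /sol -/s2 qE (mulrC s2).
(* [p] and [q] solve the linear system u (- b) = 1, u (1 - b) = 0; the factor [t]
   makes [q * t / s_i] equal to [q * sigma_i]. *)
have lowS : lower B @[B --> +oo%R] -->
    (osc_sol S (sigma2 * sinh (b' * s2) / den) (- cosh (b' * s2) / den * t) (x - b))%:E.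
  apply: low; [rewrite uneg ?(ltW b_gt0)//|rewrite upos ?(ltW b'0)//; ring].
  by apply: (mulIf den0); rewrite mul1r -[RHS]denE; field.
(* The same system with boundary values 0 and 1. *)
have uppS : upper B @[B --> +oo%R] -->
    (osc_sol S (sigma1 * sinh (b * s1) / den) (cosh (b * s1) / den * t) (x - b))%:E.
  apply: upp; [rewrite uneg ?(ltW b_gt0)//; ring|rewrite upos ?(ltW b'0)//].
  by apply: (mulIf den0); rewrite mul1r -[RHS]denE; field.
split=> [xb|bx].
  have y0 : 0 <= b - x by rewrite subr_ge0.
  have xE : x - b = - (b - x) by rewrite opprB.
  split.
    rewrite (_ : _ / den = osc_sol S (sigma2 * sinh (b' * s2) / den)
      (- cosh (b' * s2) / den * t) (x - b)) //.
    by rewrite xE uneg//; field.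
  rewrite (_ : _ / den = osc_sol S (sigma1 * sinh (b * s1) / den)
    (cosh (b * s1) / den * t) (x - b)) //.
  rewrite xE uneg// (_ : x * s1 = b * s1 - (b - x) * s1) ?sinhB; last by ring.
  by field.
have y0 : 0 <= x - b by rewrite subr_ge0.
split.
  rewrite (_ : _ / den = osc_sol S (sigma1 * sinh (b * s1) / den)
    (cosh (b * s1) / den * t) (x - b)) //.
  by rewrite upos//; field.
rewrite (_ : _ / den = osc_sol S (sigma2 * sinh (b' * s2) / den)
  (- cosh (b' * s2) / den * t) (x - b)) //.
rewrite upos// (_ : (1 - x) * s2 = b' * s2 - (x - b) * s2) ?sinhB; last by rewrite /b'; ring.
by field.
Qed.
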